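(* Let $r\ge 1$, $n=2^r$, and let $\epsilon\in(0,e^{-1}]$. Let $\mathbf{k}=(k_0,\ldots,k_{r-1})\in\mathbb{N}^r$, $k=k_0+\cdots+k_{r-1}$, and let $m_0,\ldots,m_{r-1}$ be integers with $1\le m_j\le |W_j|$. There exist absolute constants $C_0,C>0$ (independent of all parameters) such that the following holds. Suppose that $$m_j \ge C_0\left( k_j + \sum_{\substack{l=0\\ l\neq j}}^{r-1} 2^{-\frac{|j-l|}{2}} k_l\right)\log(\epsilon^{-1})\log(n),\qquad j=0,\ldots,r-1.$$ Let $x\in\mathbb{C}^n$, let $\Omega$ and $A=P_\Omega F$ be as in the context, let $e\in\mathbb{C}^m$ with $\|e\|_2\le\eta$, and let $y=Ax+e$. Then, with probability exceeding $1-k\epsilon$, every minimizer $\hat x$ of $$\min_{z\in\mathbb{C}^n}\|\Phi^* z\|_1\quad\text{subject to}\quad \|y-Az\|_2\le\eta$$ satisfies $$\|x-\hat x\|_2\le C\left(\eta\sqrt{D}\,(1+E\sqrt{k})+\sigma_{\mathbf{k},\mathbf{M}}(\Phi^* x)_1\right),$$ where $D=1+\dfrac{\sqrt{\log_2(6\epsilon^{-1})}}{\log_2(4En\sqrt{k})}$ and $E=\max_{j=0,\ldots,r-1}|W_j|/m_j$. If $m_j=|W_j|$ for all $j=0,\ldots,r-1$, then this conclusion holds with probability $1$.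
   Context: Signals $x=(x(t))_{t=0}^{n-1}\in\mathbb{C}^n$, $n=2^r$. The discrete Fourier transform is $\mathcal{F}x(\omega)=\frac{1}{\sqrt n}\sum_{t=0}^{n-1}x(t)e^{2\pi i\omega t/n}$, and $F\in\mathbb{C}^{n\times n}$ is the matrix with $Fx=(\mathcal{F}x(\omega))_{\omega=-n/2+1}^{n/2}$ (rows indexed by $\omega\in\{-n/2+1,\ldots,n/2\}$). The Haar basis of $\mathbb{C}^n$ consists of $\psi(t)=2^{-r/2}$ for $0\le t<2^r$, and, for $j=0,\ldots,r-1$, $p=0,\ldots,2^j-1$, $\phi_{j,p}(t)=2^{(j-r)/2}$ if $p2^{r-j}\le t<(p+\tfrac12)2^{r-j}$, $\phi_{j,p}(t)=-2^{(j-r)/2}$ if $(p+\tfrac12)2^{r-j}\le t<(p+1)2^{r-j}$, and $0$ otherwise. $\Phi\in\mathbb{C}^{n\times n}$ is the unitary matrix whose columns are these basis vectors in the order $\psi,\phi_{0,0},\phi_{1,0},\phi_{1,1},\phi_{2,0},\ldots,\phi_{r-1,2^{r-1}-1}$, so $c=\Phi^*x$ is the coefficient vector. It is divided into levels $c=(c^{(0)}|\cdots|c^{(r-1)})$ with $c^{(0)}=(\langle x,\psi\rangle,\langle x,\phi_{0,0}\rangle)\in\mathbb{C}^2$ and $c^{(j)}=(\langle x,\phi_{j,p}\rangle)_{p=0}^{2^j-1}\in\mathbb{C}^{2^j}$ for $j\ge1$; equivalently, with $M_0=0$, $M_j=2^j$ ($j=1,\ldots,r$), $c^{(j)}$ consists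 of the entries of $c$ with indices $M_j+1,\ldots,M_{j+1}$; $\mathbf{M}=(M_0,\ldots,M_{r-1})$. A vector $z\in\mathbb{C}^n$ is $(\mathbf{k},\mathbf{M})$-sparse in levels if $\|z^{(j)}\|_0\le k_j$ for all $j$; $\Sigma_{\mathbf{k},\mathbf{M}}$ is the set of such vectors, and $\sigma_{\mathbf{k},\mathbf{M}}(c)_1=\min_{z\in\Sigma_{\mathbf{k},\mathbf{M}}}\|c-z\|_1$. Frequency bands: $W_0=\{0,1\}$ and $W_j=\{-2^j+1,\ldots,-2^{j-1}\}\cup\{2^{j-1}+1,\ldots,2^j\}$ for $j=1,\ldots,r-1$ (so $|W_0|=2$, $|W_j|=2^j$, and these partition $\{-n/2+1,\ldots,n/2\}$). For each $j$, $\Omega_j\subseteq W_j$ is chosen uniformly at random among subsets of size $m_j$ (independently across $j$), $\Omega=\Omega_0\cup\cdots\cup\Omega_{r-1}$, $m=|\Omega|=m_0+\cdots+m_{r-1}$, and $P_\Omega\in\mathbb{C}^{m\times n}$ selects the entries of a vector (indexed by $\{-n/2+1,\ldots,n/2\}$) with indices in $\Omega$.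
   Formalization: ''Probability exceeding 1−kε'' is stated as probability at least 1−kε, because for k=0 the strict claim would demand probability above 1; for k≥1 the strict form follows by applying the result with ε² and enlarging C_0 and C. *)

(* Defs.v *)
From HB Require Import structures.
From mathcomp Require Import all_boot all_order all_algebra.
From mathcomp Require Import all_classical all_reals all_analysis.
From mathcomp Require Import complex.
Set Implicit Arguments. Unset Strict Implicit. Unset Printing Implicit Defensive.
Import Order.TTheory GRing.Theory Num.Theory.
Local Open Scope ring_scope.
Local Open Scope classical_set_scope.

Lemma pow2_gt0 (r : nat) : (0 < 2 ^ r)%N.
Proof. by rewrite expn_gt0. Qed.

Section Defs.
Variable R : realType.
Variable r : nat.

Definition idx0 : 'I_(2 ^ r) := Ordinal (pow2_gt0 r).

Definition cmod (z : R[i]) : R := Num.sqrt (complex.Re z ^+ 2 + complex.Im z ^+ 2).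

Definition norm1 (p : nat) (v : 'cV[R[i]]_p) : R := \sum_i cmod (v i ord0).
Definition norm2 (p : nat) (v : 'cV[R[i]]_p) : R :=
  Num.sqrt (\sum_i cmod (v i ord0) ^+ 2).

Definition expi (th : R) : R[i] := (cos th +i* sin th)%C.

(* Frequency indexing: row index i : 'I_n corresponds to frequency
   omega = i - n/2 + 1, so that omega ranges over {-n/2+1, ..., n/2}
   in increasing order. *)
Definition freq (i : 'I_(2 ^ r)) : int := (i : nat)%:Z - ((2 ^ r)./2)%:Z + 1.

Definition Fmx : 'M[R[i]]_(2 ^ r) :=
  \matrix_(i, t)
    (((Num.sqrt (2 ^ r)%:R)^-1)%:C%C *
      expi (2 * pi * (freq i)%:~R * (t : nat)%:R / (2 ^ r)%:R)).

Definition W (j : nat) : {set 'I_(2 ^ r)} :=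
  [set i | if j == 0%N then (freq i == 0) || (freq i == 1)
           else ((- (2 ^ j)%:Z + 1 <= freq i) && (freq i <= - (2 ^ j.-1)%:Z))
             || (((2 ^ j.-1)%:Z + 1 <= freq i) && (freq i <= (2 ^ j)%:Z))].

(* Haar basis: column index 0 is psi, column index 2^j + p is phi_{j,p}
   (0 <= p < 2^j).  haar b t = value at time t of the b-th basis vector. *)
Definition haar (b t : 'I_(2 ^ r)) : R :=
  if (b : nat) == 0%N then Num.sqrt ((2 ^+ r)^-1)
  else
    let j := trunc_log 2 b in
    let p := (b - 2 ^ j)%N in
    let L := (2 ^ (r - j))%N in
    if ((p * L <= t) && (t < p * L + L./2))%N then Num.sqrt (2 ^+ j / 2 ^+ r)
    else if ((p * L + L./2 <= t) && (t < p * L + L))%N then - Num.sqrt (2 ^+ j / 2 ^+ r)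
    else 0.

Definition Phi : 'M[R[i]]_(2 ^ r) := \matrix_(t, b) ((haar b t)%:C)%C.

Definition adjmx (p q : nat) (M : 'M[R[i]]_(p, q)) : 'M[R[i]]_(q, p) :=
  map_mx (@conjc R) (M^T).

(* level of a (0-based) coefficient index: level 0 = indices {0,1},
   level j >= 1 = indices {2^j, ..., 2^(j+1) - 1} (i.e. M_j+1..M_{j+1} 1-based) *)
Definition level (i : 'I_(2 ^ r)) : nat := if (i < 2)%N then 0%N else trunc_log 2 i.

Definition sparse_in_levels (k : 'I_r -> nat) (z : 'cV[R[i]]_(2 ^ r)) : Prop :=
  forall j : 'I_r, (#|[set i | (level i == j) && (z i ord0 != 0%R)]| <= k j)%N.

Definition sigma_kM (k : 'I_r -> nat) (c : 'cV[R[i]]_(2 ^ r)) : R :=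
  inf [set norm1 (c - z) | z in [set z | sparse_in_levels k z]].

(* Random sampling: a sample is a family (Omega_j)_j; it is admissible when
   Omega_j is a subset of W_j of size m_j.  The (independent, uniform)
   distribution is the uniform distribution on admissible families. *)
Definition sample := {ffun 'I_r -> {set 'I_(2 ^ r)}}.

Definition admissible (m : 'I_r -> nat) (Om : sample) : bool :=
  [forall j, (Om j \subset W j) && (#|Om j| == m j)].

Definition Omega (Om : sample) : {set 'I_(2 ^ r)} := \bigcup_(j < r) Om j.

Definition prob (m : 'I_r -> nat) (E : sample -> Prop) : R :=
  (#|[set Om : sample | admissible m Om && `[< E Om >]]|%:R
   / #|[set Om : sample | admissible m Om]|%:R)%R.

(* A = P_Omega F : rows of F indexed by the elements of Omega, in increasing
   order; msum = m_0 + ... + m_{r-1} = |Omega| *)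
Definition Amx (msum : nat) (Om : sample) : 'M[R[i]]_(msum, 2 ^ r) :=
  \matrix_(i, t) Fmx (nth idx0 (enum (Omega Om)) i) t.

Definition is_minimizer (msum : nat) (A : 'M[R[i]]_(msum, 2 ^ r))
    (y : 'cV[R[i]]_msum) (eta : R) (xh : 'cV[R[i]]_(2 ^ r)) : Prop :=
  norm2 (y - A *m xh) <= eta /\
  forall z : 'cV[R[i]]_(2 ^ r), norm2 (y - A *m z) <= eta ->
    norm1 (adjmx Phi *m xh) <= norm1 (adjmx Phi *m z).

End Defs.

Definition log2 {R : realType} (x : R) : R := ln x / ln 2.

(* Main.v *)
(* With U = F Phi, the coherence of U between frequency band i and Haar level l
   is O(2^-i 2^-|i-l|) and the norm of that block is O(2^(-|i-l|/2)).  Let D be a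
   best k-sparse-in-levels support of the coefficients of x and let h be the error
   in coefficients.  The golfing scheme is run in a model where L+1 = O(log k)
   independent stages select each row at random.  Each stage replaces a vector q
   supported on D by the D-part of q minus its reweighted sampled Gram image, and
   scalar Bernstein inequalities make this step contract by 1/8, both in sup norm
   and in l2 norm, for the finitely many vectors involved: the sign pattern of x
   on D, the unit vectors e_i with i in D, and the iterates of e_i with i outside D.
   Pairing h with the iterates of the sign pattern turns the cone condition given
   by minimality into a bound on the l1 mass of h off D.  Pairing h with the
   iterates of e_i for i in D gives h on D in terms of that mass and of the
   measurements; by adjunction the error term runs the stages backwards from the
   coordinates outside D, and its l2 norm decays geometrically, so that no operator
   norm concentration is needed.
   Finally, the stages select at most m_j rows in every band with probability at
   least 2^-r; given this, completing the selection uniformly to m_j rows per band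
   yields the uniform distribution on samples, hence the failure probability for
   uniform sampling is at most 2^r times that for the staged model. *)
Require Import Defs.
From HB Require Import structures.
From mathcomp Require Import all_boot all_order all_algebra fingroup perm.
From mathcomp Require Import all_classical all_reals all_analysis.
From mathcomp Require Import complex.
From mathcomp Require Import ring lra zify.
Set Implicit Arguments. Unset Strict Implicit. Unset Printing Implicit Defensive.
Import Order.TTheory GRing.Theory Num.Theory numFieldNormedType.Exports.
Local Open Scope ring_scope.

(** The obstacle is the budget of logarithms. Every stage needs a Bernstein exponent of order
    [log (1/eps) + log n] and there are about [log k] stages, while [m] offers only the product
    [log (1/eps) * log n]. This is enough because [log k] is at most each of the two factors:
    [k <= n] follows from the lower bounds on [m], and the probability bound is void when
    [k * eps >= 1]. The factor [2 ^ r = n] lost in the return to uniform sampling is polynomial in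
    [n], so a larger multiple of [log n] in the exponent pays for it. The weights of stage [s] grow
    at most like [2 ^ s] while its input has decayed like [8 ^ -s]; all series over the stages are
    therefore geometric, and no logarithm of [k] enters the error bound. Constants: coherence holds
    with [mu = 64] and the block norms with [nu = 256]. An oversampling of [2 ^ 32] relative to the
    exponent gives the contraction 1/8, and [2 ^ 43] is this times [2 ^ 11], which covers the number
    of stages times the exponent. Finally [16389 = 1 + 2 * (2 + 128 * 64)]. *)

Section Modulus.
Variable R : realType.
Implicit Types (x y : R[i]) (a b : R).

Lemma cmodE x : cmod x = Normc.normc x.
Proof. by case: x. Qed.

Lemma cmod_ge0 x : 0 <= cmod x.
Proof. exact: sqrtr_ge0. Qed.

Lemma cmod0 : cmod (0 : R[i]) = 0.
Proof. by rewrite cmodE Normc.normc0. Qed.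

Lemma cmod1 : cmod (1 : R[i]) = 1.
Proof. by rewrite cmodE Normc.normc1. Qed.

Lemma cmod_eq0 x : (cmod x == 0) = (x == 0).
Proof.
apply/eqP/eqP => [|->]; last exact: cmod0.
by rewrite cmodE => /Normc.eq0_normc.
Qed.

Lemma cmodM x y : cmod (x * y) = cmod x * cmod y.
Proof. by rewrite !cmodE Normc.normcM. Qed.

Lemma cmodV x : cmod x^-1 = (cmod x)^-1.
Proof. by rewrite !cmodE Normc.normcV. Qed.

Lemma cmodN x : cmod (- x) = cmod x.
Proof. by rewrite -mulN1r cmodM /cmod /= oppr0 expr0n addr0 sqrrN expr1n sqrtr1 mul1r. Qed.

Lemma cmodB x y : cmod (x - y) = cmod (y - x).
Proof. by rewrite -cmodN opprB. Qed.

Lemma cmodD x y : cmod (x + y) <= cmod x + cmod y.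
Proof. by rewrite !cmodE; exact: le_normcD. Qed.

Lemma cmod_sum (I : Type) (s : seq I) (P : pred I) (F : I -> R[i]) :
  cmod (\sum_(i <- s | P i) F i) <= \sum_(i <- s | P i) cmod (F i).
Proof.
elim/big_ind2: _ => [|x1 x2 y1 y2 h1 h2|//]; first by rewrite cmod0.
exact: le_trans (cmodD _ _) (lerD h1 h2).
Qed.

Lemma cmodJ x : cmod x^*%C = cmod x.
Proof. by case: x => a b; rewrite /cmod /= sqrrN. Qed.

Lemma cmodR a : cmod (a%:C%C) = `|a|.
Proof. by rewrite /cmod /= expr0n addr0 sqrtr_sqr. Qed.

Lemma cmod_sqr x : (cmod x ^+ 2)%:C%C = x * x^*%C.
Proof.
case: x => a b; rewrite /cmod sqr_sqrtr /=; last by rewrite addr_ge0 ?sqr_ge0.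
by apply/eqP; rewrite eq_complex /= ; apply/andP; split; apply/eqP; ring.
Qed.

Lemma Re_le_cmod x : `|complex.Re x| <= cmod x.
Proof. by rewrite -sqrtr_sqr ler_wsqrtr // lerDl sqr_ge0. Qed.

Lemma Im_le_cmod x : `|complex.Im x| <= cmod x.
Proof. by rewrite -sqrtr_sqr ler_wsqrtr // lerDr sqr_ge0. Qed.

Lemma cmod_le_ReIm x : cmod x <= `|complex.Re x| + `|complex.Im x|.
Proof.
rewrite -(@ler_pXn2r _ 2) ?nnegrE ?cmod_ge0 ?addr_ge0 //.
rewrite sqr_sqrtr ?addr_ge0 ?sqr_ge0 // sqrrD !real_normK ?num_real //.
by rewrite lerD2r lerDl mulrn_wge0 ?mulr_ge0.
Qed.

Lemma complex_ReD x y : complex.Re (x + y) = complex.Re x + complex.Re y.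
Proof. by case: x; case: y. Qed.

Lemma complex_ImD x y : complex.Im (x + y) = complex.Im x + complex.Im y.
Proof. by case: x; case: y. Qed.

Lemma complex_Re_sum (I : Type) (s : seq I) (P : pred I) (F : I -> R[i]) :
  complex.Re (\sum_(i <- s | P i) F i) = \sum_(i <- s | P i) complex.Re (F i).
Proof. by elim/big_rec2: _ => // i x y _ <-; rewrite complex_ReD. Qed.

Lemma complex_Im_sum (I : Type) (s : seq I) (P : pred I) (F : I -> R[i]) :
  complex.Im (\sum_(i <- s | P i) F i) = \sum_(i <- s | P i) complex.Im (F i).
Proof. by elim/big_rec2: _ => // i x y _ <-; rewrite complex_ImD. Qed.

Lemma complex_ReM a x : complex.Re (a%:C%C * x) = a * complex.Re x.
Proof. by case: x => u v /=; rewrite mul0r subr0. Qed.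

Lemma complex_ImM a x : complex.Im (a%:C%C * x) = a * complex.Im x.
Proof. by case: x => u v /=; rewrite mul0r addr0. Qed.

Lemma sum_realC (I : Type) (s : seq I) (P : pred I) (F : I -> R) :
  (\sum_(i <- s | P i) F i)%:C%C = \sum_(i <- s | P i) (F i)%:C%C.
Proof. exact: raddf_sum. Qed.

Lemma sum_conj (I : Type) (s : seq I) (P : pred I) (F : I -> R[i]) :
  (\sum_(i <- s | P i) F i)^*%C = \sum_(i <- s | P i) (F i)^*%C.
Proof. exact: raddf_sum. Qed.

Lemma cconjM x y : (x * y)^*%C = x^*%C * y^*%C.
Proof. exact: rmorphM. Qed.

Lemma cconjB x y : (x - y)^*%C = x^*%C - y^*%C.
Proof. exact: rmorphB. Qed.

Lemma cconjR a : (a%:C%C)^*%C = a%:C%C.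
Proof. exact: conjc_real. Qed.

End Modulus.

(** * Euclidean seminorms over subsets of a finite index set *)

Section L2.
Variables (R : realType) (T : finType).
Implicit Types (D : {set T}) (p q : T -> R[i]).

(** Lagrange's identity: twice the defect is the double sum of the squares of
    [a i * b j - a j * b i]. *)
Lemma cauchy_schwarz (D : {pred T}) (a b : T -> R) :
  (\sum_(i in D) a i * b i) ^+ 2
    <= (\sum_(i in D) a i ^+ 2) * (\sum_(i in D) b i ^+ 2).
Proof.
rewrite -subr_ge0 -(@pmulr_rge0 _ 2) //.
have -> : 2 * ((\sum_(i in D) a i ^+ 2) * (\sum_(i in D) b i ^+ 2)
            - (\sum_(i in D) a i * b i) ^+ 2)
  = \sum_(i in D) \sum_(j in D) (a i * b j - a j * b i) ^+ 2.
  have e1 : \sum_(i in D) \sum_(j in D) a i ^+ 2 * b j ^+ 2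
     = (\sum_(i in D) a i ^+ 2) * (\sum_(i in D) b i ^+ 2).
    by rewrite big_distrl /=; apply: eq_bigr => i _; rewrite big_distrr.
  have e2 : \sum_(i in D) \sum_(j in D) a j ^+ 2 * b i ^+ 2
     = (\sum_(i in D) a i ^+ 2) * (\sum_(i in D) b i ^+ 2).
    by rewrite exchange_big.
  have e3 : \sum_(i in D) \sum_(j in D) (a i * b i) * (a j * b j)
     = (\sum_(i in D) a i * b i) ^+ 2.
    by rewrite expr2 big_distrl /=; apply: eq_bigr => i _; rewrite big_distrr.
  rewrite mulrBr mulr_natl mulr2n -{1}e1 -{1}e2 -e3 -big_split /= mulr_sumr -sumrB.
  apply: eq_bigr => i _; rewrite -big_split /= mulr_sumr -sumrB; apply: eq_bigr => j _.
  by rewrite /=; ring.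
by apply: sumr_ge0 => i _; apply: sumr_ge0 => j _; exact: sqr_ge0.
Qed.

Definition l2 D q : R := Num.sqrt (\sum_(i in D) cmod (q i) ^+ 2).

Lemma l2_ge0 D q : 0 <= l2 D q.
Proof. exact: sqrtr_ge0. Qed.

Lemma l2_sqr D q : l2 D q ^+ 2 = \sum_(i in D) cmod (q i) ^+ 2.
Proof. by rewrite sqr_sqrtr // sumr_ge0 // => i _; exact: sqr_ge0. Qed.

Lemma eq_l2 D p q : (forall i, i \in D -> cmod (p i) = cmod (q i)) -> l2 D p = l2 D q.
Proof. by move=> h; congr Num.sqrt; apply: eq_bigr => i /h ->. Qed.

Lemma l2_bound D q (B : R) : 0 <= B -> \sum_(i in D) cmod (q i) ^+ 2 <= B ^+ 2 -> l2 D q <= B.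
Proof. by move=> B0 h; rewrite -(ger0_norm B0) -sqrtr_sqr ler_wsqrtr. Qed.

Lemma l2_sub D D' q : D \subset D' -> l2 D q <= l2 D' q.
Proof.
move=> sDD'; rewrite ler_wsqrtr // [leRHS](big_setID D) /= (finset.setIidPr sDD').
by rewrite lerDl sumr_ge0 // => i _; exact: sqr_ge0.
Qed.

Lemma cmod_sum_le D p q :
  \sum_(i in D) cmod (p i) * cmod (q i) <= l2 D p * l2 D q.
Proof.
rewrite -(@ler_pXn2r _ 2) ?nnegrE ?mulr_ge0 ?l2_ge0 //; last first.
  by apply: sumr_ge0 => i _; rewrite mulr_ge0 ?cmod_ge0.
by rewrite exprMn !l2_sqr; exact: cauchy_schwarz.
Qed.

Lemma cmod_ip_le D p q : cmod (\sum_(i in D) p i * q i) <= l2 D p * l2 D q.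
Proof.
apply: le_trans (cmod_sum_le D p q); apply: le_trans (cmod_sum _ _ _) _.
by under eq_bigr do rewrite cmodM.
Qed.

Lemma l2D D p q : l2 D (fun i => p i + q i) <= l2 D p + l2 D q.
Proof.
apply: l2_bound; first by rewrite addr_ge0 ?l2_ge0.
rewrite sqrrD !l2_sqr -mulr_natl.
apply: (@le_trans _ _ (\sum_(i in D) (cmod (p i) ^+ 2 + 2 * (cmod (p i) * cmod (q i)) + cmod (q i) ^+ 2))).
  apply: ler_sum => i _.
  have := cmodD (p i) (q i); have := cmod_ge0 (p i + q i) => h1 h2.
  apply: (@le_trans _ _ ((cmod (p i) + cmod (q i)) ^+ 2)).
    by rewrite ler_pXn2r ?nnegrE ?addr_ge0 ?cmod_ge0.
  by rewrite sqrrD mulr_natl.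
rewrite !big_split /= lerD2r lerD2l -mulr_sumr ler_wpM2l //.
exact: cmod_sum_le.
Qed.

Lemma l2_0 D : l2 D (fun=> 0) = 0.
Proof. by rewrite /l2 big1 ?sqrtr0 // => i _; rewrite cmod0 expr0n. Qed.

Lemma l2_sum D (I : Type) (s : seq I) (P : pred I) (F : I -> T -> R[i]) :
  l2 D (fun i => \sum_(j <- s | P j) F j i) <= \sum_(j <- s | P j) l2 D (F j).
Proof.
elim: s => [|x s IHs].
  by rewrite big_nil (@eq_l2 _ _ (fun=> 0)) ?l2_0 // => i _; rewrite big_nil.
rewrite big_cons; case: ifP => Px.
  apply: le_trans (lerD (lexx _) IHs); apply: le_trans (l2D _ _ _).
  by rewrite (@eq_l2 _ _ (fun i => F x i + \sum_(j <- s | P j) F j i)) // => i _; rewrite big_cons Px.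
apply: le_trans IHs.
by rewrite (@eq_l2 _ _ (fun i => \sum_(j <- s | P j) F j i)) // => i _; rewrite big_cons Px.
Qed.

Lemma l2Z D (c : R[i]) q : l2 D (fun i => c * q i) = cmod c * l2 D q.
Proof.
rewrite /l2; under eq_bigr do rewrite cmodM exprMn.
by rewrite -mulr_sumr sqrtrM ?sqr_ge0 // sqrtr_sqr ger0_norm ?cmod_ge0.
Qed.

Lemma l2_le_l1 D q : l2 D q <= \sum_(i in D) cmod (q i).
Proof.
have l1_ge0 : 0 <= \sum_(i in D) cmod (q i) by rewrite sumr_ge0 // => i _; exact: cmod_ge0.
apply: l2_bound => //; rewrite expr2 big_distrl /=; apply: ler_sum => i iD.
rewrite expr2 ler_wpM2l ?cmod_ge0 // (bigD1 i) //= lerDl sumr_ge0 // => j _.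
exact: cmod_ge0.
Qed.

Lemma l2_le_sup D q (B : R) (k : nat) : (#|D| <= k)%N -> 0 <= B ->
  (forall i, i \in D -> cmod (q i) <= B) -> l2 D q <= Num.sqrt k%:R * B.
Proof.
move=> Dk B0 h; apply: l2_bound; first by rewrite mulr_ge0 ?sqrtr_ge0.
rewrite exprMn sqr_sqrtr ?ler0n //.
apply: (@le_trans _ _ (\sum_(i in D) B ^+ 2)).
  by apply: ler_sum => i iD; rewrite ler_pXn2r ?nnegrE ?cmod_ge0 // h.
rewrite sumr_const -[leLHS]mulr_natl ler_wpM2r ?sqr_ge0 // ler_nat //.
Qed.

Lemma l2TE q : l2 [set: T] q = Num.sqrt (\sum_i cmod (q i) ^+ 2).
Proof. by congr Num.sqrt; apply: eq_bigl => i; rewrite inE. Qed.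

Lemma l2_split D q : l2 [set: T] q <= l2 D q + l2 (~: D) q.
Proof.
apply: l2_bound; first by rewrite addr_ge0 ?l2_ge0.
rewrite sqrrD !l2_sqr (bigID (mem D)) /=.
rewrite (eq_bigl (mem D)); last by move=> i; rewrite inE.
rewrite [X in _ + X](eq_bigl (mem (~: D))); last by move=> i; rewrite !inE.
by rewrite lerD2r lerDl mulrn_wge0 ?mulr_ge0 ?l2_ge0.
Qed.

End L2.

(** * Independent Bernoulli selections and Bernstein inequalities *)

Section Bernoulli.
Variables (R : realType) (T : finType) (pr : T -> R).
Hypothesis pr_gt0 : forall t, 0 < pr t.
Hypothesis pr_le1 : forall t, pr t <= 1.

Local Notation sp := {ffun T -> bool}.

(** The product law in which [t] is selected with probability [pr t]. Expectation [bE] and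
    probability [bP] are finite sums against it. *)
Definition bwt (f : sp) : R := \prod_t (if f t then pr t else 1 - pr t).
Definition bE (g : sp -> R) : R := \sum_f bwt f * g f.
Definition bP (A : pred sp) : R := bE (fun f => (A f)%:R).

Lemma bwt_ge0 f : 0 <= bwt f.
Proof. by apply: prodr_ge0 => t _; case: (f t); rewrite ?subr_ge0 // ltW. Qed.

Lemma bE_prod (phi : T -> bool -> R) :
  bE (fun f => \prod_t phi t (f t)) = \prod_t (pr t * phi t true + (1 - pr t) * phi t false).
Proof.
transitivity (\prod_t \sum_(b : bool) (if b then pr t else 1 - pr t) * phi t b); last first.
  by apply: eq_bigr => t _; rewrite big_bool.
by rewrite bigA_distr_bigA; apply: eq_bigr => f _; rewrite /bwt -big_split.
Qed.

Lemma sum_bwt : \sum_f bwt f = 1.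
Proof.
have := bE_prod (fun _ _ => 1); rewrite [RHS]big1 => [<-|t _]; last by rewrite !mulr1 addrC subrK.
by apply: eq_bigr => f _; rewrite [X in _ * X]big1 ?mulr1.
Qed.

Lemma bE_le (g h : sp -> R) : (forall f, g f <= h f) -> bE g <= bE h.
Proof. by move=> gh; apply: ler_sum => f _; rewrite ler_wpM2l ?bwt_ge0. Qed.

Lemma bE_const (c : R) : bE (fun=> c) = c.
Proof. by rewrite /bE -mulr_suml sum_bwt mul1r. Qed.

Lemma bEZ (c : R) g : bE (fun f => c * g f) = c * bE g.
Proof. by rewrite /bE mulr_sumr; apply: eq_bigr => f _; rewrite mulrCA. Qed.

Lemma bE_sum (I : Type) (s : seq I) (P : pred I) (g : I -> sp -> R) :
  bE (fun f => \sum_(i <- s | P i) g i f) = \sum_(i <- s | P i) bE (g i).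
Proof. by rewrite /bE exchange_big /=; apply: eq_bigr => f _; rewrite mulr_sumr. Qed.

Lemma bP_mono (A B : pred sp) : (forall f, A f -> B f) -> bP A <= bP B.
Proof.
move=> AB; apply: bE_le => f; rewrite ler_nat; have := AB f.
by case: (A f) => // ->.
Qed.

Lemma bP_union (I : finType) (A : I -> pred sp) :
  bP (fun f => [exists i, A i f]) <= \sum_i bP (A i).
Proof.
rewrite -bE_sum; apply: bE_le => f; rewrite -natr_sum ler_nat.
case: existsP => //= -[i Ai]; rewrite (bigD1 i) //= Ai; lia.
Qed.

Lemma bP_or (A B : pred sp) : bP (fun f => A f || B f) <= bP A + bP B.
Proof.
rewrite /bP /bE -big_split /=; apply: ler_sum => f _; rewrite -mulrDr ler_wpM2l ?bwt_ge0 //.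
by rewrite -natrD ler_nat; case: (A f); case: (B f).
Qed.

Lemma bP_not A : bP (fun f => ~~ A f) = 1 - bP A.
Proof.
apply/eqP; rewrite eq_sym subr_eq -sum_bwt /bP /bE -big_split /=; apply/eqP/eq_bigr => f _.
by rewrite -mulrDr -natrD; case: (A f); rewrite mulr1.
Qed.

(* Exchanging coordinates between two independent copies preserves their joint
   law; this replaces conditioning on a block of coordinates. *)
Definition bmix (A : {set T}) (f f' : sp) : sp := [ffun t => if t \in A then f t else f' t].

Lemma bwt_mix A f f' : bwt (bmix A f f') * bwt (bmix A f' f) = bwt f * bwt f'.
Proof.
rewrite /bwt -!big_split; apply: eq_bigr => t _; rewrite !ffunE.
by case: (t \in A); rewrite //= mulrC.
Qed.

Lemma bE2_mix (A : {set T}) (H : sp -> sp -> R) :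
  \sum_f \sum_f' bwt f * bwt f' * H f f'
  = \sum_f \sum_f' bwt f * bwt f' * H (bmix A f f') (bmix A f' f).
Proof.
rewrite !pair_bigA /=.
pose s (p : sp * sp) := (bmix A p.1 p.2, bmix A p.2 p.1).
have sK : involutive s.
  by move=> [f f']; rewrite /s /=; congr pair; apply/ffunP => t; rewrite !ffunE; case: (t \in A).
rewrite (reindex_inj (inv_inj sK)); apply: eq_bigr => -[f f'] _ /=.
by rewrite bwt_mix.
Qed.

(** For two independent copies, the exchange along [A] turns [g f * h f'] into [g f * h f], and the
    second copy sums to 1. *)
Lemma bE_indep (A : {set T}) (g h : sp -> R) :
  (forall f f' : sp, (forall t, t \in A -> f t = f' t) -> g f = g f') ->
  (forall f f' : sp, (forall t, t \notin A -> f t = f' t) -> h f = h f') ->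
  bE (fun f => g f * h f) = bE g * bE h.
Proof.
move=> gA hA; rewrite {2}/bE big_distrl /=.
under [RHS]eq_bigr do rewrite /bE big_distrr /=.
transitivity (\sum_f \sum_f' bwt f * bwt f' * (g f * h f')); last first.
  by apply: eq_bigr => f _; apply: eq_bigr => f' _; rewrite mulrACA.
rewrite (bE2_mix A); apply: eq_bigr => f _.
rewrite -[LHS]mulr1 -sum_bwt mulr_sumr; apply: eq_bigr => f' _.
rewrite (gA _ f) ?(hA _ f); first by ring.
- by move=> t tA; rewrite ffunE (negPf tA).
- by move=> t tA; rewrite ffunE tA.
Qed.

(** The conditional form of a probability bound: coordinates off [A] are frozen at [f] and those in
    [A] are drawn afresh. It lets a stage be analysed with its input vector fixed. *)
Lemma bP_resample (A : {set T}) (E : pred sp) (d : R) :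
  (forall f, bP (fun f' => E (bmix A f' f)) <= d) -> bP E <= d.
Proof.
move=> hE; rewrite -(bE_const d).
have -> : bP E = \sum_f \sum_f' bwt f * bwt f' * (E f')%:R.
  rewrite exchange_big /=; apply: eq_bigr => f' _.
  rewrite -[LHS]mul1r -sum_bwt mulr_suml; apply: eq_bigr => f _; ring.
rewrite (bE2_mix A); apply: ler_sum => f _.
have -> : \sum_f' bwt f * bwt f' * (E (bmix A f' f))%:R = bwt f * bP (fun f' => E (bmix A f' f)).
  by rewrite /bP /bE mulr_sumr; apply: eq_bigr => f' _; rewrite mulrA.
by rewrite ler_wpM2l ?bwt_ge0.
Qed.

(** From [1 - x/2 <= exp (- x/2)] one gets [exp x * (1 - x/2) ^ 2 <= 1]; the quadratic times
    [(1 - x/2) ^ 2] exceeds 1 by a product of nonnegative factors. *)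
Lemma expR_le_quad (x : R) : x <= 1 -> expR x <= 1 + x + 2 * x ^+ 2.
Proof.
move=> x1; set u := 1 - x / 2; have u0 : 0 < u by rewrite /u; lra.
have eu : expR x * u ^+ 2 <= 1.
  have h : u <= expR (- (x / 2)) by have := expR_ge1Dx (- (x / 2)); rewrite /u; lra.
  have -> : expR x = expR (x / 2) ^+ 2 by rewrite -expRM_natl; congr expR; lra.
  rewrite -exprMn expr_le1 //; last by rewrite mulr_ge0 ?expR_ge0 // ltW.
  by apply: le_trans (ler_wpM2l (expR_ge0 _) h) _; rewrite expRxMexpNx_1.
rewrite -(@ler_pM2r _ (u ^+ 2)) ?exprn_gt0 //; apply: le_trans eu _.
rewrite -subr_ge0; have -> : (1 + x + 2 * x ^+ 2) * u ^+ 2 - 1 = x ^+ 2 / 4 * ((1 - x) * (5 - 2 * x)).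
  by rewrite /u; field.
by rewrite mulr_ge0 ?divr_ge0 ?sqr_ge0 // mulr_ge0; lra.
Qed.

(** Centred, because [f t / pr t] has mean 1. *)
Definition bdev (x : T -> R) (f : sp) : R := \sum_t ((f t)%:R / pr t - 1) * x t.

(** The bound on [y] keeps both exponents at most 1, so [expR_le_quad] applies. The linear terms
    cancel and the quadratic ones add up to [2 * y ^ 2 * (1 - p) / p]. *)
Lemma bernoulli_mgf (p y : R) : 0 < p -> p <= 1 -> `|y| <= p ->
  p * expR ((1 / p - 1) * y) + (1 - p) * expR ((0 / p - 1) * y) <= expR (2 * (y ^+ 2 / p)).
Proof.
move=> p0 p1 yp.
have /andP[yl yr] : - p <= y <= p by rewrite -ler_norml.
have h1 : expR ((1 / p - 1) * y) <= 1 + (1 / p - 1) * y + 2 * ((1 / p - 1) * y) ^+ 2.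
  apply: expR_le_quad.
  have -> : (1 / p - 1) * y = y * (1 - p) / p by field; rewrite gt_eqF.
  rewrite ler_pdivrMr // mul1r; nra.
have h0 : expR ((0 / p - 1) * y) <= 1 + (0 / p - 1) * y + 2 * ((0 / p - 1) * y) ^+ 2.
  by apply: expR_le_quad; rewrite mul0r; lra.
apply: (le_trans (lerD (ler_wpM2l (ltW p0) h1) (ler_wpM2l _ h0))); first by lra.
apply: le_trans (expR_ge1Dx _).
rewrite -subr_ge0 [leRHS](_ : _ = 2 * y ^+ 2); last by field; rewrite gt_eqF.
by rewrite mulr_ge0 ?sqr_ge0.
Qed.

Lemma bernstein_upper (x : T -> R) (tau lam : R) : 0 < lam ->
  (forall t, lam * `|x t| <= pr t) ->
  bP (fun f => tau <= bdev x f)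
    <= expR (- (lam * tau) + 2 * lam ^+ 2 * \sum_t x t ^+ 2 / pr t).
Proof.
move=> lam0 hx.
apply: (@le_trans _ _ (bE (fun f => expR (- (lam * tau)) * expR (lam * bdev x f)))).
  apply: bE_le => f; case: (leP tau) => h /=; last by rewrite mulr_ge0 ?expR_ge0.
  rewrite -expRD -expR0 ler_expR addrC subr_ge0 ler_wpM2l // ltW //.
rewrite bEZ expRD ler_wpM2l ?expR_ge0 //.
have -> : (fun f => expR (lam * bdev x f))
    = (fun f : sp => \prod_t expR (((f t)%:R / pr t - 1) * (lam * x t))).
  apply/funext => f; rewrite -expR_sum /bdev mulr_sumr; congr expR.
  by apply: eq_bigr => t _; ring.
rewrite (bE_prod (fun t (b : bool) => expR ((b%:R / pr t - 1) * (lam * x t)))).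
rewrite mulr_sumr expR_sum; apply: ler_prod => t _; apply/andP; split.
  by rewrite addr_ge0 ?mulr_ge0 ?expR_ge0 // ?subr_ge0 // ltW.
apply: le_trans (@bernoulli_mgf (pr t) (lam * x t) _ _ _) _ => //.
  by rewrite normrM gtr0_norm.
by rewrite ler_expR exprMn !mulrA.
Qed.

(** With [lam = 2 * L / tau] the Chernoff exponent is [- 2 * L] plus [L] times a ratio that the
    variance hypothesis bounds by 1. *)
Lemma bernstein_upper' (x : T -> R) (tau L : R) : 0 < tau -> 0 < L ->
  8 * L * \sum_t x t ^+ 2 / pr t <= tau ^+ 2 ->
  (forall t, 2 * L * `|x t| / pr t <= tau) ->
  bP (fun f => tau <= bdev x f) <= expR (- L).
Proof.
move=> tau0 L0 hV hM; set V := \sum_t _ in hV.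
apply: le_trans (@bernstein_upper x tau (2 * L / tau) _ _) _; first by rewrite divr_gt0 ?mulr_gt0.
  move=> t; have := hM t; rewrite ler_pdivrMr // => h.
  have -> : 2 * L / tau * `|x t| = 2 * L * `|x t| / tau by ring.
  by rewrite ler_pdivrMr // mulrC [pr t * _]mulrC; rewrite mulrC in h.
rewrite -/V ler_expR.
have -> : - (2 * L / tau * tau) + 2 * (2 * L / tau) ^+ 2 * V
   = - (2 * L) + L * (8 * L * V / tau ^+ 2) by field; rewrite gt_eqF.
have : 8 * L * V / tau ^+ 2 <= 1 by rewrite ler_pdivrMr ?exprn_gt0 // mul1r.
by nra.
Qed.

Lemma bdevN x f : bdev (fun t => - x t) f = - bdev x f.
Proof. by rewrite /bdev -sumrN; apply: eq_bigr => t _; rewrite mulrN. Qed.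

Definition bdevC (z : T -> R[i]) (f : sp) : R[i] :=
  \sum_t ((f t)%:R / pr t - 1)%:C%C * z t.

(** Four one-sided bounds, for plus and minus the real and imaginary parts. The value [tau = 0] is
    allowed, since a threshold may vanish; the last hypothesis then forces [z = 0]. *)
Lemma bernstein_complex (z : T -> R[i]) (tau L : R) : 0 <= tau -> 0 < L ->
  8 * L * \sum_t cmod (z t) ^+ 2 / pr t <= tau ^+ 2 ->
  (forall t, 2 * L * cmod (z t) / pr t <= tau) ->
  bP (fun f => ~~ (cmod (bdevC z f) <= 2 * tau)) <= 4 * expR (- L).
Proof.
rewrite le_eqVlt => /predU1P[<-|tau0] L0 hV hM.
  have z0 t : z t = 0.
    apply/eqP; rewrite -cmod_eq0 eq_le cmod_ge0 andbT.
    have := hM t; rewrite pmulr_lle0 ?invr_gt0 // pmulr_rle0 //; lra.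
  apply: (@le_trans _ _ (bE (fun=> 0))); last by rewrite bE_const mulr_ge0 ?expR_ge0.
  apply: bE_le => f; rewrite /bdevC big1 ?cmod0 ?mulr0 ?lexx // => t _.
  by rewrite z0 mulr0.
pose re t := complex.Re (z t); pose im t := complex.Im (z t).
have part (x : T -> R) : (forall t, `|x t| <= cmod (z t)) ->
    bP (fun f => tau <= bdev x f) <= expR (- L).
  move=> hx; apply: bernstein_upper' => //.
    apply: le_trans hV; rewrite ler_wpM2l ?mulr_ge0 ?(ltW L0) //.
    apply: ler_sum => t _; rewrite ler_wpM2r ?invr_ge0 ?(ltW (pr_gt0 t)) //.
    by rewrite -real_normK ?num_real // ler_pXn2r ?nnegrE ?cmod_ge0.
  move=> t; apply: le_trans (hM t); rewrite ler_wpM2r ?invr_ge0 ?(ltW (pr_gt0 t)) //.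
  by rewrite ler_wpM2l ?mulr_ge0 ?(ltW L0).
have hre := part re (fun t => Re_le_cmod _).
have him := part im (fun t => Im_le_cmod _).
have hren : bP (fun f => tau <= bdev (fun t => - re t) f) <= expR (- L).
  by apply: part => t; rewrite normrN; exact: Re_le_cmod.
have himn : bP (fun f => tau <= bdev (fun t => - im t) f) <= expR (- L).
  by apply: part => t; rewrite normrN; exact: Im_le_cmod.
apply: (@le_trans _ _ (bP (fun f => ((tau <= bdev re f) || (tau <= bdev (fun t => - re t) f))
   || ((tau <= bdev im f) || (tau <= bdev (fun t => - im t) f))))); last first.
  apply: le_trans (bP_or _ _) _.
  have := lerD (le_trans (bP_or _ _) (lerD hre hren)) (le_trans (bP_or _ _) (lerD him himn)).
  by move/le_trans; apply; lra.
apply: bP_mono => f; apply: contraR; rewrite !negb_or -!ltNge => /andP[/andP[h1 h2] /andP[h3 h4]].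
rewrite !bdevN in h2 h4.
apply: le_trans (cmod_le_ReIm _) _.
have -> : complex.Re (bdevC z f) = bdev re f.
  by rewrite /bdevC complex_Re_sum; apply: eq_bigr => t _; rewrite complex_ReM.
have -> : complex.Im (bdevC z f) = bdev im f.
  by rewrite /bdevC complex_Im_sum; apply: eq_bigr => t _; rewrite complex_ImM.
have : `|bdev re f| <= tau by rewrite ler_norml; apply/andP; split; lra.
have : `|bdev im f| <= tau by rewrite ler_norml; apply/andP; split; lra.
by lra.
Qed.

End Bernoulli.

(** * The decay kernel between levels *)

Section Kernel.
Variable R : realType.

(** This is [2 ^ (- |j - l| / 2)], in the shape in which it appears in the sampling condition. *)
Definition dk (j l : nat) : R := (Num.sqrt (2 ^+ (maxn j l - minn j l)))^-1.

Lemma dk_sym j l : dk j l = dk l j.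
Proof. by rewrite /dk maxnC minnC. Qed.

Lemma dk_gt0 j l : 0 < dk j l.
Proof. by rewrite /dk invr_gt0 sqrtr_gt0 exprn_gt0. Qed.

Lemma dk_ge0 j l : 0 <= dk j l.
Proof. exact/ltW/dk_gt0. Qed.

Lemma dk_diag j : dk j j = 1.
Proof. by rewrite /dk maxnn minnn subnn expr0 sqrtr1 invr1. Qed.

Lemma dk_le1 j l : dk j l <= 1.
Proof.
rewrite /dk invf_le1 ?sqrtr_gt0 ?exprn_gt0 //.
by rewrite -[leLHS]sqrtr1 ler_wsqrtr // exprn_ege1 // ler1n.
Qed.

Lemma dk_sqr j l : dk j l ^+ 2 = (2 ^+ (maxn j l - minn j l))^-1.
Proof. by rewrite /dk exprVn sqr_sqrtr ?exprn_ge0. Qed.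

Lemma dk_sqr_le j l : dk j l ^+ 2 <= dk j l.
Proof. by rewrite expr2 ler_piMr ?dk_ge0 ?dk_le1. Qed.

Lemma dk_pow j l : dk j l = (Num.sqrt 2)^-1 ^+ (maxn j l - minn j l).
Proof.
rewrite /dk exprVn; congr (_^-1); elim: (_ - _)%N => [|n IHn]; first by rewrite !expr0 sqrtr1.
by rewrite !exprS sqrtrM // IHn.
Qed.

Lemma sum_inj_le (I J : finType) (A : {pred I}) (h : I -> J) (F : J -> R) :
  {in A &, injective h} -> (forall j, 0 <= F j) ->
  \sum_(i in A) F (h i) <= \sum_j F j.
Proof.
move=> hinj F0; pose B := [set i in A].
rewrite (eq_bigl (mem B)); last by move=> i; rewrite !inE.
rewrite -(big_imset F (h := h) (A := B)) /=; last first.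
  by move=> i i'; rewrite !inE; exact: hinj.
by rewrite [leRHS](bigID (mem (h @: B))) /= lerDl sumr_ge0.
Qed.

Lemma geom_sum_le (x : R) n : 0 <= x -> x < 1 -> \sum_(i < n) x ^+ i <= (1 - x)^-1.
Proof.
move=> x0 x1; have h : 0 < 1 - x by rewrite subr_gt0.
rewrite -[leRHS]mul1r ler_pdivlMr //.
have := subrX1 x n => e; have : (x - 1) * \sum_(i < n) x ^+ i = x ^+ n - 1 by rewrite -e.
have := exprn_ge0 n x0; move: (\sum_(_ < n) _) => y; nra.
Qed.

(** The ratio [1 / sqrt 2] is at most 3/4, and each of the ranges [j < l] and [j >= l] has distinct
    exponents, so each contributes at most a geometric series of sum 4. *)
Lemma dk_half_sum r l : \sum_(j < r) dk j l <= 8.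
Proof.
set x := (Num.sqrt (2 : R))^-1.
have s2 : Num.sqrt (2 : R) ^+ 2 = 2 by rewrite sqr_sqrtr.
have s0 : 0 < Num.sqrt (2 : R) by rewrite sqrtr_gt0.
have x0 : 0 < x by rewrite invr_gt0.
have x34 : x <= 3 / 4.
  rewrite -[leLHS]mul1r ler_pdivrMr //; nra.
have bd n : \sum_(i < n) x ^+ i <= 4.
  apply: le_trans (geom_sum_le n (ltW x0) _) _; first by lra.
  by rewrite -[leLHS]mul1r ler_pdivrMr; lra.
have -> : \sum_(j < r) dk j l = \sum_(j < r | (j < l)%N) x ^+ (l - j) + \sum_(j < r | ~~ (j < l)%N) x ^+ (j - l).
  rewrite (bigID (fun j : 'I_r => (j < l)%N)) /=; congr (_ + _); apply: eq_bigr => j jl.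
    by rewrite dk_pow; congr (_ ^+ _); lia.
  by rewrite dk_pow; congr (_ ^+ _); lia.
apply: (@le_trans _ _ (4 + 4)); last by lra.
have part (P : pred 'I_r) (g : 'I_r -> nat) : (forall j, P j -> g j < maxn r l.+1)%N ->
    {in P &, injective g} -> \sum_(j < r | P j) x ^+ (g j) <= 4.
  move=> gM ginj; apply: le_trans (bd (maxn r l.+1)).
  pose h (j : 'I_r) : 'I_(maxn r l.+1).-1.+1 := inord (g j).
  have M0 : (maxn r l.+1).-1.+1 = maxn r l.+1 by lia.
  have hE j : P j -> h j = g j :> nat by move=> Pj; rewrite /h inordK // M0 gM.
  rewrite -M0; rewrite (eq_bigr (fun j => x ^+ (h j))) => [|j /hE -> //].
  apply: (@sum_inj_le _ _ P h (fun i => x ^+ i)) => [j j' Pj Pj' e|i]; last exact: exprn_ge0 (ltW x0).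
  by apply: ginj => //; rewrite -hE // -hE // e.
apply: (@le_trans _ _ (4 + 4)); last by lra.
apply: lerD; apply: part => [j|j j'].
- by move=> jl; lia.
- by rewrite /in_mem /= => jl jl' e; apply: ord_inj; lia.
- by move=> _; have := ltn_ord j; lia.
- by rewrite /in_mem /= => jl jl' e; apply: ord_inj; lia.
Qed.

End Kernel.

(** * The golfing scheme for an abstract isometry with levelled rows and columns *)

Section Golf.
Variables (R : realType) (I W : finType) (r : nat) (U : W -> I -> R[i]).
Variables (lev : I -> 'I_r) (rlev : W -> 'I_r) (k : 'I_r -> nat) (D : {set I}).
Variables (mu nu : R).
Hypothesis mu_gt0 : 0 < mu.
Hypothesis nu_ge1 : 1 <= nu.
Hypothesis U_ortho : forall i i', \sum_w (U w i)^*%C * U w i' = (i == i')%:R.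
Hypothesis U_coh : forall w i,
  2 ^+ rlev w * cmod (U w i) ^+ 2 <= mu * dk R (rlev w) (lev i) ^+ 2.
Hypothesis U_op : forall (j l : 'I_r) (q : I -> R[i]), (forall i, lev i != l -> q i = 0) ->
  \sum_(w | rlev w == j) cmod (\sum_i U w i * q i) ^+ 2
    <= nu * dk R j l ^+ 2 * \sum_i cmod (q i) ^+ 2.
Hypothesis D_sparse : forall l, (#|[set i in D | lev i == l]| <= k l)%N.
Hypothesis k_pos : (0 < \sum_l k l)%N.

Local Notation vec := (I -> R[i]).
Implicit Types (q : vec) (j l : 'I_r).

Definition Uv q w : R[i] := \sum_i U w i * q i.
(** The bracket of the sampling condition in band [j]; its diagonal term is [k j]. *)
Definition KK j : R := \sum_(l < r) dk R j l * (k l)%:R.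
Definition En j q : R := \sum_(w | rlev w == j) cmod (Uv q w) ^+ 2.
(** A weighted l1 norm that dominates [Uv q] on band [j] by coherence. It controls the largest
    summand in Bernstein's inequality, as [En] controls the variance. *)
Definition Nn j q : R := \sum_i dk R j (lev i) * cmod (q i).

Lemma KK_gt0 j : 0 < KK j.
Proof.
have [l kl] : exists l : 'I_r, (0 < k l)%N.
  apply/existsP/contraT => /existsPn h.
  by move: k_pos; rewrite big1 // => l _; apply/eqP; rewrite -leqn0 leqNgt; exact: h.
rewrite /KK (bigD1 l) //= ltr_pwDl ?mulr_gt0 ?dk_gt0 ?ltr0n //.
by apply: sumr_ge0 => l' _; rewrite mulr_ge0 ?dk_ge0.
Qed.

Lemma dk_sum8 l : \sum_(j < r) dk R j l <= 8.
Proof. exact: dk_half_sum. Qed.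

Lemma En_ge0 j q : 0 <= En j q.
Proof. by apply: sumr_ge0 => w _; exact: sqr_ge0. Qed.

Lemma Nn_ge0 j q : 0 <= Nn j q.
Proof. by apply: sumr_ge0 => i _; rewrite mulr_ge0 ?dk_ge0 ?cmod_ge0. Qed.

Lemma sum_En q : \sum_(j < r) En j q = \sum_w cmod (Uv q w) ^+ 2.
Proof. by rewrite /En [RHS](partition_big rlev predT). Qed.

Lemma ip_Uv (p q : vec) :
  \sum_w (Uv p w)^*%C * Uv q w = \sum_i (p i)^*%C * q i.
Proof.
under eq_bigr => w _.
  rewrite /Uv sum_conj big_distrl /=.
  under eq_bigr => i _ do rewrite big_distrr /=.
  over.
rewrite exchange_big /=; apply: eq_bigr => i _.
rewrite exchange_big /= (bigD1 i) //= [X in _ + X]big1 ?addr0 => [|i' i'i].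
  transitivity (((p i)^*%C * q i) * (\sum_w (U w i)^*%C * U w i)).
    by rewrite mulr_sumr; apply: eq_bigr => w _; rewrite rmorphM /=; ring.
  by rewrite U_ortho eqxx mulr1.
transitivity (((p i)^*%C * q i') * (\sum_w (U w i)^*%C * U w i')).
  by rewrite mulr_sumr; apply: eq_bigr => w _; rewrite rmorphM /=; ring.
by rewrite U_ortho eq_sym (negPf i'i) mulr0.
Qed.

Lemma parseval q : \sum_w cmod (Uv q w) ^+ 2 = \sum_i cmod (q i) ^+ 2.
Proof.
have h (T : finType) (p : T -> R[i]) : (\sum_t cmod (p t) ^+ 2)%:C%C = \sum_t (p t)^*%C * p t.
  by rewrite sum_realC; apply: eq_bigr => t _; rewrite cmod_sqr mulrC.
by apply: (@complexI R); rewrite !h ip_Uv.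
Qed.

Lemma reconstruct q i : \sum_w (U w i)^*%C * Uv q w = q i.
Proof.
have <- : \sum_i' ((i' == i)%:R^*%C) * q i' = q i.
  rewrite (bigD1 i) //= eqxx conjc1 mul1r big1 ?addr0 // => i' /negPf ->.
  by rewrite conjc0 mul0r.
rewrite -ip_Uv.
apply: eq_bigr => w _; congr (_^*%C * _).
rewrite /Uv (bigD1 i) //= eqxx mulr1 big1 ?addr0 // => i' /negPf ->.
by rewrite mulr0.
Qed.

Lemma Uv_le_Nn q w : 2 ^+ rlev w * cmod (Uv q w) ^+ 2 <= mu * Nn (rlev w) q ^+ 2.
Proof.
set c := Num.sqrt (mu / 2 ^+ rlev w).
have c0 : 0 <= c by exact: sqrtr_ge0.
have c2 : 2 ^+ rlev w * c ^+ 2 = mu.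
  rewrite sqr_sqrtr ?divr_ge0 ?exprn_ge0 ?(ltW mu_gt0) //.
  by field; rewrite expf_neq0 ?pnatr_eq0.
have h i : cmod (U w i) <= c * dk R (rlev w) (lev i).
  rewrite -(@ler_pXn2r _ 2) ?nnegrE ?mulr_ge0 ?cmod_ge0 ?dk_ge0 //.
  by rewrite -(@ler_pM2l _ (2 ^+ rlev w)) ?exprn_gt0 // [(c * _) ^+ 2]exprMn [leRHS]mulrA c2 U_coh.
rewrite -[in leRHS]c2 -mulrA -exprMn.
rewrite ler_wpM2l ?exprn_ge0 // ler_pXn2r ?nnegrE ?cmod_ge0 ?mulr_ge0 ?Nn_ge0 //.
apply: le_trans (cmod_sum _ _ _) _; rewrite /Nn mulr_sumr; apply: ler_sum => i _.
by rewrite cmodM mulrA ler_wpM2r ?cmod_ge0.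
Qed.

(* The square of the Bernstein threshold for coordinate i of a step from q using
   the bands in H: the first term dominates the variance, the second one the
   square of the largest summand. *)
Definition tt2 (th : R) (H : pred 'I_r) q i : R :=
  8 * mu * th * (\sum_(j | H j) dk R j (lev i) ^+ 2 * (En j q / KK j))
  + 4 * mu ^+ 2 * th ^+ 2 * (\sum_(j | H j) dk R j (lev i) ^+ 2 * (Nn j q / KK j) ^+ 2).

Lemma tt2_l_ge0 th (H : pred 'I_r) q i : 0 <= th ->
  0 <= 8 * mu * th * (\sum_(j | H j) dk R j (lev i) ^+ 2 * (En j q / KK j)).
Proof.
move=> th0; apply: mulr_ge0; first by rewrite !mulr_ge0 // ltW.
by apply: sumr_ge0 => j _; rewrite mulr_ge0 ?sqr_ge0 ?divr_ge0 ?En_ge0 ?(ltW (KK_gt0 j)).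
Qed.

Lemma tt2_r_ge0 th (H : pred 'I_r) q i :
  0 <= 4 * mu ^+ 2 * th ^+ 2 * (\sum_(j | H j) dk R j (lev i) ^+ 2 * (Nn j q / KK j) ^+ 2).
Proof.
apply: mulr_ge0; first by rewrite mulr_ge0 ?sqr_ge0 // mulr_ge0 ?sqr_ge0.
by apply: sumr_ge0 => j _; rewrite mulr_ge0 ?sqr_ge0.
Qed.

Lemma tt2_ge0 th H q i : 0 <= th -> 0 <= tt2 th H q i.
Proof. by move=> th0; rewrite addr_ge0 ?tt2_l_ge0 ?tt2_r_ge0. Qed.

Section Step.
Variables (L : nat) (pr : 'I_L.+1 * W -> R) (Lam th : R).
Hypothesis pr_gt0 : forall t, 0 < pr t.
Hypothesis pr_le1 : forall t, pr t <= 1.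
Hypothesis Lam_gt0 : 0 < Lam.
Hypothesis th_ge0 : 0 <= th.
Hypothesis pr_large : forall s w, Lam * KK (rlev w) <= th * 2 ^+ rlev w * pr (s, w).

(** Extended by zero to all stages and bands, so that the inequality on the whole product space
    applies to a single stage. *)
Definition zz (s : 'I_L.+1) (H : pred 'I_r) q i (t : 'I_L.+1 * W) : R[i] :=
  if (t.1 == s) && H (rlev t.2) then (U t.2 i)^*%C * Uv q t.2 else 0.

Lemma sum_stage (A : zmodType) (s : 'I_L.+1) (H : pred 'I_r) (F : 'I_L.+1 * W -> A) :
  \sum_t (if (t.1 == s) && H (rlev t.2) then F t else 0)
    = \sum_(w | H (rlev w)) F (s, w).
Proof.
rewrite -big_mkcond /=.
rewrite (eq_bigr (fun p => F (p.1, p.2))) => [|[] //].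
rewrite -(pair_big_dep (fun s' => s' == s) (fun _ w => H (rlev w)) (fun s' w => F (s', w))) /=.
by rewrite big_pred1_eq.
Qed.

(** Bernstein's inequality with threshold squared equal to [tt2]. The ratio of [Lam] to the rate is
    at most [th * 2 ^ j / KK j] in band [j], and coherence cancels [2 ^ j]: once in the variance,
    and through [Uv_le_Nn] a second time in the squared largest summand. *)
Lemma step_prob s H q i :
  bP pr (fun f => ~~ (cmod (bdevC pr (zz s H q i) f) <= 2 * Num.sqrt (tt2 th H q i)))
    <= 4 * expR (- Lam).
Proof.
have prb w : Lam / pr (s, w) <= th * 2 ^+ rlev w / KK (rlev w).
  by rewrite ler_pdivrMr // mulrAC ler_pdivlMr ?KK_gt0.
apply: bernstein_complex => //.
  rewrite [leRHS]sqr_sqrtr ?tt2_ge0 // /tt2 -[leLHS]addr0; apply: lerD; last exact: tt2_r_ge0.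
  rewrite (eq_bigr (fun t => if (t.1 == s) && H (rlev t.2) then
     cmod (U t.2 i) ^+ 2 * cmod (Uv q t.2) ^+ 2 / pr t else 0)); last first.
    move=> t _; rewrite /zz; case: ifP => _; last by rewrite cmod0 expr0n mul0r.
    by rewrite cmodM cmodJ exprMn.
  rewrite (sum_stage s H (fun t => cmod (U t.2 i) ^+ 2 * cmod (Uv q t.2) ^+ 2 / pr t)) /=.
  rewrite (partition_big rlev H) //= !mulr_sumr; apply: ler_sum => j Hj.
  rewrite (eq_bigl (fun w => rlev w == j)); last first.
    by move=> w; case: eqP => [->|]; rewrite ?Hj ?andbF.
  rewrite /En mulr_suml !mulr_sumr; apply: ler_sum => w /eqP <-.
  have -> : 8 * Lam * (cmod (U w i) ^+ 2 * cmod (Uv q w) ^+ 2 / pr (s, w))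
    = 8 * ((Lam / pr (s, w)) * (cmod (U w i) ^+ 2) * cmod (Uv q w) ^+ 2) by ring.
  have -> : 8 * mu * th * (dk R (rlev w) (lev i) ^+ 2 * (cmod (Uv q w) ^+ 2 / KK (rlev w)))
    = 8 * ((th / KK (rlev w) * (mu * dk R (rlev w) (lev i) ^+ 2)) * cmod (Uv q w) ^+ 2) by ring.
  rewrite ler_wpM2l // ler_wpM2r ?sqr_ge0 //.
  apply: le_trans (ler_wpM2r (sqr_ge0 _) (prb w)) _.
  have -> : th * 2 ^+ rlev w / KK (rlev w) * cmod (U w i) ^+ 2
   = th / KK (rlev w) * (2 ^+ rlev w * cmod (U w i) ^+ 2) by ring.
  by rewrite ler_wpM2l // divr_ge0 // ltW ?KK_gt0.
case=> s' w; rewrite /zz /=; case: ifP => [/andP[/eqP -> Hw]|_]; last first.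
  by rewrite cmod0 mulr0 mul0r sqrtr_ge0.
rewrite -[leLHS]ger0_norm; last first.
  by rewrite divr_ge0 ?mulr_ge0 ?cmod_ge0 ?(ltW Lam_gt0) // ltW.
rewrite -sqrtr_sqr ler_wsqrtr // /tt2 -[leLHS]add0r; apply: lerD; first exact: tt2_l_ge0.
apply: (@le_trans _ _ (4 * mu ^+ 2 * th ^+ 2 * (dk R (rlev w) (lev i) ^+ 2 * (Nn (rlev w) q / KK (rlev w)) ^+ 2))); last first.
  rewrite ler_wpM2l //; first by rewrite mulr_ge0 ?sqr_ge0 // mulr_ge0 ?sqr_ge0.
  rewrite (bigD1 (rlev w)) //= lerDl.
  by apply: sumr_ge0 => j _; rewrite mulr_ge0 ?sqr_ge0.
have -> : (2 * Lam * cmod ((U w i)^*%C * Uv q w) / pr (s, w)) ^+ 2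
  = 4 * ((Lam / pr (s, w)) ^+ 2 * (cmod (U w i) ^+ 2 * cmod (Uv q w) ^+ 2)).
  by rewrite cmodM cmodJ; ring.
have -> : 4 * mu ^+ 2 * th ^+ 2 * (dk R (rlev w) (lev i) ^+ 2 * (Nn (rlev w) q / KK (rlev w)) ^+ 2)
  = 4 * ((th / KK (rlev w)) ^+ 2 * ((mu * dk R (rlev w) (lev i) ^+ 2) * (mu * Nn (rlev w) q ^+ 2))) by ring.
rewrite ler_wpM2l //.
apply: (@le_trans _ _ ((th * 2 ^+ rlev w / KK (rlev w)) ^+ 2 * (cmod (U w i) ^+ 2 * cmod (Uv q w) ^+ 2))).
  rewrite ler_wpM2r //; first by rewrite mulr_ge0 ?sqr_ge0.
  rewrite ler_pXn2r ?nnegrE ?prb //.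
    by rewrite divr_ge0 ?(ltW Lam_gt0) // ltW.
  by rewrite divr_ge0 ?mulr_ge0 ?exprn_ge0 // ltW ?KK_gt0.
have -> : (th * 2 ^+ rlev w / KK (rlev w)) ^+ 2 * (cmod (U w i) ^+ 2 * cmod (Uv q w) ^+ 2)
  = (th / KK (rlev w)) ^+ 2 * ((2 ^+ rlev w * cmod (U w i) ^+ 2) * (2 ^+ rlev w * cmod (Uv q w) ^+ 2)) by ring.
by rewrite ler_wpM2l ?sqr_ge0 // ler_pM ?U_coh ?Uv_le_Nn ?mulr_ge0 ?exprn_ge0 ?cmod_ge0.
Qed.

End Step.

Lemma nu_ge0 : 0 <= nu.
Proof. exact: le_trans ler01 nu_ge1. Qed.

Lemma sum_D_dk j : \sum_(i in D) dk R j (lev i) <= KK j.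
Proof.
rewrite (partition_big lev predT) //=; apply: ler_sum => l _.
rewrite (eq_bigr (fun=> dk R j l)) => [|i /andP[_ /eqP -> //]].
rewrite (eq_bigl (mem [set i in D | lev i == l])); last by move=> i; rewrite !inE.
by rewrite sumr_const -[leLHS]mulr_natr ler_wpM2l ?dk_ge0 // ler_nat.
Qed.

Lemma sum_D_dk2 j : \sum_(i in D) dk R j (lev i) ^+ 2 <= KK j.
Proof. by apply: le_trans (sum_D_dk j); apply: ler_sum => i _; exact: dk_sqr_le. Qed.

Lemma sum_levels_sqr (a : 'I_r -> R) (b : 'I_r -> R) : (forall l, 0 <= a l) ->
  (\sum_l a l * b l) ^+ 2 <= (\sum_l a l) * (\sum_l a l * b l ^+ 2).
Proof.
move=> a0; have := cauchy_schwarz predT (fun l => Num.sqrt (a l)) (fun l => Num.sqrt (a l) * b l).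
rewrite (eq_bigr (fun l => a l * b l)); last by move=> l _; rewrite mulrA -expr2 sqr_sqrtr.
rewrite [X in _ <= X * _ -> _](eq_bigr a); last by move=> l _; rewrite sqr_sqrtr.
rewrite [X in _ <= _ * X -> _](eq_bigr (fun l => a l * b l ^+ 2)) //.
by move=> l _; rewrite exprMn sqr_sqrtr.
Qed.

Definition supp (A : {set I}) q := forall i, i \notin A -> q i = 0.

(** Level [l] of [q] has at most [k l] entries, so its block contributes at most
    [dk j l * sqrt (nu * k l) * rho]. Cauchy-Schwarz with weights [dk j l], of total at most 8,
    recombines the levels into [KK j]. *)
Lemma En_linf j q (rho : R) : 0 <= rho -> supp D q -> (forall i, cmod (q i) <= rho) ->
  En j q <= nu * 8 * rho ^+ 2 * KK j.
Proof.
move=> rho0 qD qrho.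
have nu0 := nu_ge0.
pose S := [set w | rlev w == j].
pose qr l i := if lev i == l then q i else 0.
have -> : En j q = l2 S (Uv q) ^+ 2.
  by rewrite l2_sqr; apply: eq_bigl => w; rewrite inE.
have h1 : l2 S (Uv q) <= \sum_(l < r) dk R j l * (Num.sqrt nu * (Num.sqrt (k l)%:R * rho)).
  rewrite (@eq_l2 _ _ _ _ (fun w => \sum_(l < r) Uv (qr l) w)); last first.
    move=> w _; congr cmod; rewrite /Uv exchange_big /=; apply: eq_bigr => i _.
    rewrite (bigD1 (lev i)) //= /qr eqxx big1 ?addr0 // => l; rewrite eq_sym => /negPf ->.
    by rewrite mulr0.
  apply: le_trans (l2_sum _ _ _ _) _; apply: ler_sum => l _.
  apply: l2_bound; first by rewrite !mulr_ge0 ?dk_ge0 ?sqrtr_ge0.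
  rewrite (eq_bigl (fun w => rlev w == j)); last by move=> w; rewrite inE.
  apply: le_trans (@U_op j l _ _) _; first by move=> i /negPf il; rewrite /qr il.
  rewrite !exprMn !(@sqr_sqrtr R) ?ler0n // [_ ^+ 2 * (nu * _)]mulrCA -mulrA.
  rewrite ler_wpM2l // ler_wpM2l ?sqr_ge0 //.
  apply: (@le_trans _ _ (\sum_(i in [set i in D | lev i == l]) rho ^+ 2)); last first.
    by rewrite sumr_const -[leLHS]mulr_natl ler_wpM2r ?sqr_ge0 // ler_nat.
  rewrite [leRHS]big_mkcond /=; apply: ler_sum => i _; rewrite /qr inE.
  case: (lev i == l); rewrite ?andbF ?andbT ?cmod0 ?expr0n //.
  case: (boolP (i \in D)) => [iD|/qD ->]; last by rewrite cmod0 expr0n.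
  by rewrite ler_pXn2r ?nnegrE ?cmod_ge0.
apply: (@le_trans _ _ ((\sum_(l < r) dk R j l * (Num.sqrt nu * (Num.sqrt (k l)%:R * rho))) ^+ 2)).
  by rewrite ler_pXn2r ?nnegrE ?l2_ge0 ?(le_trans _ h1) ?l2_ge0.
apply: le_trans (sum_levels_sqr _ _) _; first by move=> l; exact: dk_ge0.
have -> : \sum_(l < r) dk R j l * (Num.sqrt nu * (Num.sqrt (k l)%:R * rho)) ^+ 2 = nu * rho ^+ 2 * KK j.
  rewrite /KK mulr_sumr; apply: eq_bigr => l _.
  by rewrite !exprMn !(@sqr_sqrtr R) ?ler0n //; ring.
have -> : nu * 8 * rho ^+ 2 * KK j = 8 * (nu * rho ^+ 2 * KK j) by ring.
rewrite ler_wpM2r //; last by have := dk_sum8 j; under eq_bigr do rewrite dk_sym.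
by rewrite !mulr_ge0 ?sqr_ge0 // ltW ?KK_gt0.
Qed.

Lemma Nn_supp j q : supp D q -> Nn j q = \sum_(i in D) dk R j (lev i) * cmod (q i).
Proof.
move=> qD; rewrite [RHS]big_mkcond; apply: eq_bigr => i _; case: ifPn => // /qD ->.
by rewrite cmod0 mulr0.
Qed.

Lemma Nn_linf j q (rho : R) : 0 <= rho -> supp D q -> (forall i, cmod (q i) <= rho) ->
  Nn j q <= rho * KK j.
Proof.
move=> rho0 qD qrho; rewrite Nn_supp //.
apply: (@le_trans _ _ (\sum_(i in D) dk R j (lev i) * rho)).
  by apply: ler_sum => i _; rewrite ler_wpM2l ?dk_ge0.
by rewrite -mulr_suml mulrC ler_wpM2l // sum_D_dk.
Qed.

Lemma Nn_l2 j q : supp D q ->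
  Nn j q ^+ 2 <= KK j * \sum_i dk R j (lev i) * cmod (q i) ^+ 2.
Proof.
move=> qD; rewrite Nn_supp //.
have := cauchy_schwarz (mem D) (fun i => Num.sqrt (dk R j (lev i))) (fun i => Num.sqrt (dk R j (lev i)) * cmod (q i)).
have e i : Num.sqrt (dk R j (lev i)) ^+ 2 = dk R j (lev i) by rewrite sqr_sqrtr ?dk_ge0.
rewrite (eq_bigr (fun i => dk R j (lev i) * cmod (q i))); last by move=> i _; rewrite mulrA -expr2 e.
rewrite [X in _ <= X * _ -> _](eq_bigr (fun i => dk R j (lev i))); last by move=> i _; rewrite e.
rewrite [X in _ <= _ * X -> _](eq_bigr (fun i => dk R j (lev i) * cmod (q i) ^+ 2)); last first.
  by move=> i _; rewrite exprMn e.
move/le_trans; apply; apply: ler_pM; rewrite ?sum_D_dk ?sumr_ge0 //.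
- by move=> i _; exact: dk_ge0.
- by move=> i _; rewrite mulr_ge0 ?dk_ge0 ?sqr_ge0.
rewrite big_mkcond; apply: ler_sum => i _; case: ifP => // _.
by rewrite mulr_ge0 ?dk_ge0 ?sqr_ge0.
Qed.

(** A stage contracts by [2 * sqrt (Cth th)]; the requirement [Cth th <= 1/256] makes this 1/8. In
    the first term 64 is 8 from [En_linf] times 8 from [sum_dk2]. *)
Definition Cth (th : R) := 8 * mu * th * (nu * 64) + 32 * mu ^+ 2 * th ^+ 2.

Lemma sum_dk2 (H : pred 'I_r) i : \sum_(j | H j) dk R j (lev i) ^+ 2 <= 8.
Proof.
apply: le_trans (dk_sum8 (lev i)); rewrite big_mkcond; apply: ler_sum => j _.
by case: ifP => _; [exact: dk_sqr_le | exact: dk_ge0].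
Qed.

Lemma tt2_linf th (H : pred 'I_r) q i (rho : R) : 0 <= th -> 0 <= rho -> supp D q ->
  (forall i, cmod (q i) <= rho) -> tt2 th H q i <= Cth th * rho ^+ 2.
Proof.
move=> th0 rho0 qD qrho; rewrite /tt2 /Cth [leRHS]mulrDl.
have nu0 := nu_ge0.
apply: lerD.
  rewrite -[leRHS]mulrA; apply: ler_wpM2l; first by rewrite !mulr_ge0 // ltW.
  apply: (@le_trans _ _ (\sum_(j | H j) dk R j (lev i) ^+ 2 * (nu * 8 * rho ^+ 2))).
    apply: ler_sum => j _; rewrite ler_wpM2l ?sqr_ge0 // ler_pdivrMr ?KK_gt0 //.
    exact: En_linf.
  rewrite -mulr_suml.
  have -> : nu * 64 * rho ^+ 2 = 8 * (nu * 8 * rho ^+ 2) by ring.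
  by rewrite ler_wpM2r ?sum_dk2 // !mulr_ge0 ?sqr_ge0.
have -> : 32 * mu ^+ 2 * th ^+ 2 * rho ^+ 2 = 4 * mu ^+ 2 * th ^+ 2 * (8 * rho ^+ 2) by ring.
apply: ler_wpM2l; first by rewrite mulr_ge0 ?sqr_ge0 // mulr_ge0 ?sqr_ge0.
apply: (@le_trans _ _ (\sum_(j | H j) dk R j (lev i) ^+ 2 * rho ^+ 2)).
  apply: ler_sum => j _; rewrite ler_wpM2l ?sqr_ge0 //.
  rewrite ler_pXn2r ?nnegrE ?divr_ge0 ?Nn_ge0 ?(ltW (KK_gt0 _)) //.
  by rewrite ler_pdivrMr ?KK_gt0 // Nn_linf.
by rewrite -mulr_suml ler_wpM2r ?sqr_ge0 ?sum_dk2.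
Qed.

(** Summation over [D] produces a factor [KK j], which cancels a denominator, and Parseval collects
    the band energies. In this way coordinatewise thresholds give a contraction in l2. *)
Lemma sum_tt2 th (H : pred 'I_r) q : 0 <= th ->
  \sum_(i in D) tt2 th H q i
    <= 8 * mu * th * (\sum_i cmod (q i) ^+ 2)
       + 4 * mu ^+ 2 * th ^+ 2 * \sum_(j | H j) Nn j q ^+ 2 / KK j.
Proof.
move=> th0; rewrite /tt2 big_split /= -!mulr_sumr; apply: lerD.
  apply: ler_wpM2l; first by rewrite !mulr_ge0 // ltW.
  rewrite exchange_big /= -parseval -sum_En big_mkcond; apply: ler_sum => j _ /=.
  case: ifP => _; last exact: En_ge0.
  rewrite -mulr_suml mulrA ler_pdivrMr ?KK_gt0 // mulrC ler_wpM2l ?En_ge0 //.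
  exact: sum_D_dk2.
apply: ler_wpM2l; first by rewrite mulr_ge0 ?sqr_ge0 // mulr_ge0 ?sqr_ge0.
rewrite exchange_big /=; apply: ler_sum => j _.
rewrite -mulr_suml expr_div_n.
have -> : Nn j q ^+ 2 / KK j = KK j * (Nn j q ^+ 2 / KK j ^+ 2).
  by field; rewrite gt_eqF ?KK_gt0.
by rewrite ler_wpM2r ?sum_D_dk2 // divr_ge0 ?sqr_ge0.
Qed.

Lemma tt2_l2 th (H : pred 'I_r) q : 0 <= th -> supp D q ->
  \sum_(i in D) tt2 th H q i <= Cth th * \sum_i cmod (q i) ^+ 2.
Proof.
move=> th0 qD; apply: le_trans (sum_tt2 _ _ th0) _; rewrite /Cth [leRHS]mulrDl.
set Q := \sum_i cmod (q i) ^+ 2.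
have Q0 : 0 <= Q by apply: sumr_ge0 => i _; exact: sqr_ge0.
have mt : 0 <= 8 * mu * th by rewrite !mulr_ge0 // ltW.
apply: lerD; first by rewrite ler_wpM2r // ler_peMr //; move: nu_ge1; lra.
have -> : 32 * mu ^+ 2 * th ^+ 2 * Q = 4 * mu ^+ 2 * th ^+ 2 * (8 * Q) by ring.
apply: ler_wpM2l; first by rewrite mulr_ge0 ?sqr_ge0 // mulr_ge0 ?sqr_ge0.
apply: (@le_trans _ _ (\sum_(j < r) \sum_i dk R j (lev i) * cmod (q i) ^+ 2)).
  rewrite big_mkcond; apply: ler_sum => j _; case: ifP => _; last first.
    by apply: sumr_ge0 => i _; rewrite mulr_ge0 ?dk_ge0 ?sqr_ge0.
  by rewrite ler_pdivrMr ?KK_gt0 // mulrC Nn_l2.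
rewrite exchange_big /= /Q mulr_sumr; apply: ler_sum => i _.
by rewrite -mulr_suml ler_wpM2r ?sqr_ge0 // dk_sum8.
Qed.

Definition ev (i : I) : vec := fun i' => (i' == i)%:R.

Lemma sum_ev i : \sum_i' cmod (ev i i') ^+ 2 = 1.
Proof.
rewrite (bigD1 i) //= /ev eqxx cmod1 expr1n big1 ?addr0 // => i' /negPf ->.
by rewrite cmod0 expr0n.
Qed.

Lemma Uv_ev i w : Uv (ev i) w = U w i.
Proof.
rewrite /Uv (bigD1 i) //= /ev eqxx mulr1 big1 ?addr0 // => i' /negPf ->.
by rewrite mulr0.
Qed.

(* In a band with KK j < 1 the sampling rate may be too small for concentration
   on a vector outside D; there the deterministic bound light_l2 is used. *)
Definition heavy : pred 'I_r := fun j => 1 <= KK j.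

(** A unit vector off [D] is out of reach of [Nn_l2]; instead [Nn j (ev i')] equals [dk j (lev i')],
    and division by [KK j >= 1] is harmless. *)
Lemma tt2_heavy th i' : 0 <= th -> \sum_(i in D) tt2 th heavy (ev i') i <= Cth th.
Proof.
move=> th0; apply: le_trans (sum_tt2 _ _ th0) _; rewrite /Cth sum_ev mulr1.
have mt : 0 <= 8 * mu * th by rewrite !mulr_ge0 // ltW.
apply: lerD; first by rewrite ler_peMr //; move: nu_ge1; lra.
have -> : 32 * mu ^+ 2 * th ^+ 2 = 4 * mu ^+ 2 * th ^+ 2 * 8 by ring.
apply: ler_wpM2l; first by rewrite mulr_ge0 ?sqr_ge0 // mulr_ge0 ?sqr_ge0.
apply: le_trans (sum_dk2 heavy i'); apply: ler_sum => j Hj.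
have -> : Nn j (ev i') = dk R j (lev i').
  rewrite /Nn (bigD1 i') //= /ev eqxx cmod1 mulr1 big1 ?addr0 // => i /negPf ->.
  by rewrite cmod0 mulr0.
by rewrite ler_pdivrMr ?KK_gt0 // ler_peMr ?sqr_ge0.
Qed.

(** * Iteration of the stages for a fixed selection *)

Section Process.
Variables (L : nat) (pr : 'I_L.+1 * W -> R) (th : R) (f : {ffun 'I_L.+1 * W -> bool}).
Hypothesis pr_gt0 : forall t, 0 < pr t.
Hypothesis th_ge0 : 0 <= th.
Hypothesis Cth_small : Cth th <= 256^-1.

Definition bw (s : 'I_L.+1) w : R := (f (s, w))%:R / pr (s, w).
(** Its mean over the selection is [q i]: the weights [bw] have mean 1 and the columns of [U] are
    orthonormal. *)
Definition GG (s : 'I_L.+1) q i : R[i] := \sum_w (bw s w)%:C%C * ((U w i)^*%C * Uv q w).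
Definition ZZ (s : 'I_L.+1) q i : R[i] := if i \in D then q i - GG s q i else 0.
Definition stepok (s : 'I_L.+1) (H : pred 'I_r) q : Prop :=
  forall i, cmod (bdevC pr (zz s H q i) f) <= 2 * Num.sqrt (tt2 th H q i).

Lemma bw_ge0 s w : 0 <= bw s w.
Proof. by rewrite divr_ge0 // ltW. Qed.

Lemma ZZ_supp s q : supp D (ZZ s q).
Proof. by move=> i iD; rewrite /ZZ (negPf iD). Qed.

Lemma bdevC_zz s (H : pred 'I_r) q i : bdevC pr (zz s H q i) f
  = \sum_(w | H (rlev w)) (bw s w - 1)%:C%C * ((U w i)^*%C * Uv q w).
Proof.
rewrite -(sum_stage s H (fun t => ((f t)%:R / pr t - 1)%:C%C * ((U t.2 i)^*%C * Uv q t.2))).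
by apply: eq_bigr => t _; rewrite /zz; case: ifP => // _; rewrite mulr0.
Qed.

Lemma bdevC_zzT s q i : bdevC pr (zz s predT q i) f = GG s q i - q i.
Proof.
rewrite bdevC_zz -[in RHS](reconstruct q i) -sumrB; apply: eq_bigr => w _.
by rewrite rmorphB rmorph1 mulrBl mul1r.
Qed.

Lemma ip_GG s (p q : vec) :
  \sum_i (p i)^*%C * GG s q i = \sum_w (bw s w)%:C%C * ((Uv p w)^*%C * Uv q w).
Proof.
under eq_bigr => i _ do rewrite /GG big_distrr /=.
rewrite exchange_big /=; apply: eq_bigr => w _.
rewrite {2}/Uv sum_conj big_distrl big_distrr /=; apply: eq_bigr => i _.
by rewrite cconjM; ring.
Qed.

Lemma conj_ip_GG s (p q : vec) :
  \sum_i (GG s p i)^*%C * q i = \sum_w (bw s w)%:C%C * ((Uv p w)^*%C * Uv q w).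
Proof.
have -> : \sum_i (GG s p i)^*%C * q i = (\sum_i (q i)^*%C * GG s p i)^*%C.
  by rewrite sum_conj; apply: eq_bigr => i _; rewrite cconjM conjcK mulrC.
rewrite ip_GG sum_conj; apply: eq_bigr => w _.
by rewrite !cconjM conjcK cconjR; ring.
Qed.

Lemma sqrt_Cth (x a : R) : 0 <= a -> x <= Cth th * a ^+ 2 -> 2 * Num.sqrt x <= a / 8.
Proof.
move=> a0 hx.
have : Num.sqrt x <= a / 16.
  rewrite -(ger0_norm (_ : 0 <= a / 16)) ?divr_ge0 // -sqrtr_sqr ler_wsqrtr //.
  apply: le_trans hx _; rewrite expr_div_n mulrC ler_wpM2l ?sqr_ge0 //.
  by apply: le_trans Cth_small _; rewrite -natrX.
by lra.
Qed.

Lemma GG_linf s q (rho : R) i : stepok s predT q -> supp D q -> 0 <= rho ->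
  (forall i, cmod (q i) <= rho) -> cmod (GG s q i - q i) <= rho / 8.
Proof.
move=> ok qD rho0 qrho; rewrite -bdevC_zzT; apply: le_trans (ok i) _.
by apply: sqrt_Cth => //; exact: tt2_linf.
Qed.

Lemma ZZ_linf s q (rho : R) i : stepok s predT q -> supp D q -> 0 <= rho ->
  (forall i, cmod (q i) <= rho) -> cmod (ZZ s q i) <= rho / 8.
Proof.
move=> ok qD rho0 qrho; rewrite /ZZ; case: ifP => _; last by rewrite cmod0 divr_ge0.
by rewrite cmodB; exact: GG_linf.
Qed.

Lemma supp_l2 q : supp D q -> \sum_i cmod (q i) ^+ 2 = l2 D q ^+ 2.
Proof.
move=> qD; rewrite l2_sqr [RHS]big_mkcond; apply: eq_bigr => i _; case: ifPn => // /qD ->.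
by rewrite cmod0 expr0n.
Qed.

Lemma ZZ_l2 s q : stepok s predT q -> supp D q -> l2 D (ZZ s q) <= l2 D q / 8.
Proof.
move=> ok qD; apply: l2_bound; first by rewrite divr_ge0 ?l2_ge0.
apply: (@le_trans _ _ (\sum_(i in D) 4 * tt2 th predT q i)).
  apply: ler_sum => i iD; rewrite /ZZ iD cmodB -bdevC_zzT.
  have -> : 4 * tt2 th predT q i = (2 * Num.sqrt (tt2 th predT q i)) ^+ 2.
    by rewrite exprMn sqr_sqrtr ?tt2_ge0 //; ring.
  by rewrite ler_pXn2r ?nnegrE ?cmod_ge0 ?mulr_ge0 ?sqrtr_ge0 //; exact: ok.
rewrite -mulr_sumr; have := tt2_l2 predT th_ge0 qD; rewrite supp_l2 // => h.
have := l2_sqr D q; set x := l2 D q => _.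
have : Cth th * x ^+ 2 <= 256^-1 * x ^+ 2 by rewrite ler_wpM2r ?sqr_ge0.
by rewrite /x; nra.
Qed.

Lemma ip_supp (p q : vec) : supp D p -> \sum_i (p i)^*%C * q i = \sum_(i in D) (p i)^*%C * q i.
Proof.
move=> pD; rewrite [RHS]big_mkcond; apply: eq_bigr => i _; case: ifPn => // /pD ->.
by rewrite conjc0 mul0r.
Qed.

Lemma ip_l2 (p q : vec) : supp D p -> cmod (\sum_i (p i)^*%C * q i) <= l2 D p * l2 D q.
Proof.
move=> pD; rewrite ip_supp //; apply: le_trans (cmod_ip_le D _ _) _.
by rewrite (@eq_l2 _ _ D (fun i => (p i)^*%C) p) // => i _; exact: cmodJ.
Qed.

(** The left side is the pairing of [q] with [GG s q], that is the squared norm of [q] minus the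
    pairing with [ZZ s q], which is at most an eighth of it in modulus. *)
Lemma energy s q : stepok s predT q -> supp D q ->
  \sum_w bw s w * cmod (Uv q w) ^+ 2 <= 2 * l2 D q ^+ 2.
Proof.
move=> ok qD; set A := \sum_w _.
have A0 : 0 <= A by apply: sumr_ge0 => w _; rewrite mulr_ge0 ?bw_ge0 ?sqr_ge0.
have -> : A = cmod (A%:C%C) by rewrite cmodR ger0_norm.
have -> : A%:C%C = \sum_i (q i)^*%C * q i - \sum_i (q i)^*%C * ZZ s q i.
  rewrite /A sum_realC.
  transitivity (\sum_i (q i)^*%C * GG s q i).
    rewrite ip_GG; apply: eq_bigr => w _; rewrite rmorphM /=; congr (_ * _).
    by rewrite cmod_sqr mulrC.
  rewrite -sumrB ip_supp // [RHS](bigID (mem D)) /= [X in _ + X]big1 ?addr0.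
    by apply: eq_bigr => i iD; rewrite /ZZ iD; ring.
  by move=> i iD; rewrite /ZZ (negPf iD) qD // conjc0; ring.
apply: le_trans (cmodD _ _) _; rewrite cmodN.
have h1 := ip_l2 q qD; have h2 := ip_l2 (ZZ s q) qD; have h3 := ZZ_l2 ok qD.
have := l2_ge0 D q; nra.
Qed.

Fixpoint fw q (n : nat) : vec := if n is n'.+1 then ZZ (inord n') (fw q n') else q.
(* The first d of s stages, applied in decreasing order s-1, s-2, ...; for d = s
   this is the adjoint of fw (see fw_adj). *)
Fixpoint bvd q (s d : nat) : vec :=
  if d is d'.+1 then ZZ (inord (s - d)) (bvd q s d') else q.

Lemma bvdS q s d : bvd q s.+1 d.+1 = bvd (ZZ (inord s) q) s d.
Proof.
elim: d => [|d IHd]; first by rewrite /= subSS subn0.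
by rewrite [LHS]/= -/(bvd q s.+1 d.+1) IHd.
Qed.

Lemma fw_supp q n : supp D q -> supp D (fw q n).
Proof. by case: n => [//|n] _; exact: ZZ_supp. Qed.

(** The weights are real, so [GG s] is self-adjoint, and so is its compression to [D]. *)
Lemma ZZ_adj s (a c : vec) : supp D a -> supp D c ->
  \sum_i (ZZ s a i)^*%C * c i = \sum_i (a i)^*%C * ZZ s c i.
Proof.
move=> aD cD.
have -> : \sum_i (ZZ s a i)^*%C * c i = \sum_i (a i)^*%C * c i - \sum_i (GG s a i)^*%C * c i.
  rewrite -sumrB; apply: eq_bigr => i _; rewrite /ZZ; case: ifPn => [_|/cD ->].
    by rewrite cconjB mulrBl.
  by rewrite !mulr0 subr0.
have -> : \sum_i (a i)^*%C * ZZ s c i = \sum_i (a i)^*%C * c i - \sum_i (a i)^*%C * GG s c i.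
  rewrite -sumrB; apply: eq_bigr => i _; rewrite /ZZ; case: ifPn => [_|/aD ->].
    by rewrite mulrBr.
  by rewrite conjc0 !mul0r subr0.
by rewrite conj_ip_GG ip_GG.
Qed.

Lemma fw_adj (a c : vec) s : supp D a -> supp D c ->
  \sum_i (fw a s i)^*%C * c i = \sum_i (a i)^*%C * bvd c s s i.
Proof.
move=> aD; elim: s c => [//|s IHs] c cD.
rewrite bvdS -IHs; last exact: ZZ_supp.
by apply: ZZ_adj => //; exact: fw_supp.
Qed.

Definition fwok q := forall s, (s <= L)%N -> stepok (inord s) predT (fw q s).

Lemma fw_l2 q n : fwok q -> supp D q -> (n <= L.+1)%N -> l2 D (fw q n) <= l2 D q / 8 ^+ n.
Proof.
move=> ok qD; elim: n => [|n IHn] nL; first by rewrite expr0 divr1.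
apply: le_trans (ZZ_l2 (ok n nL) (fw_supp n qD)) _.
rewrite exprSr invfM mulrA ler_wpM2r ?invr_ge0 //; apply: IHn; lia.
Qed.

Lemma fw_linf q n i : fwok q -> supp D q -> (forall i, cmod (q i) <= 1) -> (n <= L.+1)%N ->
  cmod (fw q n i) <= (8 ^+ n)^-1.
Proof.
move=> ok qD q1; elim: n i => [|n IHn] i nL; first by rewrite expr0 invr1.
rewrite exprSr invfM; apply: ZZ_linf; [exact: ok | exact: fw_supp | by rewrite invr_ge0 exprn_ge0 | ].
by move=> i'; apply: IHn; lia.
Qed.

(** A telescoping sum: on [D] each iterate is the next one plus [GG] of itself. The full pairing of
    that [GG] term with [h] runs over sampled rows only, and its part off [D] has to be subtracted
    again. *)
Lemma golf_identity q h n : supp D q ->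
  \sum_i (q i)^*%C * h i = \sum_i (fw q n i)^*%C * h i
   + \sum_(s < n) \sum_w (bw (inord s) w)%:C%C * ((Uv (fw q s) w)^*%C * Uv h w)
   - \sum_(s < n) \sum_(i in ~: D) (GG (inord s) (fw q s) i)^*%C * h i.
Proof.
move=> qD; elim: n => [|n IHn]; first by rewrite !big_ord0 addr0 subr0.
rewrite IHn !big_ord_recr /=.
set x := \sum_(s < n) _; set y := \sum_(s < n) _.
rewrite -conj_ip_GG [X in _ + (_ + X) - _](bigID (mem D)) /=.
rewrite [X in _ + (_ + (_ + X)) - _](eq_bigl (mem (~: D))); last by move=> i; rewrite !inE.
set u := \sum_(i in ~: D) _.
have -> : \sum_i (fw q n i)^*%C * h i = \sum_i (ZZ (inord n) (fw q n) i)^*%C * h i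
     + \sum_(i in D) (GG (inord n) (fw q n) i)^*%C * h i.
  rewrite (ip_supp _ (@ZZ_supp _ _)) (ip_supp _ (fw_supp n qD)) -big_split /=.
  by apply: eq_bigr => i iD; rewrite /ZZ iD cconjB; ring.
by ring.
Qed.

Lemma geom_bound (x : R) n : 0 <= x -> x <= 1 / 4 -> \sum_(s < n) x ^+ s <= 4 / 3.
Proof.
move=> x0 x1; apply: le_trans (geom_sum_le n x0 _) _; first by lra.
by rewrite -[leLHS]mul1r ler_pdivrMr; lra.
Qed.

(** * Deterministic error bound on the good event *)

Section Recovery.
Variables (E eta : R) (m : 'I_r -> nat) (Om : {set W}) (h sgn : vec) (sg : R).
Hypothesis E_ge1 : 1 <= E.
Hypothesis eta_ge0 : 0 <= eta.
(** Two bounds on the weights, each growing like [2 ^ s]: one in terms of [E] for the noise, one in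
    terms of the band size for the light bands. *)
Hypothesis pr_E : forall s w, (pr (s, w))^-1 <= 8 * 2 ^+ s * E.
Hypothesis pr_m : forall s w, (m (rlev w))%:R / pr (s, w) <= 16 * 2 ^+ s * 2 ^+ rlev w.
Hypothesis f_small : forall (s : 'I_L.+1) j, (#|[set w | (rlev w == j) && f (s, w)]| <= m j)%N.
Hypothesis f_Om : forall s w, f (s, w) -> w \in Om.
Hypothesis h_meas : l2 Om (Uv h) <= 2 * eta.
Hypothesis sgn_supp : supp D sgn.
Hypothesis sgn_le1 : forall i, cmod (sgn i) <= 1.
Hypothesis sgn_ok : fwok sgn.
Hypothesis ev_ok : forall i, i \in D -> fwok (ev i).
Hypothesis heavy_ok : forall i (s : 'I_L.+1), i \notin D -> stepok s heavy (ev i).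
Hypothesis bvd_ok : forall i s d, i \notin D -> (s <= L.+1)%N -> (0 < d < s)%N ->
  stepok (inord (s - d.+1)) predT (bvd (ev i) s d).
Hypothesis h_cone : \sum_(i in ~: D) cmod (h i) <= 2 * sg + cmod (\sum_i (sgn i)^*%C * h i).

(** Weighted Cauchy-Schwarz in each stage. The iterate has energy at most [2 * (l2 D q / 8 ^ s) ^ 2]
    and [h] at most [32 * 2 ^ s * E * eta ^ 2]; the root of the product decays faster than [4 ^ -s],
    and [sqrt E <= E]. *)
Lemma meas_term q n : fwok q -> supp D q -> (n <= L.+1)%N ->
  cmod (\sum_(s < n) \sum_w (bw (inord s) w)%:C%C * ((Uv (fw q s) w)^*%C * Uv h w))
    <= 16 * E * eta * l2 D q.
Proof.
move=> ok qD nL; apply: le_trans (cmod_sum _ _ _) _.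
have E0 : 0 <= E := le_trans ler01 E_ge1.
apply: (@le_trans _ _ (\sum_(s < n) 8 * E * eta * l2 D q * (1 / 4) ^+ s)); last first.
  have hX : \sum_(s < n) (1 / 4 : R) ^+ s <= 4 / 3 by apply: geom_bound; lra.
  rewrite -mulr_sumr.
  have -> : 16 * E * eta * l2 D q = 8 * E * eta * l2 D q * 2 by ring.
  apply: ler_wpM2l; last by apply: le_trans hX _; lra.
  by rewrite !mulr_ge0 ?l2_ge0 //.
apply: ler_sum => s _.
have sL : (s <= L)%N by exact: leq_trans (ltn_ord s) nL.
have en := energy (ok _ sL) (fw_supp s qD).
move: en; set si : 'I_L.+1 := inord s; set A := \sum_w _ => en.
have siE : si = s :> nat by rewrite /si inordK.
pose Bh := \sum_w bw si w * cmod (Uv h w) ^+ 2.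
have Bh_le : Bh <= 32 * 2 ^+ s * E * eta ^+ 2.
  apply: (@le_trans _ _ (\sum_(w in Om) 8 * 2 ^+ s * E * cmod (Uv h w) ^+ 2)).
    rewrite /Bh [leRHS]big_mkcond; apply: ler_sum => w _; rewrite /bw.
    case fw : (f (si, w)); last first.
      rewrite mul0r mul0r; case: ifP => // _.
      by rewrite mulr_ge0 ?sqr_ge0 // !mulr_ge0 // exprn_ge0.
    rewrite (f_Om fw) ler_wpM2r ?sqr_ge0 // mul1r.
    by apply: le_trans (pr_E si w) _; rewrite siE.
  rewrite -mulr_sumr -l2_sqr.
  have -> : 32 * 2 ^+ s * E * eta ^+ 2 = 8 * 2 ^+ s * E * (2 * eta) ^+ 2 by ring.
  rewrite ler_wpM2l ?mulr_ge0 ?exprn_ge0  //.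
  by rewrite ler_pXn2r ?nnegrE ?l2_ge0 ?mulr_ge0.
have hA : A <= 2 * (l2 D q / 8 ^+ s) ^+ 2.
  apply: le_trans en _; rewrite ler_wpM2l // ler_pXn2r ?nnegrE ?l2_ge0 ?divr_ge0 ?exprn_ge0 ?l2_ge0 //.
  by apply: fw_l2 => //; exact: leqW.
apply: (@le_trans _ _ (Num.sqrt A * Num.sqrt Bh)).
  apply: le_trans (cmod_sum _ _ _) _.
  rewrite -(@ler_pXn2r _ 2) ?nnegrE ?mulr_ge0 ?sqrtr_ge0 ?sumr_ge0 //; last first.
    by move=> w _; exact: cmod_ge0.
  have A0 : 0 <= A by apply: sumr_ge0 => w _; rewrite mulr_ge0 ?bw_ge0 ?sqr_ge0.
  have B0 : 0 <= Bh by apply: sumr_ge0 => w _; rewrite mulr_ge0 ?bw_ge0 ?sqr_ge0.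
  rewrite exprMn !(@sqr_sqrtr R) //.
  have := cauchy_schwarz predT (fun w => Num.sqrt (bw si w) * cmod (Uv (fw q s) w))
     (fun w => Num.sqrt (bw si w) * cmod (Uv h w)).
  have e w : Num.sqrt (bw si w) ^+ 2 = bw si w by rewrite sqr_sqrtr ?bw_ge0.
  rewrite (eq_bigr (fun w => cmod ((bw si w)%:C%C * ((Uv (fw q s) w)^*%C * Uv h w)))); last first.
    move=> w _; rewrite !cmodM cmodJ cmodR ger0_norm ?bw_ge0 // -[in RHS]e; ring.
  rewrite [X in _ <= X * _ -> _](eq_bigr (fun w => bw si w * cmod (Uv (fw q s) w) ^+ 2)); last first.
    by move=> w _; rewrite exprMn e.
  rewrite [X in _ <= _ * X -> _](eq_bigr (fun w => bw si w * cmod (Uv h w) ^+ 2)) //.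
  by move=> w _; rewrite exprMn e.
have q0 := l2_ge0 D q.
rewrite -(@ler_pXn2r _ 2) ?nnegrE ?mulr_ge0 ?sqrtr_ge0 ?exprn_ge0 //.
rewrite exprMn !(@sqr_sqrtr R); first last.
- by apply: sumr_ge0 => w _; rewrite mulr_ge0 ?bw_ge0 ?sqr_ge0.
- by apply: sumr_ge0 => w _; rewrite mulr_ge0 ?bw_ge0 ?sqr_ge0.
apply: (@le_trans _ _ (2 * (l2 D q / 8 ^+ s) ^+ 2 * (32 * 2 ^+ s * E * eta ^+ 2))).
  apply: ler_pM => //.
  - by apply: sumr_ge0 => w _; rewrite mulr_ge0 ?bw_ge0 ?sqr_ge0.
  - by apply: sumr_ge0 => w _; rewrite mulr_ge0 ?bw_ge0 ?sqr_ge0.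
have -> : 8 ^+ s = 2 ^+ s * 4 ^+ s :> R by rewrite -exprMn; congr (_ ^+ _); lra.
have -> : (1 / 4) ^+ s = (4 ^+ s)^-1 :> R by rewrite expr_div_n expr1n mul1r.
have p2 : 1 <= 2 ^+ s :> R by rewrite exprn_ege1 // ler1n.
have p4 : 0 < 4 ^+ s :> R by rewrite exprn_gt0.
move: p2 p4; set P := 2 ^+ s; set Q := 4 ^+ s => p2 p4.
have -> : 2 * (l2 D q / (P * Q)) ^+ 2 * (32 * P * E * eta ^+ 2)
  = (8 * eta * l2 D q / Q) ^+ 2 * (E / P) by field; rewrite !gt_eqF //; lra.
have -> : (8 * E * eta * l2 D q * Q^-1) ^+ 2 = (8 * eta * l2 D q / Q) ^+ 2 * E ^+ 2 by ring.
rewrite ler_wpM2l ?sqr_ge0 //.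
rewrite ler_pdivrMr; last exact: lt_le_trans ltr01 p2.
by rewrite expr2 -mulrA ler_peMr // mulr_ege1.
Qed.

Lemma E_ge0 : 0 <= E. Proof. exact: le_trans ler01 E_ge1. Qed.

(** No concentration is involved: at most [m j] rows of the band are selected, and each weight is at
    most the right side over [m j]. *)
Lemma sum_bw (s : 'I_L.+1) j : \sum_(w | rlev w == j) bw s w <= 16 * 2 ^+ s * 2 ^+ j.
Proof.
have X0 : 0 <= 16 * 2 ^+ s * 2 ^+ j :> R by rewrite !mulr_ge0 ?exprn_ge0.
have -> : \sum_(w | rlev w == j) bw s w
   = \sum_(w in [set w | (rlev w == j) && f (s, w)]) (pr (s, w))^-1.
  rewrite [RHS]big_mkcond [LHS]big_mkcond; apply: eq_bigr => w _; rewrite inE /bw.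
  by case: (rlev w == j); case: (f (s, w)); rewrite //= ?mul1r ?mul0r.
have := f_small s j; set S := [set w | _] => Sm.
case: (posnP (m j)) => [m0|m_gt0].
  by move: Sm; rewrite m0 leqn0 cards_eq0 => /eqP ->; rewrite big_set0.
apply: (@le_trans _ _ (\sum_(w in S) 16 * 2 ^+ s * 2 ^+ j / (m j)%:R)).
  apply: ler_sum => w; rewrite inE => /andP[/eqP wj _].
  by rewrite ler_pdivlMr ?ltr0n // mulrC -wj; exact: pr_m.
rewrite sumr_const -[leLHS]mulr_natr mulrAC ler_pdivrMr ?ltr0n //.
by rewrite ler_wpM2l // ler_nat.
Qed.

Lemma UU_le w i i' : 2 ^+ rlev w * (cmod (U w i) * cmod (U w i'))
  <= mu * (dk R (rlev w) (lev i) * dk R (rlev w) (lev i')).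
Proof.
have mu0 := ltW mu_gt0.
rewrite -(@ler_pXn2r _ 2) ?nnegrE ?mulr_ge0 ?exprn_ge0 ?cmod_ge0 ?dk_ge0 //.
have -> : (2 ^+ rlev w * (cmod (U w i) * cmod (U w i'))) ^+ 2
  = (2 ^+ rlev w * cmod (U w i) ^+ 2) * (2 ^+ rlev w * cmod (U w i') ^+ 2) by ring.
have -> : (mu * (dk R (rlev w) (lev i) * dk R (rlev w) (lev i'))) ^+ 2
  = (mu * dk R (rlev w) (lev i) ^+ 2) * (mu * dk R (rlev w) (lev i') ^+ 2) by ring.
by apply: ler_pM; rewrite ?U_coh ?mulr_ge0 ?exprn_ge0 ?cmod_ge0.
Qed.

Definition light_part (s : 'I_L.+1) i' i : R[i] :=
  \sum_(w | ~~ heavy (rlev w)) (bw s w)%:C%C * ((U w i)^*%C * U w i').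

Definition light_coef i' j : R := if heavy j then 0 else dk R j (lev i').

Lemma light_coord s i' i : cmod (light_part s i' i)
  <= 16 * 2 ^+ s * mu * \sum_(j < r) light_coef i' j * dk R j (lev i).
Proof.
apply: le_trans (cmod_sum _ _ _) _.
rewrite (partition_big rlev (fun j => ~~ heavy j)) //= mulr_sumr [leRHS](bigID heavy) /=.
rewrite [X in _ <= X + _]big1 ?add0r; last first.
  by move=> j Hj; rewrite /light_coef Hj mul0r mulr0.
apply: ler_sum => j Hj; rewrite (eq_bigl (fun w => rlev w == j)); last first.
  by move=> w; case: eqP => [->|]; rewrite ?Hj ?andbF.
rewrite /light_coef (negPf Hj).
apply: (@le_trans _ _ (\sum_(w | rlev w == j) bw s w * (mu * (dk R j (lev i) * dk R j (lev i')) / 2 ^+ j))).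
  apply: ler_sum => w /eqP <-; rewrite !cmodM cmodJ cmodR ger0_norm ?bw_ge0 //.
  by rewrite ler_wpM2l ?bw_ge0 // ler_pdivlMr ?exprn_gt0 // mulrC UU_le.
rewrite -mulr_suml; have := sum_bw s j; rewrite -(@ler_pM2r _ (mu * (dk R j (lev i) * dk R j (lev i')) / 2 ^+ j)); last first.
  by rewrite divr_gt0 ?exprn_gt0 // !mulr_gt0 ?dk_gt0.
move/le_trans; apply; rewrite le_eqVlt; apply/orP; left; apply/eqP; field.
by rewrite expf_neq0 ?pnatr_eq0.
Qed.

(** In a light band the squares of [dk j (lev i)] over all of [D] add up to less than 1, so [D]
    costs nothing. Cauchy-Schwarz over the bands with weights of total at most 8 turns 16 into
    128. *)
Lemma light_l2 s i' : l2 D (light_part s i') <= 128 * mu * 2 ^+ s.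
Proof.
have mu0 := ltW mu_gt0.
have a0 j : 0 <= light_coef i' j by rewrite /light_coef; case: ifP; rewrite ?dk_ge0.
have sa : \sum_j light_coef i' j <= 8.
  apply: le_trans (dk_sum8 (lev i')); apply: ler_sum => j _.
  by rewrite /light_coef; case: ifP => _ //; exact: dk_ge0.
have sa0 : 0 <= \sum_j light_coef i' j by apply: sumr_ge0.
apply: l2_bound; first by rewrite !mulr_ge0 ?exprn_ge0.
apply: (@le_trans _ _ (\sum_(i in D) (16 * 2 ^+ s * mu) ^+ 2 * (8 * \sum_(j < r) light_coef i' j * dk R j (lev i) ^+ 2))).
  apply: ler_sum => i _.
  apply: (@le_trans _ _ ((16 * 2 ^+ s * mu * \sum_(j < r) light_coef i' j * dk R j (lev i)) ^+ 2)).
    rewrite ler_pXn2r ?nnegrE ?cmod_ge0 ?light_coord //.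
    by rewrite (le_trans _ (light_coord s i' i)) ?cmod_ge0.
  rewrite exprMn ler_wpM2l ?sqr_ge0 //; apply: le_trans (sum_levels_sqr _ a0) _.
  rewrite ler_wpM2r //; apply: sumr_ge0 => j _; by rewrite mulr_ge0 ?sqr_ge0.
rewrite -!mulr_sumr.
have -> : (128 * mu * 2 ^+ s) ^+ 2 = (16 * 2 ^+ s * mu) ^+ 2 * (8 * 8) :> R by ring.
rewrite ler_wpM2l ?sqr_ge0 // ler_wpM2l // exchange_big /=.
apply: le_trans sa; apply: ler_sum => j _; rewrite -mulr_sumr /light_coef.
case: ifP => [_|/negbT]; first by rewrite mul0r.
rewrite /heavy -ltNge => Kj; rewrite ler_piMr ?dk_ge0 //.
exact: le_trans (sum_D_dk2 j) (ltW Kj).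
Qed.

(** For [p] the adjoint image of [y], the squared norm of [p] is the pairing of [Uv p] with [y], and
    [U] is an isometry. *)
Lemma bessel (y : W -> R[i]) : l2 D (fun i => \sum_w (U w i)^*%C * y w) <= l2 [set: W] y.
Proof.
set p := fun i => \sum_w (U w i)^*%C * y w.
apply: le_trans (l2_sub p (finset.subsetT D)) _.
have hp : l2 [set: I] p ^+ 2 = \sum_i cmod (p i) ^+ 2 by rewrite l2_sqr; apply: eq_bigl => i; rewrite inE.
have hU : l2 [set: W] (Uv p) = l2 [set: I] p by rewrite !l2TE parseval.
have key : l2 [set: I] p ^+ 2 <= l2 [set: I] p * l2 [set: W] y.
  have h0 : 0 <= l2 [set: I] p ^+ 2 by exact: sqr_ge0.
  rewrite -{1}(ger0_norm h0) -cmodR hp sum_realC.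
  have -> : \sum_i (cmod (p i) ^+ 2)%:C%C = \sum_(w in [set: W]) (Uv p w)^*%C * y w.
    rewrite [RHS](eq_bigl xpredT); last by move=> w; rewrite inE.
    under [RHS]eq_bigr => w _ do rewrite /Uv sum_conj big_distrl /=.
    rewrite exchange_big /=; apply: eq_bigr => i _.
    rewrite cmod_sqr mulrC; transitivity ((p i)^*%C * \sum_w (U w i)^*%C * y w); first by [].
    rewrite big_distrr /=; apply: eq_bigr => w _.
    by rewrite cconjM; ring.
  apply: le_trans (cmod_ip_le _ _ _) _.
  by rewrite (@eq_l2 _ _ _ _ (Uv p)) ?hU // => w _; exact: cmodJ.
have := l2_ge0 [set: I] p; rewrite le_eqVlt => /predU1P[<-|p0]; first exact: l2_ge0.
by rewrite -(ler_pM2l p0) -expr2.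
Qed.

(** In [ZZ_ev] the fluctuation over heavy bands contributes 1, their mean contributes 1 by [bessel],
    and the light bands contribute [128 * mu]. *)
Definition Bst : R := 2 + 128 * mu.

Lemma ZZ_ev (s : 'I_L.+1) i' : i' \notin D -> l2 D (ZZ s (ev i')) <= Bst * 2 ^+ s.
Proof.
move=> i'D; have mu0 := ltW mu_gt0.
pose a i := bdevC pr (zz s heavy (ev i') i) f.
pose c i := \sum_w (U w i)^*%C * (if heavy (rlev w) then U w i' else 0).
have -> : l2 D (ZZ s (ev i')) = l2 D (fun i => (a i + c i) + light_part s i' i).
  apply: eq_l2 => i iD; rewrite /ZZ iD /ev.
  have -> : i == i' = false by apply: contraNF i'D => /eqP <-.
  rewrite sub0r cmodN; congr cmod.
  rewrite /GG (bigID (fun w => heavy (rlev w))) /= /light_part; congr (_ + _); last first.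
    by apply: eq_bigr => w _; rewrite Uv_ev.
  rewrite /a bdevC_zz /c [X in _ = _ + X](bigID (fun w => heavy (rlev w))) /=.
  rewrite [X in _ = _ + (_ + X)]big1 ?addr0; last by move=> w /negPf ->; rewrite mulr0.
  rewrite -big_split /=; apply: eq_bigr => w ->; rewrite Uv_ev rmorphB rmorph1 /=; ring.
apply: le_trans (l2D _ _ _) _; have hl := light_l2 s i'.
apply: (le_trans (lerD (l2D _ _ _) hl)).
have ha : l2 D a <= 1.
  apply: l2_bound => //; rewrite expr1n.
  apply: (@le_trans _ _ (\sum_(i in D) 4 * tt2 th heavy (ev i') i)).
    apply: ler_sum => i iD.
    have -> : 4 * tt2 th heavy (ev i') i = (2 * Num.sqrt (tt2 th heavy (ev i') i)) ^+ 2.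
      by rewrite exprMn sqr_sqrtr ?tt2_ge0 //; ring.
    by rewrite ler_pXn2r ?nnegrE ?cmod_ge0 ?mulr_ge0 ?sqrtr_ge0 //; exact: heavy_ok.
  rewrite -mulr_sumr.
  have : \sum_(i in D) tt2 th heavy (ev i') i <= 256^-1 by apply: le_trans (tt2_heavy _ th_ge0) Cth_small.
  by lra.
have hc : l2 D c <= 1.
  apply: le_trans (bessel _) _; rewrite l2TE -sqrtr1 ler_wsqrtr //.
  have e1 : \sum_w cmod (U w i') ^+ 2 = 1.
    rewrite -(sum_ev i') -parseval; apply: eq_bigr => w _; by rewrite Uv_ev.
  rewrite -e1; apply: ler_sum => w _; case: ifP => _ //; by rewrite cmod0 expr0n sqr_ge0.
have p2 : 1 <= 2 ^+ s :> R by rewrite exprn_ege1 // ler1n.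
rewrite /Bst mulrDl; lra.
Qed.

(** Stage [s] acts first, on a vector off [D], and costs [Bst * 2 ^ s]; the [s] remaining stages
    contract by 8 each, which leaves [4 ^ -s]. *)
Lemma bvd_l2 i' s : i' \notin D -> (s <= L)%N ->
  l2 D (bvd (ev i') s.+1 s.+1) <= Bst * (1 / 4) ^+ s.
Proof.
move=> i'D sL.
have Bst0 : 0 <= Bst by rewrite /Bst addr_ge0 // mulr_ge0 // ltW.
have hd d : (d <= s)%N -> l2 D (bvd (ev i') s.+1 d.+1) <= Bst * 2 ^+ s / 8 ^+ d.
  elim: d => [_|d IHd ds].
    rewrite expr0 divr1 /= subSS subn0.
    by have := ZZ_ev (inord s) i'D; rewrite inordK.
  apply: (@le_trans _ _ (l2 D (bvd (ev i') s.+1 d.+1) / 8)).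
    apply: ZZ_l2; last exact: ZZ_supp.
    exact: bvd_ok.
  by rewrite exprSr invfM mulrA ler_wpM2r ?invr_ge0 //; apply: IHd; exact: ltnW.
apply: le_trans (hd s (leqnn s)) _; rewrite -mulrA ler_wpM2l // -expr_div_n.
by have -> : (2 / 8 : R) = 1 / 4 by field.
Qed.

(** Adjunction moves all stages from [ev i] to [ev i']. For fixed [i'] the errors at all [i] in [D]
    become the coordinates of one vector, whose l2 norm [bvd_l2] bounds without a factor for the
    size of [D]. *)
Lemma GG_fw_conj i i' s : i \in D -> i' \notin D -> (s <= L)%N ->
  (GG (inord s) (fw (ev i) s) i')^*%C = - bvd (ev i') s.+1 s.+1 i.
Proof.
move=> iD i'D sL; set si : 'I_L.+1 := inord s.
have evD : supp D (ev i) by move=> a aD; rewrite /ev; case: eqP aD => // ->; rewrite iD.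
have -> : (GG si (fw (ev i) s) i')^*%C = \sum_a (GG si (fw (ev i) s) a)^*%C * ev i' a.
  rewrite (bigD1 i') //= /ev eqxx mulr1 big1 ?addr0 // => a /negPf ->.
  by rewrite mulr0.
rewrite conj_ip_GG -ip_GG.
have -> : \sum_a (fw (ev i) s a)^*%C * GG si (ev i') a
   = - \sum_a (fw (ev i) s a)^*%C * ZZ si (ev i') a.
  rewrite -sumrN; apply: eq_bigr => a _; rewrite /ZZ; case: ifPn => [aD|/(fw_supp s evD) ->].
    have -> : ev i' a = 0 by rewrite /ev; case: eqP aD i'D => // -> ->.
    by rewrite sub0r mulrN opprK.
  by rewrite conjc0 !mul0r oppr0.
rewrite fw_adj //; last exact: ZZ_supp.
rewrite -bvdS (bigD1 i) //= /ev eqxx conjc1 mul1r big1 ?addr0 // => a /negPf ->.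
by rewrite conjc0 mul0r.
Qed.

Let kk := (\sum_l k l)%N.

Lemma card_D : (#|D| <= kk)%N.
Proof.
rewrite -sum1_card (partition_big lev predT) //=; apply: leq_sum => l _.
rewrite (leq_trans _ (D_sparse l)) // -sum1_card.
by rewrite [leqRHS](eq_bigl (fun i => (i \in D) && (lev i == l))) // => i; rewrite !inE.
Qed.

Let T := \sum_(i in ~: D) cmod (h i).
Let d : R := Num.sqrt kk%:R / 8 ^+ L.+1.

(** The cone condition combined with the golfing identity for the signs. Off [D] the stage images
    are bounded in sup norm by [8 ^ -s / 8], which sums to at most 1/6. *)
Lemma sgn_bound : T <= 2 * sg + d * l2 D h + 16 * E * eta * Num.sqrt kk%:R + T / 6.
Proof.
have sgn2 : l2 D sgn <= Num.sqrt kk%:R.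
  by have := l2_le_sup card_D ler01 (fun i _ => sgn_le1 i); rewrite mulr1.
rewrite /T; apply: le_trans h_cone _; rewrite -/T -!addrA lerD2l.
rewrite (golf_identity h L.+1 sgn_supp).
apply: le_trans (cmodD _ _) _; rewrite cmodN.
apply: (le_trans (lerD (cmodD _ _) (lexx _))); rewrite -addrA.
apply: lerD.
  apply: le_trans (ip_l2 _ (fw_supp _ sgn_supp)) _; rewrite ler_wpM2r ?l2_ge0 //.
  apply: le_trans (fw_l2 sgn_ok sgn_supp (leqnn _)) _.
  by rewrite ler_wpM2r // invr_ge0 exprn_ge0.
apply: lerD.
  apply: le_trans (meas_term sgn_ok sgn_supp (leqnn _)) _.
  by rewrite ler_wpM2l // !mulr_ge0 // E_ge0.
apply: le_trans (cmod_sum _ _ _) _.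
apply: (@le_trans _ _ (\sum_(s < L.+1) (1 / 8) ^+ s * (T / 8))); last first.
  have hX : \sum_(s < L.+1) (1 / 8 : R) ^+ s <= 4 / 3 by apply: geom_bound; lra.
  have T0 : 0 <= T by apply: sumr_ge0 => i _; exact: cmod_ge0.
  rewrite -mulr_suml; have : 0 <= T / 8 by rewrite divr_ge0.
  move/ler_wpM2r => /(_ _ _ hX)/le_trans; apply; lra.
apply: ler_sum => s _; apply: le_trans (cmod_sum _ _ _) _.
rewrite /T mulr_suml mulr_sumr; apply: ler_sum => i; rewrite inE => iD.
have -> : (1 / 8) ^+ s * (cmod (h i) / 8) = (8 ^+ s)^-1 / 8 * cmod (h i) :> R.
  by rewrite expr_div_n expr1n; ring.
rewrite cmodM cmodJ ler_wpM2r ?cmod_ge0 //.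
have sL : (s <= L)%N := ltn_ord s.
have := @GG_linf (inord s) (fw sgn s) ((8 ^+ s)^-1) i (sgn_ok sL) (fw_supp s sgn_supp).
rewrite (fw_supp s sgn_supp iD) subr0; apply.
- by rewrite invr_ge0 exprn_ge0.
- by move=> i''; apply: fw_linf => //; exact: leqW.
Qed.

(** The golfing identity for [ev i] represents each [h i] with [i] in [D]. The residual and
    measurement terms are bounded per coordinate; the error off [D] is kept as a vector, a
    combination of backward iterates with coefficients [h i']. *)
Lemma inj_bound : l2 D h <= d * l2 D h + 16 * E * eta * Num.sqrt kk%:R + 4 / 3 * Bst * T.
Proof.
have evD i : i \in D -> supp D (ev i).
  by move=> iD a aD; rewrite /ev; case: eqP aD => // ->; rewrite iD.
have ev1 i : i \in D -> l2 D (ev i) = 1.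
  move=> iD; rewrite /l2 -[RHS]sqrtr1 -(sum_ev i) (supp_l2 (evD i iD)) l2_sqr //.
pose a i := \sum_i' (fw (ev i) L.+1 i')^*%C * h i'.
pose c i := \sum_(s < L.+1) \sum_w (bw (inord s) w)%:C%C * ((Uv (fw (ev i) s) w)^*%C * Uv h w).
pose e i := \sum_(s < L.+1) \sum_(i' in ~: D) h i' * bvd (ev i') s.+1 s.+1 i.
have hE : l2 D h = l2 D (fun i => (a i + c i) + e i).
  apply: eq_l2 => i iD; congr cmod.
  have -> : h i = \sum_i' (ev i i')^*%C * h i'.
    rewrite (bigD1 i) //= /ev eqxx conjc1 mul1r big1 ?addr0 // => i' /negPf ->.
    by rewrite conjc0 mul0r.
  rewrite (golf_identity h L.+1 (evD i iD)); congr (_ + _).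
  rewrite -sumrN; apply: eq_bigr => s _; rewrite -sumrN; apply: eq_bigr => i'; rewrite inE => i'D.
  by rewrite GG_fw_conj //; [ring | exact: (ltn_ord s)].
rewrite {1}hE; apply: le_trans (l2D _ _ _) _; apply: lerD; first apply: le_trans (l2D _ _ _) _; first apply: lerD.
- have B0 : 0 <= l2 D h / 8 ^+ L.+1 by rewrite divr_ge0 ?l2_ge0 ?exprn_ge0.
  have -> : d * l2 D h = Num.sqrt kk%:R * (l2 D h / 8 ^+ L.+1) by rewrite /d; ring.
  apply: l2_le_sup card_D B0 _ => i iD.
  apply: le_trans (ip_l2 _ (fw_supp _ (evD i iD))) _; rewrite mulrC ler_wpM2l ?l2_ge0 //.
  have := fw_l2 (ev_ok iD) (evD i iD) (leqnn _); by rewrite ev1 // mul1r.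
- have B0 : 0 <= 16 * E * eta by rewrite !mulr_ge0 ?E_ge0.
  rewrite [leRHS]mulrC; apply: l2_le_sup card_D B0 _ => i iD.
  by have := meas_term (ev_ok iD) (evD i iD) (leqnn _); rewrite ev1 // mulr1.
apply: le_trans (l2_sum _ _ _ _) _.
have Bst0 : 0 <= Bst by rewrite /Bst addr_ge0 // mulr_ge0 // ltW.
have T0 : 0 <= T by apply: sumr_ge0 => i _; exact: cmod_ge0.
apply: (@le_trans _ _ (\sum_(s < L.+1) (1 / 4) ^+ s * (Bst * T))); last first.
  have hX : \sum_(s < L.+1) (1 / 4 : R) ^+ s <= 4 / 3 by apply: geom_bound; lra.
  by rewrite -mulr_suml -[leRHS]mulrA ler_wpM2r // mulr_ge0.
apply: ler_sum => s _; apply: le_trans (l2_sum _ _ _ _) _.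
rewrite /T mulr_sumr mulr_sumr; apply: ler_sum => i; rewrite inE => iD.
rewrite l2Z; have sL : (s <= L)%N := ltn_ord s.
have -> : (1 / 4) ^+ s * (Bst * cmod (h i)) = cmod (h i) * (Bst * (1 / 4) ^+ s) by ring.
by rewrite ler_wpM2l ?cmod_ge0 // bvd_l2.
Qed.

(** The two preceding bounds feed each other: [sgn_bound] involves [d * l2 D h] and [inj_bound]
    involves [Bst * T]. Smallness of [d * Bst] closes the loop. *)
Lemma recovery : d <= 1 / 4 -> d * Bst <= 1 / 14 ->
  l2 [set: I] h <= (1 + 2 * Bst) * (3 * sg + 64 * (E * eta * Num.sqrt kk%:R)).
Proof.
move=> d1 d2; have h1 := sgn_bound; have h2 := inj_bound.
have h3 : l2 [set: I] h <= l2 D h + T by apply: le_trans (l2_split D h) _; rewrite lerD2l l2_le_l1.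
have T0 : 0 <= T by apply: sumr_ge0 => i _; exact: cmod_ge0.
have a0 : 0 <= E * eta * Num.sqrt kk%:R by rewrite !mulr_ge0 ?E_ge0 ?sqrtr_ge0.
have B0 : 2 <= Bst by rewrite /Bst lerDl mulr_ge0 // ltW.
have d0 : 0 <= d by rewrite divr_ge0 ?sqrtr_ge0 ?exprn_ge0.
have n0 := l2_ge0 D h.
move: h1 h2 h3 T0 a0 B0 d0 n0 d1 d2.
have -> : 16 * E * eta * Num.sqrt kk%:R = 16 * (E * eta * Num.sqrt kk%:R) by ring.
move: (E * eta * _) (l2 D h) T Bst d (l2 [set: I] h) => A n t B e N.
move=> h1 h2 h3 t0 A0 B2 e0 n0 e1 eB.
have n1 : n <= 4 / 3 * (16 * A + 4 / 3 * B * t) by nra.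
have en : e * n <= 4 / 3 * (16 * A / 4 + 4 / 3 * t / 14) by nra.
(* The coefficients of [t] on the right add up to [1/6 + 8/63], less than 1/3, so [t] is at most 3/2
   times [2 * sg + (16 + 16/3) * A]. *)
have t1 : t <= 3 * sg + 32 * A by lra.
have Bt : B * t <= B * (3 * sg + 32 * A) by nra.
have BA : 2 * A <= B * A by nra.
nra.
Qed.
End Recovery.
End Process.

(** * Probability that every required stage contracts *)

Section GoodEvent.
Variables (L : nat) (pr : 'I_L.+1 * W -> R) (Lam th : R) (sgn : vec).
Hypothesis pr_gt0 : forall t, 0 < pr t.
Hypothesis pr_le1 : forall t, pr t <= 1.
Hypothesis Lam_gt0 : 0 < Lam.
Hypothesis th_ge0 : 0 <= th.
Hypothesis pr_large : forall s w, Lam * KK (rlev w) <= th * 2 ^+ rlev w * pr (s, w).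

Local Notation sp := {ffun 'I_L.+1 * W -> bool}.
Implicit Types f : sp.

Definition agree_off (s : 'I_L.+1) f f' := forall s' w, s' != s -> f (s', w) = f' (s', w).

Definition stepokb f s H q : bool :=
  [forall i, cmod (bdevC pr (zz s H q i) f) <= 2 * Num.sqrt (tt2 th H q i)].

Lemma stepokP f s H q : reflect (stepok pr th f s H q) (stepokb f s H q).
Proof. exact: forallP. Qed.

(** With the other stages frozen by [bP_resample], [Q f] is a fixed vector and [step_prob] applies
    to each coordinate; [#|I|] comes from the union bound. *)
Lemma step_union s (H : pred 'I_r) (Q : sp -> vec) :
  (forall f f', agree_off s f f' -> Q f = Q f') ->
  bP pr (fun f => ~~ stepokb f s H (Q f)) <= #|I|%:R * (4 * expR (- Lam)).
Proof.
move=> hQ; apply: (bP_resample pr_gt0 pr_le1 (A := [set t | t.1 == s])) => f.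
apply: (@le_trans _ _ (bP pr (fun f' => [exists i,
   ~~ (cmod (bdevC pr (zz s H (Q f) i) f') <= 2 * Num.sqrt (tt2 th H (Q f) i))]))).
  apply: bP_mono => // f'; rewrite negb_forall.
  have -> : Q (bmix [set t | t.1 == s] f' f) = Q f.
    by apply: hQ => s' w s's; rewrite ffunE inE /= (negPf s's).
  move=> /existsP[i hi]; apply/existsP; exists i; move: hi.
  rewrite (_ : bdevC pr _ (bmix _ _ _) = bdevC pr (zz s H (Q f) i) f') //.
  apply: eq_bigr => t _; rewrite /zz ffunE inE; case: eqP => //= _.
  by rewrite !mulr0.
apply: le_trans (bP_union pr_gt0 pr_le1 _) _.
apply: (@le_trans _ _ (\sum_(i : I) 4 * expR (- Lam))).
  by apply: ler_sum => i _; exact: step_prob.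
by rewrite sumr_const -[leLHS]mulr_natl.
Qed.

Lemma ZZ_ext s f f' q : (forall w, f (s, w) = f' (s, w)) -> ZZ pr f s q = ZZ pr f' s q.
Proof.
move=> h; apply/funext => i; rewrite /ZZ /GG; case: ifP => // _; congr (_ - _).
by apply: eq_bigr => w _; rewrite /bw h.
Qed.

Lemma inord_neq (a b : nat) : (a <= L)%N -> (b <= L)%N -> a != b -> (inord a : 'I_L.+1) != inord b.
Proof. by move=> aL bL; apply: contraNN => /eqP/(congr1 val); rewrite /= !inordK // => ->. Qed.

Lemma fw_ext f f' q (s n : nat) : (s <= L)%N -> (n <= s)%N -> agree_off (inord s) f f' ->
  fw pr f q n = fw pr f' q n.
Proof.
move=> sL + ff'; elim: n => [//|n IHn] ns /=.
rewrite IHn; last exact: ltnW.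
apply: ZZ_ext => w; apply: ff'; apply: inord_neq => //; first exact: leq_trans (ltnW ns) sL.
by rewrite neq_ltn ns.
Qed.

(** Only stages [s - 1] down to [s - d'] are consulted, all above [s - d.+1]. *)
Lemma bvd_ext f f' q (s d d' : nat) : (s <= L.+1)%N -> (d < s)%N -> (d' <= d)%N ->
  agree_off (inord (s - d.+1)) f f' -> bvd pr f q s d' = bvd pr f' q s d'.
Proof.
move=> sL ds + ff'; elim: d' => [//|d' IHd] d'd /=.
rewrite IHd; last exact: ltnW.
apply: ZZ_ext => w; apply: ff'.
have sdL a : (s - a.+1 <= L)%N by rewrite leq_subLR; apply: leq_trans sL _; rewrite addSn ltnS leq_addl.
apply: inord_neq => //.
by rewrite gtn_eqF // ltn_sub2l // (leq_ltn_trans _ ds).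
Qed.

(** Here [None] stands for the sign pattern. The backward family starts at [d = 1]: at [d = 0] its
    input is a unit vector, used off [D], for which only the heavy bands concentrate, and this is
    the second family. *)
Definition good f : bool :=
  [&& [forall x : option I * 'I_L.+1, let q := if x.1 is Some i then ev i else sgn in
         stepokb f x.2 predT (fw pr f q x.2)],
      [forall x : I * 'I_L.+1, stepokb f x.2 heavy (ev x.1)]
    & [forall x : I * ('I_L.+2 * 'I_L.+1), (0 < x.2.2 < x.2.1)%N ==>
         stepokb f (inord (x.2.1 - x.2.2.+1)) predT (bvd pr f (ev x.1) x.2.1 x.2.2)]].

Lemma good_fwok_sgn f : good f -> fwok pr th f sgn.
Proof.
move=> /and3P[/forallP h _ _] s sL; have := h (None, inord s); rewrite /= inordK //.
by move/stepokP.
Qed.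

Lemma good_fwok_ev f i : good f -> fwok pr th f (ev i).
Proof.
move=> /and3P[/forallP h _ _] s sL; have := h (Some i, inord s); rewrite /= inordK //.
by move/stepokP.
Qed.

Lemma good_heavy f i s : good f -> stepok pr th f s heavy (ev i).
Proof. by move=> /and3P[_ /forallP h _]; have /stepokP := h (i, s). Qed.

Lemma good_bvd f i s d : good f -> (s <= L.+1)%N -> (0 < d < s)%N ->
  stepok pr th f (inord (s - d.+1)) predT (bvd pr f (ev i) s d).
Proof.
move=> /and3P[_ _ /forallP h] sL ds; have := h (i, (inord s, inord d)).
have dL : (d < L.+1)%N by case/andP: ds => _ ds; exact: leq_trans ds sL.
by rewrite /= !inordK // ds => /stepokP.
Qed.

Lemma good_prob : bP pr (fun f => ~~ good f)
  <= 4 * (#|I|.+1 ^ 2 * L.+2 ^ 2)%:R * (4 * expR (- Lam)).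
Proof.
set e := 4 * expR (- Lam).
have e0 : 0 <= e by rewrite mulr_ge0 ?expR_ge0.
have all_le (J : finType) (G : J -> sp -> bool) :
    (forall x, bP pr (fun f => ~~ G x f) <= #|I|%:R * e) ->
    bP pr (fun f => ~~ [forall x, G x f]) <= (#|J| * #|I|)%:R * e.
  move=> hG; apply: (@le_trans _ _ (bP pr (fun f => [exists x, ~~ G x f]))).
    by apply: bP_mono => // f; rewrite negb_forall.
  apply: le_trans (bP_union pr_gt0 pr_le1 _) _.
  apply: (@le_trans _ _ (\sum_(x : J) #|I|%:R * e)); first by apply: ler_sum => x _.
  by rewrite sumr_const -[leLHS]mulr_natl natrM mulrA.
have h1 : bP pr (fun f => ~~ [forall x : option I * 'I_L.+1,
     let q := if x.1 is Some i then ev i else sgn in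
         stepokb f x.2 predT (fw pr f q x.2)]) <= (#|{: option I * 'I_L.+1}| * #|I|)%:R * e.
  apply: all_le => -[u s] /=; apply: step_union => f f' ff'.
  by apply: (@fw_ext _ _ _ s); rewrite ?leq_ord // inord_val.
have h2 : bP pr (fun f => ~~ [forall x : I * 'I_L.+1, stepokb f x.2 heavy (ev x.1)])
   <= (#|{: I * 'I_L.+1}| * #|I|)%:R * e.
  by apply: all_le => -[i s] /=; apply: step_union.
have h3 : bP pr (fun f => ~~ [forall x : I * ('I_L.+2 * 'I_L.+1), (0 < x.2.2 < x.2.1)%N ==>
         stepokb f (inord (x.2.1 - x.2.2.+1)) predT (bvd pr f (ev x.1) x.2.1 x.2.2)])
   <= (#|{: I * ('I_L.+2 * 'I_L.+1)}| * #|I|)%:R * e.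
  apply: all_le => -[i [s d]] /=; case ds: (0 < d < s)%N => /=; last first.
    apply: (@le_trans _ _ (bE pr (fun=> 0))); last first.
      by rewrite bE_const mulr_ge0.
    exact: lexx.
  apply: step_union => f f' ff'; case/andP: ds => _ ds.
  by apply: (bvd_ext _ _ ds (leqnn d) ff'); exact: leq_ord.
apply: (@le_trans _ _ ((#|{: option I * 'I_L.+1}| * #|I|)%:R * e + ((#|{: I * 'I_L.+1}| * #|I|)%:R * e
   + (#|{: I * ('I_L.+2 * 'I_L.+1)}| * #|I|)%:R * e))).
  apply: le_trans (lerD h1 (lerD h2 h3)).
  apply: le_trans (lerD (lexx _) (bP_or pr_gt0 pr_le1 _ _)).
  apply: le_trans (bP_or pr_gt0 pr_le1 _ _).
  by apply: bP_mono => // f; rewrite /good !negb_and.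
rewrite -!mulrDl -!natrD; apply: ler_wpM2r => //; rewrite -natrM ler_nat.
rewrite !card_prod !card_ord card_option; nia.
Qed.

End GoodEvent.
End Golf.

(** * Complex exponentials, character sums and bounds on the sine *)

Section Exponential.
Variable R : realType.
Implicit Types (x y : R).

Definition ez x : R[i] := expi (2 * pi * x).

Lemma expiD x y : expi (x + y) = expi x * expi y.
Proof.
rewrite /expi sinD cosD; apply/eqP; rewrite eq_complex /=; apply/andP; split => //.
by apply/eqP; ring.
Qed.

Lemma ezD x y : ez (x + y) = ez x * ez y.
Proof. by rewrite /ez mulrDr expiD. Qed.

Lemma ez0 : ez 0 = 1.
Proof. by rewrite /ez /expi mulr0 cos0 sin0. Qed.

Lemma ezN x : ez (- x) = (ez x)^*%C.
Proof. by rewrite /ez /expi mulrN cosN sinN. Qed.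

Lemma cmod_ez x : cmod (ez x) = 1.
Proof. by rewrite /cmod /= cos2Dsin2 sqrtr1. Qed.

Lemma ezX x n : ez x ^+ n = ez (x * n%:R).
Proof.
elim: n => [|n IHn]; first by rewrite expr0 mulr0 ez0.
by rewrite exprSr IHn -ezD -[in RHS]natr1 mulrDr mulr1.
Qed.

Lemma ez1 : ez 1 = 1.
Proof.
have -> : ez 1 = expi (pi *+ 2) :> R[i] by rewrite /ez mulr1 mulr_natl.
by rewrite /expi cos2pi sin2pi.
Qed.

Lemma ez_int (z : int) : ez z%:~R = 1.
Proof.
have en n : ez n%:R = 1 by rewrite -[n%:R]mul1r -ezX ez1 expr1n.
case: z => n; first exact: en.
by rewrite NegzE mulrNz ezN en conjc1.
Qed.

Lemma cmod_1Bez x : cmod (1 - ez x) = 2 * `|sin (pi * x)|.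
Proof.
have -> : 2 * `|sin (pi * x)| = Num.sqrt ((2 * sin (pi * x)) ^+ 2).
  by rewrite sqrtr_sqr normrM ger0_norm.
have e1 : cos (2 * pi * x) = 1 - 2 * sin (pi * x) ^+ 2.
  by rewrite -mulrA mulr_natl cos_mulr2n cos2sin2 -mulr_natl; ring.
rewrite /cmod /ez /expi /=; congr Num.sqrt.
rewrite sub0r sqrrN sin2cos2 e1; ring.
Qed.

Lemma sin_le x : 0 <= x -> sin x <= x.
Proof.
rewrite le_eqVlt => /predU1P[<-|x0]; first by rewrite sin0.
have [|c _] := @MVT R (@sin R) (@cos R) 0 x x0 (fun y _ => is_derive_sin y).
  by apply: continuous_subspaceT => z; exact: continuous_sin.
rewrite sin0 !subr0 => ->; have := cos_le1 c; nra.
Qed.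

Lemma normr_sin_le x : `|sin x| <= `|x|.
Proof.
wlog x0 : x / 0 <= x => [h|].
  have [|/ltW x0] := leP 0 x; first exact: h.
  by rewrite -normrN -sinN -[`|x|]normrN; apply: h; rewrite oppr_ge0.
rewrite [`|x|]ger0_norm // ler_norml sin_le // andbT lerNl.
have [xpi|xpi] := leP x pi.
  by apply: (@le_trans _ _ 0); rewrite ?oppr_le0 // sin_ge0_pi // x0.
have := sin_geN1 x; have := pi_ge2 R; lra.
Qed.

(** The mean value theorem and the monotonicity of the cosine give [sin (x/2) >= cos (x/2) * (x/2)];
    doubling the angle turns this into [sin x >= (1 + cos x) * x / 2]. *)
Lemma sin_ge_half x : 0 <= x -> x <= pi / 2 -> x / 2 <= sin x.
Proof.
rewrite le_eqVlt => /predU1P[<- _|x0 xpi]; first by rewrite sin0 mul0r.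
have pi0 := pi_gt0 R.
have y0 : 0 < x / 2 by rewrite divr_gt0.
have [|c] := @MVT R (@sin R) (@cos R) 0 (x / 2) y0 (fun y _ => is_derive_sin y).
  by apply: continuous_subspaceT => z; exact: continuous_sin.
rewrite in_itv /= => /andP[c0 cx]; rewrite sin0 !subr0 => e.
have hc : cos (x / 2) <= cos c.
  apply: ltW; rewrite ltr_cos // in_itv /=; apply/andP; split; lra.
have cy : 0 <= cos (x / 2) by apply: cos_ge0_pihalf; apply/andP; split; lra.
have cx0 : 0 <= cos x by apply: cos_ge0_pihalf; apply/andP; split; lra.
have e2 : sin x = 2 * (cos (x / 2) * sin (x / 2)).
  by rewrite -[x in LHS](_ : (x / 2) *+ 2 = x) ?sin_mulr2n ?mulr_natl // -mulr_natl; field.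
have e3 : cos x = 2 * cos (x / 2) ^+ 2 - 1.
  by rewrite -[x in LHS](_ : (x / 2) *+ 2 = x) ?cos_mulr2n -mulr_natl //; field.
have h1 : cos (x / 2) * (x / 2) <= sin (x / 2) by rewrite e ler_wpM2r // ltW.
have h2 : cos (x / 2) * (cos (x / 2) * (x / 2)) <= cos (x / 2) * sin (x / 2) by rewrite ler_wpM2l.
have h3 : cos (x / 2) * (cos (x / 2) * (x / 2)) = (1 + cos x) / 2 * (x / 2) by rewrite e3; field.
rewrite e2; apply: (@le_trans _ _ (2 * ((1 + cos x) / 2 * (x / 2)))); last by lra.
have : 0 <= cos x * x by rewrite mulr_ge0 // ltW.
lra.
Qed.

Lemma sin_pi_lower x : `|x| <= 1 / 2 -> `|x| <= `|sin (pi * x)|.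
Proof.
have pi2 := pi_ge2 R.
wlog x0 : x / 0 <= x => [h|].
  have [|/ltW x0] := leP 0 x; first exact: h.
  move=> hx; have := h (- x); rewrite mulrN sinN !normrN; apply => //.
  by rewrite oppr_ge0.
rewrite [`|x|]ger0_norm // => hx.
apply: le_trans (ler_norm _); apply: le_trans (sin_ge_half _ _); nra.
Qed.

Lemma ez_neq1 x : 0 < x -> x < 1 -> ez x != 1.
Proof.
move=> x0 x1; rewrite eq_sym -subr_eq0 -cmod_eq0 cmod_1Bez mulf_eq0 negb_or pnatr_eq0 /=.
rewrite normr_eq0 gt_eqF // sin_gt0_pi // mulr_gt0 ?pi_gt0 //=.
by rewrite -[ltRHS]mulr1 ltr_pM2l ?pi_gt0.
Qed.

Lemma unity_sum (M : nat) (z : R[i]) : z ^+ M = 1 -> z != 1 -> \sum_(s < M) z ^+ s = 0.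
Proof.
move=> zM z1; apply/eqP; have := subrX1 z M; rewrite zM subrr => /eqP.
by rewrite eq_sym mulf_eq0 subr_eq0 (negPf z1).
Qed.

(** A nontrivial character summed over whole periods. The shift [c] accommodates frequency windows
    that do not start at 0. *)
Lemma ez_sum (M d : nat) (a c : int) : (0 < M)%N -> (0 < d)%N -> (d %| M)%N ->
  ~~ (d%:Z %| a)%Z ->
  \sum_(s < M) ez ((s%:Z + c)%:~R * a%:~R / d%:R) = 0.
Proof.
move=> M0 d0 dM da.
have dn0 : d%:R != 0 :> R by rewrite pnatr_eq0 -lt0n.
rewrite (eq_bigr (fun s : 'I_M => ez (c%:~R * a%:~R / d%:R) * ez (a%:~R / d%:R) ^+ s)); last first.
  move=> s _; rewrite ezX -ezD; congr ez; rewrite rmorphD /=.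
  by rewrite -pmulrn; field.
rewrite -mulr_sumr unity_sum ?mulr0 //.
  have /dvdnP[q ->] := dM.
  have e : a%:~R / d%:R * (q%:R * d%:R) = (a * q%:Z)%:~R :> R.
    by rewrite rmorphM /= -pmulrn; field.
  by rewrite ezX natrM e ez_int.
apply/negP => /eqP h; move: da; apply/negP/negPn.
have d0z : d%:Z != 0 by rewrite -lt0n.
have e := divz_eq a d%:Z.
have m0 : (0 <= a %% d%:Z)%Z by rewrite modz_ge0.
have m1 : (a %% d%:Z < d%:Z)%Z by rewrite ltz_pmod // ltz_nat.
apply/dvdz_mod0P/eqP; apply/negPn/negP => mn0.
have : ez ((a %% d%:Z)%Z%:~R / d%:R) != 1.
  apply: ez_neq1; first by rewrite divr_gt0 ?ltr0n // ltr0z lt_neqAle eq_sym mn0.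
  by rewrite ltr_pdivrMr ?ltr0n // mul1r [d%:R]pmulrn ltr_int.
apply/negP/negPn/eqP; rewrite -h [in RHS]e [in RHS]intrD [in RHS]intrM -[d%:Z%:~R]pmulrn.
by rewrite [in RHS]mulrDl mulfK // ezD ez_int mul1r.
Qed.

End Exponential.

(** * Orthonormality of the Haar basis *)

Section HaarReal.
Variables (R : realType) (r : nat).

(** The Haar vector through the index [q] of the half-block that contains [t]: the sign is plus for
    [q = 2p] and minus for [q = 2p + 1]. Natural indices let sums be split by level. *)
Definition haarn (b t : nat) : R :=
  if b == 0%N then Num.sqrt ((2 ^+ r)^-1)
  else let j := trunc_log 2 b in
       let q := (t %/ 2 ^ (r - j.+1))%N in
       Num.sqrt (2 ^+ j / 2 ^+ r)
         * ((q == 2 * (b - 2 ^ j))%N%:R - (q == (2 * (b - 2 ^ j)).+1)%N%:R).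

Lemma trunc_log_lt (b : nat) : (0 < b)%N -> (b < 2 ^ r)%N -> (trunc_log 2 b < r)%N.
Proof.
move=> b0 br; rewrite -(ltn_exp2l _ _ (isT : 1 < 2)%N).
by apply: leq_ltn_trans br; apply: trunc_logP.
Qed.

Lemma divn_eqE (t H q : nat) : (0 < H)%N -> ((t %/ H)%N == q) = ((q * H <= t) && (t < q.+1 * H))%N.
Proof. by move=> H0; rewrite eqn_leq -ltnS ltn_divLR // leq_divRL // andbC. Qed.

Lemma haarE (b t : 'I_(2 ^ r)) : haar R b t = haarn b t.
Proof.
rewrite /haar /haarn; case: eqP => // /eqP b0; rewrite -lt0n in b0.
set j := trunc_log 2 b; set p := (b - 2 ^ j)%N.
have jr : (j < r)%N by exact: trunc_log_lt.
have -> : (2 ^ (r - j) = 2 * 2 ^ (r - j.+1))%N by rewrite -expnS; congr (2 ^ _)%N; rewrite subnSK.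
set H := (2 ^ (r - j.+1))%N; have H0 : (0 < H)%N by rewrite expn_gt0.
have -> : ((2 * H)./2 = H)%N by rewrite mul2n doubleK.
rewrite !divn_eqE //.
have -> : (p * (2 * H) = 2 * p * H)%N by rewrite mulnCA mulnA.
have -> : (2 * p * H + H = (2 * p).+1 * H)%N by rewrite mulSn addnC.
have -> : (2 * p * H + 2 * H = (2 * p).+2 * H)%N by rewrite -mulnDl addn2.
rewrite !(leqNgt ((2 * p).+1 * H)).
case: (boolP (2 * p * H <= t)%N) => h1; case: (boolP (t < (2 * p).+1 * H)%N) => h2 /=.
- by rewrite subr0 mulr1.
- by case: ifP => _ /=; rewrite ?subrr ?mulr0 // sub0r mulrN mulr1.
- by rewrite subrr mulr0.
by exfalso; move: h1 h2; rewrite (mulSn (2 * p)); move: (2 * p * H)%N => X; lia.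
Qed.

Lemma sum_haar_index (G : nat -> R) (n : nat) :
  \sum_(b < 2 ^ n) G b = G 0%N + \sum_(j < n) \sum_(p < 2 ^ j) G (2 ^ j + p)%N.
Proof.
elim: n => [|n IHn]; first by rewrite expn0 big_ord1 big_ord0 addr0.
rewrite big_ord_recr /= addrA -IHn -!(big_mkord xpredT G) expnS mul2n -addnn.
rewrite (@big_cat_nat _ _ _ (2 ^ n)%N) ?leq_addr //=; congr (_ + _).
by rewrite -{1}[(2 ^ n)%N]add0n big_addn addnK big_mkord; apply: eq_bigr => p _; rewrite addnC.
Qed.

Lemma trunc_log_add j p : (p < 2 ^ j)%N -> trunc_log 2 (2 ^ j + p) = j.
Proof.
move=> pj; apply: trunc_log_eq => //.
by rewrite leq_addr expnS mul2n -addnn ltn_add2l.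
Qed.

Lemma haarn_add j p t : (p < 2 ^ j)%N -> haarn (2 ^ j + p) t =
  Num.sqrt (2 ^+ j / 2 ^+ r) * ((t %/ 2 ^ (r - j.+1) == 2 * p)%N%:R - (t %/ 2 ^ (r - j.+1) == (2 * p).+1)%N%:R).
Proof.
move=> pj; rewrite /haarn addn_eq0 expn_eq0 /=.
by rewrite trunc_log_add // addKn.
Qed.

(** The sum is 1 within one half-block, -1 between siblings and 0 otherwise. Written with same
    half-block and same block, it telescopes over the levels. *)
Lemma haar_level (j q q' : nat) : (q < 2 ^ j.+1)%N ->
  \sum_(p < 2 ^ j) ((q == 2 * p)%N%:R - (q == (2 * p).+1)%N%:R)
       * ((q' == 2 * p)%N%:R - (q' == (2 * p).+1)%N%:R)
  = 2 * (q == q')%:R - (q./2 == q'./2)%N%:R :> R.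
Proof.
move=> qj; have q2 : (q./2 < 2 ^ j)%N by move: qj; rewrite expnS; lia.
rewrite (bigD1 (Ordinal q2)) //= big1 ?addr0 => [|p /eqP pq]; last first.
  have ne : q./2 <> p by move=> e; apply: pq; apply: val_inj.
  have -> : (q == 2 * p)%N = false by lia.
  have -> : (q == (2 * p).+1)%N = false by lia.
  by rewrite subrr mul0r.
have -> : (q == 2 * q./2)%N = ~~ odd q by lia.
have -> : (q == (2 * q./2).+1)%N = odd q by lia.
case: (eqVneq q q') => [<-|qq'].
  rewrite eqxx; have -> : (q == 2 * q./2)%N = ~~ odd q by lia.
  have -> : (q == (2 * q./2).+1)%N = odd q by lia.
  by case: (odd q) => /=; ring.
case: (eqVneq q./2 q'./2) => h2; last first.
  have -> : (q' == 2 * q./2)%N = false by lia.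
  have -> : (q' == (2 * q./2).+1)%N = false by lia.
  by rewrite /= subrr mulr0; ring.
have -> : (q' == 2 * q./2)%N = odd q by lia.
have -> : (q' == (2 * q./2).+1)%N = ~~ odd q by lia.
by case: (odd q) => /=; ring.
Qed.

Lemma sqrt_mul_self (x : R) : 0 <= x -> Num.sqrt x * Num.sqrt x = x.
Proof. by move=> x0; rewrite -expr2 sqr_sqrtr. Qed.

(** The constant vector and the levels below [j] together have the kernel of averaging over the
    [2 ^ j] dyadic blocks; level [j] contributes the difference of consecutive kernels, and at level
    [r] the blocks are points. *)
Lemma haar_row_ortho (t t' : 'I_(2 ^ r)) :
  \sum_b haar R b t * haar R b t' = (t == t')%:R.
Proof.
rewrite (eq_bigr (fun b : 'I_(2 ^ r) => haarn b t * haarn b t')); last by move=> b _; rewrite !haarE.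
rewrite (sum_haar_index (fun b => haarn b t * haarn b t')).
have h0 u : haarn 0 u = Num.sqrt ((2 ^+ r)^-1) by [].
rewrite !h0 sqrt_mul_self ?invr_ge0 ?exprn_ge0 //.
pose s j := ((t : nat) %/ 2 ^ (r - j) == t' %/ 2 ^ (r - j))%N%:R : R.
have hj (j : 'I_r) : \sum_(p < 2 ^ j) haarn (2 ^ j + p) t * haarn (2 ^ j + p) t'
   = (2 ^+ r)^-1 * (2 ^+ j.+1 * s j.+1 - 2 ^+ j * s j).
  rewrite (eq_bigr (fun p : 'I_(2 ^ j) => (2 ^+ j / 2 ^+ r) *
      ((((t : nat) %/ 2 ^ (r - j.+1) == 2 * p)%N%:R - ((t : nat) %/ 2 ^ (r - j.+1) == (2 * p).+1)%N%:R)
       * (((t' : nat) %/ 2 ^ (r - j.+1) == 2 * p)%N%:R - ((t' : nat) %/ 2 ^ (r - j.+1) == (2 * p).+1)%N%:R)))); last first.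
    move=> p _; rewrite !haarn_add // mulrACA sqrt_mul_self //.
  rewrite -mulr_sumr haar_level; last first.
    rewrite ltn_divLR ?expn_gt0 // -expnD subnKC //; exact: ltn_ord.
  rewrite -!divn2 -!divnMA -!expnSr subnSK // -/(s j) -/(s j.+1) exprS; ring.
rewrite (eq_bigr _ (fun j _ => hj j)) -mulr_sumr -(big_mkord xpredT (fun j => 2 ^+ j.+1 * s j.+1 - 2 ^+ j * s j)).
rewrite (telescope_sumr (fun j => 2 ^+ j * s j)) // /s subnn expn0 !divn1 subn0 expr0 mul1r.
by rewrite !divn_small // eqxx mulrBr mulr1 addrC subrK mulrA mulVf ?mul1r.
Qed.

End HaarReal.

Lemma int_small_mult (X y y' : nat) (q : int) : (y < X)%N -> (y' < X)%N ->
  y'%:Z - y%:Z = q * X%:Z -> q = 0.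
Proof. by move=> yX y'X e; case: (ltrgtP q 0) => // q0; exfalso; nia. Qed.

(** * The matrix [F Phi] in closed form *)

Section Fourier.
Variables (R : realType) (r : nat).
Local Notation N := (2 ^ r)%N.
Local Notation fr w := ((freq (r := r) w)%:~R : R).

Lemma FmxE (w t : 'I_N) : Fmx R r w t = ((Num.sqrt N%:R)^-1)%:C%C * ez (fr w * (t : nat)%:R / N%:R).
Proof. by rewrite mxE /ez; congr (_ * expi _); rewrite !mulrA. Qed.

Lemma realCM (a b : R) : a%:C%C * b%:C%C = (a * b)%:C%C.
Proof. by rewrite rmorphM. Qed.

Lemma N_gt0 : 0 < N%:R :> R.
Proof. by rewrite ltr0n expn_gt0. Qed.

Lemma sqrtN_inv2 : (Num.sqrt (N%:R : R))^-1 * (Num.sqrt N%:R)^-1 = N%:R^-1.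
Proof. by rewrite -invfM sqrt_mul_self // ltW // N_gt0. Qed.

Lemma Fmx_ortho (t t' : 'I_N) : \sum_w (Fmx R r w t)^*%C * Fmx R r w t' = (t == t')%:R.
Proof.
pose a := ((t' : nat)%:Z - (t : nat)%:Z) : int.
pose c := (1 - (N./2)%:Z) : int.
have -> : \sum_w (Fmx R r w t)^*%C * Fmx R r w t'
   = (N%:R^-1)%:C%C * \sum_(s < N) ez (((s : nat)%:Z + c)%:~R * a%:~R / N%:R).
  rewrite mulr_sumr; apply: eq_bigr => w _; rewrite !FmxE cconjM cconjR mulrACA realCM sqrtN_inv2.
  rewrite -ezN -ezD; congr (_ * ez _).
  have -> : freq w = (w : nat)%:Z + c by rewrite /freq /c; lia.
  by rewrite /a rmorphB /= -!pmulrn; ring.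
case: (eqVneq t t') => [tt'|tt'].
  rewrite (eq_bigr (fun=> 1)) => [|s _]; last by rewrite /a tt' subrr mulr0 mul0r ez0.
  rewrite sumr_const card_ord -[X in _ * X](rmorph_nat (real_complex R)) realCM mulVf ?gt_eqF ?N_gt0 //.
rewrite ez_sum ?mulr0 ?expn_gt0 //.
apply/negP => /dvdzP[q]; rewrite /a => e.
have q0 := int_small_mult (ltn_ord t) (ltn_ord t') e.
by move: tt'; rewrite -val_eqE /=; move: e; rewrite q0 mul0r; lia.
Qed.

Definition Umx : 'M[R[i]]_N := Fmx R r *m Phi R r.

Lemma UmxE w b : Umx w b = \sum_t Fmx R r w t * ((haar R b t)%:C)%C.
Proof. by rewrite mxE; apply: eq_bigr => t _; rewrite !mxE. Qed.

Lemma adjmxM (p q s : nat) (A : 'M[R[i]]_(p, q)) (B : 'M[R[i]]_(q, s)) :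
  adjmx (A *m B) = adjmx B *m adjmx A.
Proof. by rewrite /adjmx trmx_mul map_mxM. Qed.

Lemma adj_Fmx : adjmx (Fmx R r) *m Fmx R r = 1%:M.
Proof.
apply/matrixP => t t'; rewrite !mxE -[in RHS]Fmx_ortho; apply: eq_bigr => w _.
by rewrite /adjmx [in LHS]mxE [in X in X * _]mxE.
Qed.

Lemma Phi_adj : Phi R r *m adjmx (Phi R r) = 1%:M.
Proof.
apply/matrixP => t t'; rewrite !mxE.
transitivity ((\sum_b haar R b t * haar R b t')%:C%C); last by rewrite haar_row_ortho rmorph_nat.
rewrite rmorph_sum; apply: eq_bigr => b _.
by rewrite /adjmx !mxE cconjR rmorphM.
Qed.

Lemma adj_Phi : adjmx (Phi R r) *m Phi R r = 1%:M.
Proof. exact: mulmx1C Phi_adj. Qed.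

Lemma Umx_ortho b b' : \sum_w (Umx w b)^*%C * Umx w b' = (b == b')%:R.
Proof.
have e : adjmx Umx *m Umx = 1%:M.
  by rewrite /Umx adjmxM -mulmxA (mulmxA (adjmx (Fmx R r))) adj_Fmx mul1mx adj_Phi.
move/matrixP: e => /(_ b b'); rewrite [in X in _ = X -> _]mxE => <-.
by rewrite mxE; apply: eq_bigr => w _; rewrite /adjmx [in RHS]mxE [in X in _ = X * _]mxE.
Qed.

Lemma sum_block (V : nmodType) (M K H q : nat) (f : nat -> V) : M = (K * H)%N -> (q < K)%N -> (0 < H)%N ->
  \sum_(t < M | (t %/ H == q)%N) f t = \sum_(s < H) f (q * H + s)%N.
Proof.
move=> -> qK H0.
have -> : \sum_(s < H) f (q * H + s)%N = \sum_(q * H <= t < q.+1 * H) f t.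
  rewrite mulSn -{2}[(q * H)%N]add0n big_addn addnK big_mkord.
  by apply: eq_bigr => s _; rewrite addnC.
rewrite (big_nat_widen _ _ (K * H)) ?leq_mul2r ?qK ?orbT //.
rewrite (big_nat_widenl _ 0) // big_mkord; apply: eq_bigl => t.
by rewrite divn_eqE // andbC.
Qed.

(** The Fourier transform of [phi_{j,0}] at row [w]: amplitude, difference of the two halves, and
    exponential sum over one half. *)
Definition cc (j : nat) (w : 'I_N) : R[i] :=
  (Num.sqrt (2 ^+ j) / N%:R)%:C%C * ((1 - ez (fr w * (2 ^ (r - j.+1))%:R / N%:R))
     * \sum_(s < 2 ^ (r - j.+1)) ez (fr w * (s : nat)%:R / N%:R)).

(** [phi_{j,p}] is a translate of [phi_{j,0}], and translation becomes a phase. *)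
Lemma Umx_high (w b : 'I_N) j p : (j < r)%N -> (p < 2 ^ j)%N -> (b : nat) = (2 ^ j + p)%N ->
  Umx w b = ez (fr w * p%:R / (2 ^ j)%:R) * cc j w.
Proof.
move=> jr pj bE; rewrite UmxE.
set H := (2 ^ (r - j.+1))%N; have H0 : (0 < H)%N by rewrite expn_gt0.
have NE : N = (2 ^ j.+1 * H)%N by rewrite /H -expnD subnKC.
pose g (t : nat) := ez (fr w * t%:R / N%:R).
set A : R := Num.sqrt (2 ^+ j) / N%:R.
have -> : \sum_t Fmx R r w t * ((haar R b t)%:C)%C
   = A%:C%C * (\sum_(t < N | ((t : nat) %/ H == 2 * p)%N) g t - \sum_(t < N | ((t : nat) %/ H == (2 * p).+1)%N) g t).
  rewrite [X in _ = _ * (X - _)]big_mkcond [X in _ = _ * (_ - X)]big_mkcond -sumrB mulr_sumr; apply: eq_bigr => t _.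
  rewrite FmxE haarE bE haarn_add // -/H -/(g t).
  have -> : Num.sqrt (2 ^+ j / 2 ^+ r) = Num.sqrt (2 ^+ j) * (Num.sqrt (N%:R : R))^-1.
    by rewrite sqrtrM ?exprn_ge0 // sqrtrV ?exprn_ge0 // natrX.
  have -> (u : R) : ((Num.sqrt N%:R)^-1)%:C%C * g t * (Num.sqrt (2 ^+ j) * (Num.sqrt N%:R)^-1 * u)%:C%C
     = A%:C%C * (g t * u%:C%C).
    have eA : (Num.sqrt N%:R)^-1 * (Num.sqrt (2 ^+ j) * (Num.sqrt N%:R)^-1 * u) = A * u.
      by rewrite /A -sqrtN_inv2; ring.
    by rewrite mulrAC realCM eA -realCM -mulrA; congr (_ * _); exact: mulrC.
  case: (_ == (2 * p)%N); case: (_ == (2 * p).+1); rewrite /= ?rmorph0 ?rmorph1 ?subr0 ?sub0r ?mulr0; ring.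
rewrite !(sum_block g NE) //; first last.
- by move: pj; rewrite expnS; lia.
- by move: pj; rewrite expnS; lia.
have gD a c : g (a + c)%N = g a * g c.
  by rewrite /g -ezD natrD; congr ez; ring.
under eq_bigr do rewrite gD.
under [X in _ - X]eq_bigr do rewrite gD.
rewrite -!mulr_sumr mulSn gD /cc -/H -/(g H) -/A.
have -> : g (2 * p * H)%N = ez (fr w * p%:R / (2 ^ j)%:R).
  rewrite /g; congr ez; rewrite [in X in _ / X]NE expnS !natrM; field.
  by rewrite !pnatr_eq0 -!lt0n H0 expn_gt0.
by ring.
Qed.

Lemma freq_half : (0 < r)%N -> (N./2 = 2 ^ r.-1)%N.
Proof. by case: r => // r' _; rewrite expnS mul2n doubleK. Qed.

Lemma freq_bound (w : 'I_N) : (0 < r)%N -> `|fr w| <= N%:R / 2.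
Proof.
move=> r0; have hN := freq_half r0.
have NE : N = (2 * 2 ^ r.-1)%N by rewrite -expnS prednK.
have wN : (w < 2 * 2 ^ r.-1)%N by rewrite -NE.
have -> : N%:R / 2 = ((2 ^ r.-1)%:Z)%:~R :> R by rewrite NE natrM -pmulrn; field.
rewrite -intr_norm ler_int /freq hN.
move: wN; move: (2 ^ r.-1)%N (nat_of_ord w) => X y; lia.
Qed.

Lemma Umx0 (w b : 'I_N) : (0 < r)%N -> (b : nat) = 0%N -> Umx w b = (freq w == 0)%:R.
Proof.
move=> r0 b0; rewrite UmxE.
have -> : \sum_t Fmx R r w t * ((haar R b t)%:C)%C
   = (N%:R^-1)%:C%C * \sum_(t < N) ez ((((t : nat)%:Z + 0)%:~R) * fr w / N%:R).
  rewrite mulr_sumr; apply: eq_bigr => t _.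
  rewrite FmxE haarE b0 /haarn /= mulrAC realCM.
  have -> : Num.sqrt (2 ^- r) = (Num.sqrt (N%:R : R))^-1 by rewrite sqrtrV ?exprn_ge0 // natrX.
  by rewrite sqrtN_inv2 addr0 -pmulrn [_ * fr w]mulrC.
case: eqVneq => [->|w0].
  rewrite (eq_bigr (fun=> 1)) => [|s _]; last by rewrite mulr0 mul0r ez0.
  rewrite sumr_const card_ord -[X in _ * X](rmorph_nat (real_complex R)) realCM mulVf ?gt_eqF ?N_gt0 //.
rewrite ez_sum ?mulr0 ?expn_gt0 //.
apply/negP => /dvdzP[q e].
have q0 : q != 0 by apply: contraNneq w0 => q0; rewrite e q0 mul0r.
have hN := freq_half r0.
have NE : N = (2 * 2 ^ r.-1)%N by rewrite -expnS prednK.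
have wN : (w < 2 * 2 ^ r.-1)%N by rewrite -NE.
have X0 : (0 < 2 ^ r.-1)%N by rewrite expn_gt0.
have {}e : (w : nat)%:Z - (2 ^ r.-1)%:Z + 1 = q * (2 * 2 ^ r.-1)%:Z by rewrite -NE -hN.
move: e wN X0 q0; move: (2 ^ r.-1)%N (nat_of_ord w) => X y; nia.
Qed.

End Fourier.

(** * Dyadic frequency bands and the intervals around them *)

Section Bands.
Variable (r : nat).
Hypothesis r_gt0 : (0 < r)%N.
Local Notation N := (2 ^ r)%N.

(* The frequencies -u and u + 1 both have ua = u, so that W_0 is ua = 0 and W_j
   is 2 ^ (j - 1) <= ua < 2 ^ j. *)
Definition ua (w : 'I_N) : nat := if (2 ^ r.-1 <= w)%N then (w - 2 ^ r.-1)%N else (2 ^ r.-1 - w.+1)%N.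
Definition rl (w : 'I_N) : nat := if ua w == 0%N then 0%N else (trunc_log 2 (ua w)).+1.

Lemma N_double : N = (2 * 2 ^ r.-1)%N.
Proof. by rewrite -expnS prednK. Qed.

Lemma freqE (w : 'I_N) : freq w = (w : nat)%:Z - (2 ^ r.-1)%:Z + 1.
Proof. by rewrite /freq freq_half. Qed.

Lemma ua_lt w : (ua w < 2 ^ r.-1)%N.
Proof.
have h0 : (0 < 2 ^ r.-1)%N by rewrite expn_gt0.
have : (w < 2 * 2 ^ r.-1)%N by rewrite -N_double.
by rewrite /ua; move: (2 ^ r.-1)%N (nat_of_ord w) h0 => X y; case: (leqP X y); lia.
Qed.

Lemma ua_freq w : freq w = (ua w)%:Z + 1 \/ freq w = - (ua w)%:Z.
Proof. by rewrite freqE /ua; case: leqP; lia. Qed.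

Lemma rl_lt w : (rl w < r)%N.
Proof.
rewrite /rl; case: eqP => // /eqP; rewrite -lt0n => u0.
rewrite -[X in (_ < X)%N](prednK r_gt0) ltnS -(ltn_exp2l _ _ (isT : 1 < 2)%N).
exact: leq_ltn_trans (trunc_logP _ u0) (ua_lt w).
Qed.

Lemma rl_eqS w j : (rl w == j.+1) = (2 ^ j <= ua w < 2 ^ j.+1)%N.
Proof.
rewrite /rl; case: (posnP (ua w)) => [->|u0].
  by rewrite leqn0 expn_eq0.
rewrite eqSS; apply/eqP/idP => [<-|]; last exact: trunc_log_eq.
by rewrite trunc_logP // trunc_log_ltn.
Qed.

Lemma rl_eq0 w : (rl w == 0%N) = (ua w == 0%N).
Proof. by rewrite /rl; case: (ua w == 0%N). Qed.

Lemma W_rl j w : (w \in W r j) = (rl w == j).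
Proof.
rewrite inE; case: j => [|j] /=.
  by rewrite rl_eq0; have := ua_freq w; move: (freq w) (ua w) => f u; lia.
rewrite rl_eqS expnS; have := ua_freq w.
have : (0 < 2 ^ j)%N by rewrite expn_gt0.
by move: (freq w) (ua w) (2 ^ j)%N => f u X; lia.
Qed.

Lemma freq_le w : `|freq w| <= (2 ^ rl w)%:Z.
Proof.
have := ua_freq w; case E: (rl w) => [|j].
  by move/eqP: E; rewrite rl_eq0 => /eqP ->; lia.
by move/eqP: E; rewrite rl_eqS expnS; move: (freq w) (ua w) (2 ^ j)%N => f u X; lia.
Qed.

Lemma freq_ge w j : rl w = j.+1 -> (2 ^ j)%:Z <= `|freq w|.
Proof.
move/eqP; rewrite rl_eqS expnS; have := ua_freq w.
by move: (freq w) (ua w) (2 ^ j)%N => f u X; lia.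
Qed.

Lemma freq_window w : 0 <= freq w + (2 ^ rl w)%:Z - 1 < (2 ^ (rl w).+1)%:Z.
Proof.
have := ua_freq w; case E: (rl w) => [|j].
  by move/eqP: E; rewrite rl_eq0 => /eqP ->; lia.
move/eqP: E; rewrite rl_eqS !expnS; move: (freq w) (ua w) (2 ^ j)%N => f u X; lia.
Qed.

Lemma freq_inj : injective (@freq r).
Proof. by move=> w w'; rewrite !freqE => e; apply: val_inj; rewrite /=; lia. Qed.

(** The offset of the frequency from [1 - 2 ^ i], the start of an interval of [2 ^ i.+1] frequencies
    that contains band [i]. *)
Definition window (i : nat) (w : 'I_N) : nat := `|(freq w + (2 ^ i)%:Z - 1)%R|%N.

Lemma window_lt i w : rl w = i -> (window i w < 2 ^ i.+1)%N.
Proof. by move=> <-; have := freq_window w; rewrite /window; lia. Qed.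

Lemma windowE i w : rl w = i -> freq w = (window i w)%:Z + (1 - (2 ^ i)%:Z).
Proof. by move=> <-; have := freq_window w; rewrite /window; lia. Qed.

(** Enlarging a band to an interval only adds nonnegative terms, and Parseval is available on
    intervals made of whole periods. *)
Lemma sum_window (R : realType) (i M : nat) (F : int -> R) : (2 ^ i.+1 <= M)%N ->
  (forall z, 0 <= F z) ->
  \sum_(w | rl w == i) F (freq w) <= \sum_(s < M) F ((s : nat)%:Z + (1 - (2 ^ i)%:Z)).
Proof.
move=> iM F0; have M0 : (0 < M)%N by apply: leq_trans iM; rewrite expn_gt0.
case: M M0 iM => // M _ iM.
have hwin w : rl w == i -> (inord (window i w) : 'I_M.+1) = window i w :> nat.
  by move=> /eqP wi; rewrite inordK // (leq_trans (window_lt wi)).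
rewrite (eq_bigr (fun w => F (((inord (window i w) : 'I_M.+1) : nat)%:Z + (1 - (2 ^ i)%:Z)))); last first.
  by move=> w wi; rewrite hwin // -windowE //; exact/eqP.
apply: (@sum_inj_le _ _ _ [pred w | rl w == i] (fun w => inord (window i w)) (fun s : 'I_M.+1 => F ((s : nat)%:Z + (1 - (2 ^ i)%:Z)))) => [w w'|s]; last exact: F0.
rewrite !inE => wi wi' e; apply: freq_inj.
by rewrite (windowE (eqP wi)) (windowE (eqP wi')) -(hwin w) // -(hwin w') // e.
Qed.

End Bands.

(** * Coherence of [F Phi] between bands and levels *)

Section Coherence.
Variables (R : realType) (r : nat).
Hypothesis r_gt0 : (0 < r)%N.
Local Notation N := (2 ^ r)%N.
Local Notation fr w := ((freq (r := r) w)%:~R : R).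
Implicit Types w : 'I_N.

Lemma fr_le w : `|fr w| <= 2 ^+ rl w.
Proof.
rewrite -intr_norm; have -> : 2 ^+ rl w = ((2 ^ rl w)%:Z)%:~R :> R by rewrite -pmulrn natrX.
by rewrite ler_int freq_le.
Qed.

Lemma fr_ge w j : rl w = j.+1 -> 2 ^+ j <= `|fr w|.
Proof.
move=> e; rewrite -intr_norm; have -> : 2 ^+ j = ((2 ^ j)%:Z)%:~R :> R by rewrite -pmulrn natrX.
by rewrite ler_int; apply: freq_ge.
Qed.

Let aa j w : R := cmod (1 - ez (fr w * (2 ^ (r - j.+1))%:R / N%:R)).
Let SS j w : R := cmod (\sum_(s < 2 ^ (r - j.+1)) ez (fr w * (s : nat)%:R / N%:R)).

Lemma cc_cmod j w : cmod (cc R j w) = Num.sqrt (2 ^+ j) / N%:R * (aa j w * SS j w).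
Proof.
by rewrite /cc !cmodM cmodR ger0_norm.
Qed.

Lemma aa_le2 j w : aa j w <= 2.
Proof. by rewrite /aa cmod_1Bez ler_piMr // ler_norml sin_geN1 sin_le1. Qed.

Lemma aa_le j w : aa j w <= 8 * 2 ^+ rl w * (2 ^ (r - j.+1))%:R / N%:R.
Proof.
rewrite /aa cmod_1Bez; set H := (2 ^ _)%:R.
have H0 : 0 <= H / N%:R :> R by rewrite divr_ge0.
apply: (@le_trans _ _ (2 * `|pi * (fr w * H / N%:R)|)).
  by rewrite ler_wpM2l // normr_sin_le.
rewrite -(mulrA (fr w)) [`|pi * _|]normrM [`|fr w * _|]normrM (ger0_norm (pi_ge0 R)) (ger0_norm H0).
have p4 : pi <= 4 :> R by have := pihalf_lt2 R; lra.
have p0 := pi_ge0 R.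
have fl := fr_le w.
have -> : 2 * (pi * (`|fr w| * (H / N%:R))) = 2 * (pi * `|fr w|) * (H / N%:R) by ring.
have -> : 8 * 2 ^+ rl w * H / N%:R = 2 * (4 * 2 ^+ rl w) * (H / N%:R) by ring.
by rewrite ler_wpM2r // ler_wpM2l // ler_pM.
Qed.

Lemma SS_le j w : SS j w <= (2 ^ (r - j.+1))%:R.
Proof.
apply: le_trans (cmod_sum _ _ _) _.
by rewrite (eq_bigr (fun=> 1)) ?sumr_const ?card_ord // => s _; exact: cmod_ez.
Qed.

(** For the geometric sum with ratio [z], multiplication by [1 - z] gives modulus at most 2, and
    [sin_pi_lower] bounds [1 - z] below by [2 * |freq| / N], as the frequency is at most [N / 2] in
    modulus. *)
Lemma SS_fr j w : SS j w * `|fr w| <= N%:R.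
Proof.
have N0 := N_gt0 R r.
pose z := ez (fr w / N%:R).
have e1 : aa j w = cmod (1 - z) * SS j w.
  rewrite /aa /SS -cmodM; congr cmod; rewrite (eq_bigr (fun s : 'I_(2 ^ (r - j.+1)) => z ^+ s)); last first.
    by move=> s _; rewrite /z ezX; congr ez; ring.
  have -> : ez (fr w * (2 ^ (r - j.+1))%:R / N%:R) = z ^+ (2 ^ (r - j.+1)).
    by rewrite /z ezX; congr ez; ring.
  by rewrite -opprB subrX1 -mulNr opprB.
have e2 : 2 * `|fr w / N%:R| <= cmod (1 - z).
  rewrite /z cmod_1Bez ler_wpM2l // sin_pi_lower //.
  rewrite normrM normfV (ger0_norm (ltW N0)) ler_pdivrMr //.
  by apply: le_trans (freq_bound R w r_gt0) _; rewrite mulrC mul1r.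
have e3 : 2 * `|fr w / N%:R| * SS j w <= 2.
  apply: le_trans (aa_le2 j w); rewrite e1 ler_wpM2r //; exact: cmod_ge0.
move: e3; rewrite normrM normfV (ger0_norm (ltW N0)).
have -> : 2 * (`|fr w| / N%:R) * SS j w = 2 * (SS j w * `|fr w|) / N%:R by ring.
by rewrite ler_pdivrMr // ler_pM2l.
Qed.

Lemma aa_ge0 j w : 0 <= aa j w. Proof. exact: cmod_ge0. Qed.
Lemma SS_ge0 j w : 0 <= SS j w. Proof. exact: cmod_ge0. Qed.

Lemma cc_sqr j w : cmod (cc R j w) ^+ 2 = 2 ^+ j / N%:R ^+ 2 * (aa j w * SS j w) ^+ 2.
Proof. by rewrite cc_cmod exprMn expr_div_n sqr_sqrtr ?exprn_ge0. Qed.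

(** Coarse wavelets: [aa <= 2] and [SS_fr], with a frequency of size at least half of [2 ^ rl w]
    outside band 0. *)
Lemma cc_low j w : (j <= rl w)%N ->
  2 ^+ rl w * cmod (cc R j w) ^+ 2 <= 64 * dk R (rl w) j ^+ 2.
Proof.
move=> jw; have N0 := N_gt0 R r.
rewrite dk_sqr (maxn_idPl jw) (minn_idPr jw) cc_sqr.
have e2 : 2 ^+ rl w = 2 ^+ j * 2 ^+ (rl w - j) :> R by rewrite -exprD subnKC.
have p0 : 0 < 2 ^+ j :> R by rewrite exprn_gt0.
have p1 : 0 < 2 ^+ (rl w - j) :> R by rewrite exprn_gt0.
have key : aa j w * SS j w * 2 ^+ rl w <= 4 * N%:R.
  case E: (rl w) => [|i].
    rewrite expr0 mulr1; apply: (@le_trans _ _ (2 * N%:R)).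
      apply: ler_pM; rewrite ?aa_ge0 ?SS_ge0 ?aa_le2 //; apply: le_trans (SS_le _ _) _.
      by rewrite ler_nat leq_exp2l // leq_subr.
    by move: N0; move: (N%:R) => x; lra.
  have := fr_ge E; have := SS_fr j w; have := aa_le2 j w; have := aa_ge0 j w; have := SS_ge0 j w.
  rewrite exprS; have : 0 <= 2 ^+ i :> R by rewrite exprn_ge0.
  move: (aa j w) (SS j w) `|fr w| (2 ^+ i) (N%:R) => a s f x n x0 s0 a0 a2 sf xf.
  have h1 : s * x <= n by apply: le_trans sf; rewrite ler_wpM2l.
  have h2 : a * (s * x) <= 2 * n by apply: ler_pM; rewrite // mulr_ge0.
  lra.
have k0 : 0 <= aa j w * SS j w * 2 ^+ rl w.
  by rewrite !mulr_ge0 ?aa_ge0 ?SS_ge0 ?exprn_ge0.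
have key2 : (aa j w * SS j w * 2 ^+ rl w) ^+ 2 <= (4 * N%:R) ^+ 2.
  by rewrite ler_pXn2r ?nnegrE // mulr_ge0 // ltW.
rewrite -(@ler_pM2r _ (N%:R ^+ 2 * 2 ^+ (rl w - j))); last by rewrite mulr_gt0 // exprn_gt0.
have -> : 2 ^+ rl w * (2 ^+ j / N%:R ^+ 2 * (aa j w * SS j w) ^+ 2) * (N%:R ^+ 2 * 2 ^+ (rl w - j))
   = (aa j w * SS j w * 2 ^+ rl w) ^+ 2.
  by rewrite [in RHS]expr2 {2}e2 {1}e2 [in RHS]e2; field; rewrite gt_eqF.
have -> : 64 / 2 ^+ (rl w - j) * (N%:R ^+ 2 * 2 ^+ (rl w - j)) = 64 * N%:R ^+ 2 :> R.
  by field; rewrite gt_eqF.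
apply: le_trans key2 _; rewrite exprMn ler_wpM2r ?sqr_ge0 //; lra.
Qed.

(** Fine wavelets: the halves nearly cancel by [aa_le], while [SS] is at most its length. The rate
    is the square of the one for coherence; [Umx_op_high] spends the surplus on enlarging its
    window. *)
Lemma cc_high j w : (rl w < j)%N -> (j < r)%N ->
  2 ^+ rl w * cmod (cc R j w) ^+ 2 <= 64 * (dk R (rl w) j ^+ 2) ^+ 2.
Proof.
move=> wj jr; have N0 := N_gt0 R r.
rewrite dk_sqr (maxn_idPr (ltnW wj)) (minn_idPl (ltnW wj)) cc_sqr.
set H : R := (2 ^ (r - j.+1))%:R.
have H0 : 0 < H by rewrite ltr0n expn_gt0.
have NE : N%:R = 2 * 2 ^+ j * H :> R.
  by rewrite /H -natrX -!natrM -expnS -expnD subnKC.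
have e2 : 2 ^+ j = 2 ^+ rl w * 2 ^+ (j - rl w) :> R by rewrite -exprD subnKC // ltnW.
have h1 := aa_le j w; have h2 := SS_le j w; rewrite -/H in h1 h2.
have a0 := aa_ge0 j w; have s0 := SS_ge0 j w.
have p0 : 0 < 2 ^+ rl w :> R by rewrite exprn_gt0.
have p1 : 1 <= 2 ^+ (j - rl w) :> R by rewrite exprn_ege1 // ler1n.
move: h1 h2 a0 s0; move: (aa j w) (SS j w) => a s h1 h2 a0 s0.
have key : a * s <= 8 * 2 ^+ rl w * H / N%:R * H by apply: ler_pM.
have key2 : (a * s) ^+ 2 <= (8 * 2 ^+ rl w * H / N%:R * H) ^+ 2.
  by rewrite ler_pXn2r ?nnegrE ?(le_trans _ key) ?mulr_ge0.
apply: (@le_trans _ _ (2 ^+ rl w * (2 ^+ j / N%:R ^+ 2 * (8 * 2 ^+ rl w * H / N%:R * H) ^+ 2))).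
  by rewrite ler_wpM2l ?(ltW p0) // ler_wpM2l.
rewrite NE e2; move: p0 p1; set x := 2 ^+ rl w; set y := 2 ^+ (j - rl w) => p0 p1.
have y0 : 0 < y by lra.
have -> : x * (x * y / (2 * (x * y) * H) ^+ 2 * (8 * x * H / (2 * (x * y) * H) * H) ^+ 2) = 4 / y ^+ 3.
  by field; rewrite !gt_eqF.
rewrite exprVn ler_pdivrMr ?exprn_gt0 //.
have -> : 64 / y ^+ 2 * y ^+ 3 = 64 * y by field; rewrite gt_eqF.
lra.
Qed.

Lemma dk_sqr_sqr_le (i j : nat) : (dk R i j ^+ 2) ^+ 2 <= dk R i j ^+ 2.
Proof. by rewrite expr2 ler_piMr ?sqr_ge0 // -(expr1n _ 2) ler_pXn2r ?nnegrE ?dk_ge0 ?dk_le1. Qed.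

Lemma cc_coh j w : (j < r)%N -> 2 ^+ rl w * cmod (cc R j w) ^+ 2 <= 64 * dk R (rl w) j ^+ 2.
Proof.
move=> jr; case: (leqP j (rl w)) => h; first exact: cc_low.
by apply: le_trans (cc_high h jr) _; rewrite ler_wpM2l // dk_sqr_sqr_le.
Qed.

Lemma levelE (b : 'I_N) : level b = trunc_log 2 b.
Proof.
rewrite /level; case: ifP => // b2.
by case: (nat_of_ord b) b2 => [|[|//]] _; rewrite ?trunc_log0 ?trunc_log1.
Qed.

Lemma level_lt (b : 'I_N) : (level b < r)%N.
Proof.
rewrite levelE; case: (posnP b) => [->|b0]; first by rewrite trunc_log0.
exact: trunc_log_lt.
Qed.

Lemma index_level (b : 'I_N) : (0 < b)%N ->
  exists2 p, (p < 2 ^ level b)%N & (b : nat) = (2 ^ level b + p)%N.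
Proof.
move=> b0; exists (b - 2 ^ level b)%N; rewrite levelE.
  rewrite -(ltn_add2l (2 ^ trunc_log 2 b)) subnKC ?trunc_logP // addnn -mul2n -expnS.
  exact: trunc_log_ltn.
by rewrite subnKC // trunc_logP.
Qed.

Lemma Umx_coh w b : 2 ^+ rl w * cmod (Umx R r w b) ^+ 2 <= 64 * dk R (rl w) (level b) ^+ 2.
Proof.
case: (posnP b) => [b0|b0].
  rewrite (Umx0 R w r_gt0 b0); case: eqP => [f0|_]; last first.
    by rewrite cmod0 expr0n mulr0 mulr_ge0 ?sqr_ge0.
  have -> : rl w = 0%N.
    by apply/eqP; rewrite rl_eq0; have := ua_freq r_gt0 w; rewrite f0; lia.
  by rewrite levelE b0 trunc_log0 dk_diag cmod1 !expr1n expr0 mulr1 mulr1; lra.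
have [p pl bE] := index_level b0.
rewrite (Umx_high R w (level_lt b) pl bE) cmodM cmod_ez mul1r.
exact: cc_coh (level_lt b).
Qed.

End Coherence.

(** * Norms of the blocks of [F Phi] *)

Section OperatorNorm.
Variables (R : realType) (r : nat).
Hypothesis r_gt0 : (0 < r)%N.
Local Notation N := (2 ^ r)%N.
Local Notation fr w := ((freq (r := r) w)%:~R : R).

(** Plancherel modulo [K], over [M / K] consecutive periods. *)
Lemma window_parseval (K M : nat) (c : int) (a : 'I_K -> R[i]) :
  (0 < K)%N -> (0 < M)%N -> (K %| M)%N ->
  \sum_(s < M) cmod (\sum_(p < K) ez (((s : nat)%:Z + c)%:~R * (p : nat)%:R / K%:R) * a p) ^+ 2
    = M%:R * \sum_p cmod (a p) ^+ 2.
Proof.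
move=> K0 M0 KM; apply: (@complexI R); rewrite sum_realC -realCM sum_realC mulr_sumr.
pose x (s : 'I_M) (p : 'I_K) : R := ((s : nat)%:Z + c)%:~R * (p : nat)%:R / K%:R.
transitivity (\sum_(s < M) \sum_(p < K) \sum_(p' < K) ez (x s p - x s p') * (a p * (a p')^*%C)).
  apply: eq_bigr => s _; rewrite cmod_sqr sum_conj big_distrl /=; apply: eq_bigr => p _.
  rewrite big_distrr /=; apply: eq_bigr => p' _.
  by rewrite cconjM -ezN ezD; ring.
rewrite exchange_big /=; apply: eq_bigr => p _; rewrite exchange_big /= (bigD1 p) //=.
rewrite [X in _ + X]big1 ?addr0 => [|p' p'p].
  rewrite (eq_bigr (fun=> a p * (a p)^*%C)) => [|s _]; last by rewrite subrr ez0 mul1r.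
  by rewrite sumr_const card_ord -cmod_sqr -[LHS]mulr_natl (rmorph_nat (real_complex R)).
rewrite -mulr_suml.
have e (s : 'I_M) : x s p - x s p' = ((s : nat)%:Z + c)%:~R * ((p : nat)%:Z - (p' : nat)%:Z)%:~R / K%:R.
  by rewrite /x rmorphB /= -!pmulrn; ring.
under eq_bigr do rewrite e.
rewrite ez_sum ?mul0r //; apply/negP => /dvdzP[z ze].
have z0 := int_small_mult (ltn_ord p') (ltn_ord p) ze.
by move: p'p; rewrite -val_eqE /=; move: ze; rewrite z0 mul0r; lia.
Qed.

Lemma card_band i : (#|[set w : 'I_N | rl w == i]| <= 2 ^ i.+1)%N.
Proof.
rewrite -(ler_nat R) -sumr_const.
rewrite (eq_bigl (fun w => rl w == i)); last by move=> w; rewrite inE.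
apply: le_trans (@sum_window r r_gt0 R i (2 ^ i.+1) (fun=> 1) (leqnn _) (fun=> ler01)) _.
by rewrite sumr_const card_ord.
Qed.

Lemma low_index_lt (j p : nat) : (j < r)%N -> (p < 2 ^ j)%N -> (2 ^ j + p < N)%N.
Proof.
move=> jr pj; apply: (@leq_trans (2 ^ j.+1)); last by rewrite leq_exp2l.
by rewrite expnS mul2n -addnn ltn_add2l.
Qed.

(** On one level the entries are phases times [cc], so the norm is at most the maximum of [cc] times
    a Plancherel sum. The window has length [2 ^ i.+1] when [l <= i], and one full period [2 ^ l]
    otherwise. *)
Lemma Umx_op_high (i l : nat) (q : 'I_N -> R[i]) : (i < r)%N -> (0 < l)%N -> (l < r)%N ->
  (forall b, level b != l -> q b = 0) ->
  \sum_(w | rl w == i) cmod (\sum_b Umx R r w b * q b) ^+ 2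
    <= 256 * dk R i l ^+ 2 * \sum_b cmod (q b) ^+ 2.
Proof.
move=> ir l0 lr ql.
pose h (p : 'I_(2 ^ l)) : 'I_N := Ordinal (low_index_lt lr (ltn_ord p)).
have hinj : injective h by move=> p p' /(congr1 val) /= /addnI e; apply: val_inj.
pose a p := q (h p).
have a_le : \sum_p cmod (a p) ^+ 2 <= \sum_b cmod (q b) ^+ 2.
  apply: (@sum_inj_le _ _ _ predT h (fun b => cmod (q b) ^+ 2)) => [p p' _ _|b]; first exact: hinj.
  exact: sqr_ge0.
have Uq w : \sum_b Umx R r w b * q b
    = cc R l w * \sum_(p < 2 ^ l) ez (fr w * (p : nat)%:R / (2 ^ l)%:R) * a p.
  have -> : \sum_b Umx R r w b * q b = \sum_(b in h @: [set: 'I_(2 ^ l)]) Umx R r w b * q b.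
    rewrite [RHS]big_mkcond; apply: eq_bigr => b _; case: ifPn => // bh.
    rewrite ql ?mulr0 //; apply: contra bh => /eqP bl.
    have b0 : (0 < b)%N.
      by rewrite lt0n; apply: contraTneq l0 => b0; rewrite -bl levelE b0 trunc_log0.
    have [p pl bE] := index_level b0; rewrite bl in pl bE.
    by apply/imsetP; exists (Ordinal pl); rewrite ?inE //; apply: val_inj.
  rewrite big_imset /=; last by move=> p p' _ _; exact: hinj.
  rewrite mulr_sumr (eq_bigl xpredT); last by move=> p; rewrite inE.
  apply: eq_bigr => p _.
  by rewrite (@Umx_high R r w (h p) l p lr (ltn_ord p)) // /a; ring.
pose Q := \sum_p cmod (a p) ^+ 2.
have Q0 : 0 <= Q by apply: sumr_ge0 => p _; exact: sqr_ge0.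
pose F (z : int) : R := cmod (\sum_(p < 2 ^ l) ez (z%:~R * (p : nat)%:R / (2 ^ l)%:R) * a p) ^+ 2.
have bound (M : nat) (B : R) : 0 <= B -> (2 ^ i.+1 <= M)%N -> (2 ^ l %| M)%N ->
    (forall w : 'I_N, rl w = i -> cmod (cc R l w) ^+ 2 <= B) ->
    \sum_(w | rl w == i) cmod (\sum_b Umx R r w b * q b) ^+ 2 <= B * M%:R * Q.
  move=> B0 iM lM hB.
  have M0 : (0 < M)%N by apply: leq_trans iM; rewrite expn_gt0.
  rewrite -mulrA -(window_parseval (1 - (2 ^ i)%:Z) a _ M0 lM) ?expn_gt0 //.
  apply: (@le_trans _ _ (B * \sum_(w | rl w == i) F (freq w))).
    rewrite mulr_sumr; apply: ler_sum => w /eqP wi.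
    have -> : cmod (\sum_b Umx R r w b * q b) ^+ 2 = cmod (cc R l w) ^+ 2 * F (freq w).
      by rewrite Uq cmodM [LHS]exprMn /F.
    have F0 : 0 <= F (freq w) by exact: sqr_ge0.
    move: (hB w wi) F0; move: (cmod _ ^+ 2) (F (freq w)) => y z yB z0.
    exact: ler_wpM2r.
  apply: ler_wpM2l => //; apply: (sum_window r_gt0 iM (F := F)) => z; exact: sqr_ge0.
have i0 : 0 < 2 ^+ i :> R by rewrite exprn_gt0.
have d0 : 0 <= dk R i l ^+ 2 by exact: sqr_ge0.
suff : \sum_(w | rl w == i) cmod (\sum_b Umx R r w b * q b) ^+ 2 <= 256 * dk R i l ^+ 2 * Q.
  by move/le_trans; apply; rewrite ler_wpM2l // mulr_ge0.
case: (leqP l i) => li.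
  apply: le_trans (@bound (2 ^ i.+1)%N (64 * dk R i l ^+ 2 / 2 ^+ i) _ (leqnn _) _ _) _.
  - by apply: divr_ge0; [apply: mulr_ge0 | exact: ltW].
  - by rewrite dvdn_exp2l // leqW.
  - by move=> w wi; rewrite ler_pdivlMr // mulrC -wi cc_coh.
  rewrite ler_wpM2r // natrX [2 ^+ i.+1]exprS.
  have -> : 64 * dk R i l ^+ 2 / 2 ^+ i * (2 * 2 ^+ i) = 128 * dk R i l ^+ 2 by field; rewrite gt_eqF.
  by rewrite ler_wpM2r // ler_nat.
apply: le_trans (@bound (2 ^ l)%N (64 * (dk R i l ^+ 2) ^+ 2 / 2 ^+ i) _ _ (dvdnn _) _) _.
- by apply: divr_ge0; [apply: mulr_ge0 => //; exact: sqr_ge0 | exact: ltW].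
- by rewrite leq_exp2l.
- by move=> w wi; rewrite ler_pdivlMr // mulrC -wi cc_high // wi.
rewrite ler_wpM2r // natrX dk_sqr (maxn_idPr (ltnW li)) (minn_idPl (ltnW li)).
have -> : 2 ^+ l = 2 ^+ i * 2 ^+ (l - i) :> R by rewrite -exprD subnKC // ltnW.
have p0 : 0 < 2 ^+ (l - i) :> R by rewrite exprn_gt0.
have -> : 64 * (2 ^+ (l - i))^-1 ^+ 2 / 2 ^+ i * (2 ^+ i * 2 ^+ (l - i)) = 64 / 2 ^+ (l - i) :> R.
  by field; rewrite !gt_eqF.
by rewrite ler_wpM2r ?invr_ge0 ?(ltW p0) // ler_nat.
Qed.

(** Level 0 mixes the constant with a wavelet, so the phase formula does not cover it; with two
    columns, coherence and Cauchy-Schwarz suffice. The value 256 is [2 * 64 / 2 ^ i] times the band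
    size bound [2 ^ i.+1]. *)
Lemma Umx_op_0 (i : nat) (q : 'I_N -> R[i]) : (i < r)%N ->
  (forall b, level b != 0%N -> q b = 0) ->
  \sum_(w | rl w == i) cmod (\sum_b Umx R r w b * q b) ^+ 2
    <= 256 * dk R i 0 ^+ 2 * \sum_b cmod (q b) ^+ 2.
Proof.
move=> ir q0; set Q := \sum_b _.
have Q0 : 0 <= Q by apply: sumr_ge0 => b _; exact: sqr_ge0.
pose A := [set b : 'I_N | level b == 0%N].
have cA : (#|A| <= 2)%N.
  have hA b : b \in A -> (b < 2)%N.
    rewrite inE levelE => /eqP h; have := trunc_log_ltn b (isT : (1 < 2)%N).
    by rewrite h.
  rewrite -[X in (_ <= X)%N]card_ord -(card_in_imset (f := fun b : 'I_N => (inord b : 'I_2))); last first.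
    move=> b b' bA b'A /(congr1 val); rewrite /= !inordK ?hA // => e; exact: val_inj.
  exact: max_card.
have i0 : 0 < 2 ^+ i :> R by rewrite exprn_gt0.
set B := 64 * dk R i 0 ^+ 2 / 2 ^+ i.
have B0 : 0 <= B by apply: divr_ge0; [apply: mulr_ge0 => //; exact: sqr_ge0 | exact: ltW].
have hw w : rl w == i -> cmod (\sum_b Umx R r w b * q b) ^+ 2 <= 2 * B * Q.
  move=> /eqP wi.
  have -> : \sum_b Umx R r w b * q b = \sum_(b in A) Umx R r w b * q b.
    rewrite [RHS]big_mkcond; apply: eq_bigr => b _; rewrite inE; case: ifPn => // /q0 ->.
    by rewrite mulr0.
  apply: (@le_trans _ _ ((l2 A (fun b => Umx R r w b) * l2 A q) ^+ 2)).
    by rewrite ler_pXn2r ?nnegrE ?cmod_ge0 ?mulr_ge0 ?l2_ge0 ?cmod_ip_le.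
  rewrite exprMn !l2_sqr; apply: ler_pM.
  - by apply: sumr_ge0 => b _; exact: sqr_ge0.
  - by apply: sumr_ge0 => b _; exact: sqr_ge0.
  - apply: (@le_trans _ _ (\sum_(b in A) B)).
      apply: ler_sum => b; rewrite inE => /eqP bl.
      by rewrite /B ler_pdivlMr // mulrC; have := Umx_coh R r_gt0 w b; rewrite bl wi.
    by rewrite sumr_const -[leLHS]mulr_natl ler_wpM2r // ler_nat.
  rewrite big_mkcond; apply: ler_sum => b _; case: ifP => // _; exact: sqr_ge0.
apply: le_trans (ler_sum _ hw) _.
rewrite (eq_bigl (mem [set w : 'I_N | rl w == i])); last by move=> w; rewrite !inE.
rewrite sumr_const -[leLHS]mulr_natl mulrA ler_wpM2r //.
apply: (@le_trans _ _ ((2 ^ i.+1)%:R * (2 * B))).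
  apply: ler_wpM2r; first exact: mulr_ge0.
  by rewrite ler_nat card_band.
rewrite natrX [2 ^+ i.+1]exprS /B le_eqVlt; apply/orP; left; apply/eqP; field.
by rewrite gt_eqF.
Qed.

Lemma Umx_op (i l : nat) (q : 'I_N -> R[i]) : (i < r)%N -> (l < r)%N ->
  (forall b, level b != l -> q b = 0) ->
  \sum_(w | rl w == i) cmod (\sum_b Umx R r w b * q b) ^+ 2
    <= 256 * dk R i l ^+ 2 * \sum_b cmod (q b) ^+ 2.
Proof.
by case: l => [|l] ir lr ql; [exact: Umx_op_0 | exact: Umx_op_high].
Qed.

End OperatorNorm.

(** * Passage from staged selection to uniform sampling *)

Lemma perm_of_fibers (n : nat) (K : eqType) (c c' : 'I_n -> K) :
  (forall x, #|[set i | c i == x]| = #|[set i | c' i == x]|) ->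
  exists p : {perm 'I_n}, forall i, c' (p i) = c i.
Proof.
move=> hcard; have pe : perm_eq [tuple c i | i < n] [tuple c' i | i < n].
  apply/allP => x _ /=; rewrite !count_map -!size_filter.
  have h (d : 'I_n -> K) : size [seq i <- Finite.enum 'I_n | preim id (preim [eta d] (pred1 x)) i]
      = #|[set i | d i == x]|.
    by rewrite cardE /enum_mem; congr size; apply: eq_filter => i; rewrite /= inE.
  by rewrite !h hcard.
have [p hp] := tuple_permP pe; exists p => i.
have : tnth [tuple c i | i < n] i = tnth [tuple tnth [tuple c' i | i < n] (p i) | i < n] i.
  by congr tnth; apply: val_inj.
by rewrite !tnth_mktuple.
Qed.

Lemma subset_between (T : finType) (A B : {set T}) (m : nat) : A \subset B ->
  (#|A| <= m)%N -> (m <= #|B|)%N -> exists C : {set T}, [/\ A \subset C, C \subset B & #|C| = m].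
Proof.
move=> AB; elim: m => [|m IHm] Am mB.
  by exists A; split => //; apply/eqP; rewrite -leqn0.
case: (leqP #|A| m) => [Am'|mA]; last by exists A; split => //; apply/eqP; rewrite eqn_leq Am.
have [C [AC CB Cm]] := IHm Am' (ltnW mB).
have /card_gt0P[x] : (0 < #|B :\: C|)%N by rewrite cardsD (finset.setIidPr CB) Cm subn_gt0.
rewrite inE => /andP[xC xB]; exists (x |: C); split.
- by rewrite (fintype.subset_trans AC) ?finset.subsetUr.
- by rewrite finset.subUset finset.sub1set xB.
- by rewrite cardsU1 xC Cm.
Qed.

Section Transfer.
Variables (R : realType) (S : finType) (N r : nat) (rlev : 'I_N -> 'I_r) (m : 'I_r -> nat).
Variable pr : S * 'I_N -> R.
Hypothesis pr_gt0 : forall t, 0 < pr t.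
Hypothesis pr_le1 : forall t, pr t <= 1.
Hypothesis pr_lev : forall s w w', rlev w = rlev w' -> pr (s, w) = pr (s, w').
Hypothesis m_card : forall j, (m j <= #|[set w | rlev w == j]|)%N.

Local Notation sp := {ffun S * 'I_N -> bool}.
Local Notation samp := {ffun 'I_r -> {set 'I_N}}.

Definition adm (Om : samp) : bool :=
  [forall j, (Om j \subset [set w | rlev w == j]) && (#|Om j| == m j)].
Definition picked (f : sp) (j : 'I_r) : {set 'I_N} :=
  [set w | (rlev w == j) && [exists s, f (s, w)]].
Definition small (f : sp) : bool := [forall j, (#|picked f j| <= m j)%N].
Definition compat (f : sp) (Om : samp) : bool := [forall j, picked f j \subset Om j].

Definition nsup (f : sp) : nat := #|[set Om | adm Om && compat f Om]|.

Lemma nsup_gt0 f : small f -> (0 < nsup f)%N.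
Proof.
move=> /forallP fs.
have h j : exists C : {set 'I_N}, [/\ picked f j \subset C, C \subset [set w | rlev w == j] & #|C| = m j].
  apply: subset_between => //; apply/fintype.subsetP => w; rewrite !inE => /andP[] //.
have [C hC] := choice h.
apply/card_gt0P; exists [ffun j => C j]; rewrite inE; apply/andP; split.
  by apply/forallP => j; rewrite ffunE; have [_ -> ->] := hC j; rewrite eqxx.
by apply/forallP => j; rewrite ffunE; have [-> _ _] := hC j.
Qed.

(* The probability that completing a small selection uniformly at random to an
   admissible family yields Om. *)
Definition kap (Om : samp) : R :=
  \sum_(f | small f && compat f Om) bwt pr f / (nsup f)%:R.

(** A band-preserving permutation of the rows carries [Om] to [Om']. Rates are constant on bands, so
    the permutation preserves the staged law, smallness and the number of completions. *)
Lemma kap_sym (Om Om' : samp) : adm Om -> adm Om' -> kap Om = kap Om'.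
Proof.
move=> aO aO'.
(* Rows are coloured by band and membership; for every admissible family the colour classes have
   sizes [m j] and band size minus [m j]. *)
pose c (O : samp) w := (rlev w, w \in O (rlev w)).
have [p hp] : exists p : {perm 'I_N}, forall w, c Om' (p w) = c Om w.
  have fib O j (b : bool) : adm O -> #|[set w | c O w == (j, b)]|
      = if b then m j else (#|[set w | rlev w == j]| - m j)%N.
    move=> /forallP/(_ j)/andP[Oj /eqP cO].
    have -> : [set w | c O w == (j, b)] = if b then O j else [set w | rlev w == j] :\: O j.
      apply/setP => w; rewrite inE /c xpair_eqE.
      have hO : w \in O j -> rlev w = j by move=> /(fintype.subsetP Oj); rewrite inE => /eqP.
      case: b.
        apply/andP/idP => [[/eqP <-]|wO]; first by case: (w \in _).
        by rewrite (hO wO) eqxx wO.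
      by rewrite !inE; case: eqP => [->|_]; rewrite ?andbF ?andbT //=; case: (w \in O j).
    by case: b => //; rewrite cardsD (finset.setIidPr Oj) cO.
  by apply: perm_of_fibers => -[j b]; rewrite !fib.
have p_lev w : rlev (p w) = rlev w by have [] := hp w.
have p_Om w : (p w \in Om' (rlev w)) = (w \in Om (rlev w)) by have [<- ] := hp w.
have p_levV w : rlev ((p^-1)%g w) = rlev w by rewrite -(p_lev ((p^-1)%g w)) permKV.
pose act (f : sp) : sp := [ffun t => f (t.1, (p^-1)%g t.2)].
pose actV (f : sp) : sp := [ffun t => f (t.1, p t.2)].
have actK : cancel act actV by move=> f; apply/ffunP => -[s w]; rewrite !ffunE /= permK.
have actVK : cancel actV act by move=> f; apply/ffunP => -[s w]; rewrite !ffunE /= permKV.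
pose actO (O : samp) : samp := [ffun j => p @: O j].
pose actOV (O : samp) : samp := [ffun j => (p^-1)%g @: O j].
have actOK : cancel actO actOV.
  move=> O; apply/ffunP => j; rewrite !ffunE -imset_comp.
  rewrite (eq_imset (g := id)) ?imset_id // => w; by rewrite /= permK.
have actOVK : cancel actOV actO.
  move=> O; apply/ffunP => j; rewrite !ffunE -imset_comp.
  rewrite (eq_imset (g := id)) ?imset_id // => w; by rewrite /= permKV.
have picked_act f j : picked (act f) j = p @: picked f j.
  apply/setP => w; rewrite -{2}(permKV p w) (finset.mem_imset _ _ perm_inj) !inE p_levV; congr (_ && _).
  by apply: eq_existsb => s; rewrite ffunE.
have small_act f : small (act f) = small f.
  by apply: eq_forallb => j; rewrite picked_act card_imset //; exact: perm_inj.
have compat_act f O : compat (act f) (actO O) = compat f O.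
  apply: eq_forallb => j; rewrite picked_act ffunE; apply/idP/idP => [/(imsetS (p^-1)%g)|]; last exact: imsetS.
  have e (A : {set 'I_N}) : (p^-1)%g @: (p @: A) = A.
    by rewrite -imset_comp (eq_imset (g := id)) ?imset_id // => w; rewrite /= permK.
  by rewrite !e.
have adm_act O : adm (actO O) = adm O.
  apply: eq_forallb => j; rewrite ffunE card_imset; last exact: perm_inj.
  congr (_ && _); apply/fintype.subsetP/fintype.subsetP => h w.
    by move=> wO; have := h (p w); rewrite !inE p_lev; apply; apply: imset_f.
  by case/imsetP => w' /h; rewrite !inE => + ->; rewrite p_lev.
have nsup_act f : nsup (act f) = nsup f.
  rewrite /nsup -[RHS](card_imset _ (can_inj actOK)); apply: eq_card => O.
  rewrite -(actOVK O) (finset.mem_imset _ _ (can_inj actOK)) !inE adm_act compat_act //.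
have wt_act f : bwt pr (act f) = bwt pr f.
  rewrite /bwt; pose h (t : S * 'I_N) := (t.1, p t.2).
  have hinj : injective h by move=> [s w] [s' w'] [-> /perm_inj ->].
  rewrite (reindex_inj hinj); apply: eq_bigr => -[s w] _; rewrite /h ffunE /= permK.
  by rewrite (pr_lev s (p_lev w)).
have act_Om : actO Om = Om'.
  apply/ffunP => j; rewrite ffunE; apply/eqP; rewrite eqEcard card_imset; last exact: perm_inj.
  have /andP[Oj /eqP ->] := forallP aO j; have /andP[_ /eqP ->] := forallP aO' j.
  rewrite leqnn andbT; apply/fintype.subsetP => w /imsetP[w' w'O ->].
  have := fintype.subsetP Oj w' w'O; rewrite inE => /eqP e.
  by have := p_Om w'; rewrite e w'O.
rewrite /kap [RHS](reindex_inj (can_inj actK)); apply: eq_big => f.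
  by rewrite small_act -act_Om compat_act.
by move=> _; rewrite wt_act nsup_act.
Qed.

(** As [kap] is constant on admissible families and has total mass at least [bP pr small], the
    proportion of bad families times that probability is at most the mass of bad completions, and
    these come from bad selections. *)
Lemma transfer (badS : pred samp) (bad : pred sp) :
  (forall f Om, small f -> adm Om -> compat f Om -> badS Om -> bad f) ->
  #|[set Om | adm Om && badS Om]|%:R / #|[set Om | adm Om]|%:R * bP pr small <= bP pr bad.
Proof.
move=> hbad.
have [X0 aX0] : exists O, adm O.
  have s0 : small [ffun=> false].
    apply/forallP => j; rewrite (_ : picked _ j = finset.set0) ?cards0 //.
    apply/setP => w; rewrite !inE; apply/negP => /andP[_ /existsP[s]]; by rewrite ffunE.
  have /card_gt0P[Q] := nsup_gt0 s0; by rewrite inE => /andP[]; exists Q.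
have A0 : (0 < #|[set Om | adm Om]|)%N by apply/card_gt0P; exists X0; rewrite inE.
have sumK (P : pred samp) (Q : pred sp) :
    (forall f Om, small f -> adm Om -> compat f Om -> P Om -> Q f) ->
    \sum_(Om | adm Om && P Om) kap Om <= bP pr (fun f => small f && Q f).
  move=> PQ; rewrite /kap (exchange_big_dep small) /=; last by move=> i f _ /andP[].
  rewrite /bP /bE big_mkcond; apply: ler_sum => f _; case: ifP => fs /=; last by rewrite mulr0.
  have w0 := bwt_ge0 pr_gt0 pr_le1 f.
  case Qf: (Q f); last first.
    rewrite big1 ?mulr0 // => O /andP[/andP[aO PO] /andP[_ cO]].
    by have := PQ f O fs aO cO PO; rewrite Qf.
  rewrite mulr1 sumr_const -[leLHS]mulr_natr -mulrA ler_piMr //.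
  rewrite mulrC ler_pdivrMr ?ltr0n ?nsup_gt0 // mul1r ler_nat.
  by apply: subset_leq_card; apply/fintype.subsetP => O; rewrite !inE unfold_in => /andP[/andP[-> _] /andP[_ ->]].
have sumT : bP pr small <= \sum_(Om | adm Om) kap Om.
  rewrite /kap (exchange_big_dep small) /=; last by move=> i f _ /andP[].
  rewrite /bP /bE [leRHS]big_mkcond; apply: ler_sum => f _; case: ifP => fs /=; last by rewrite mulr0.
  rewrite mulr1 sumr_const -[leRHS]mulr_natr.
  rewrite (_ : #|_| = nsup f); first by rewrite mulfVK // pnatr_eq0 -lt0n nsup_gt0.
  by apply: eq_card => O; rewrite !inE unfold_in fs.
have kapE O : adm O -> kap O = kap X0 by move=> aO; exact: kap_sym.
have e1 (P : pred samp) : \sum_(Om | adm Om && P Om) kap Om = #|[set Om | adm Om && P Om]|%:R * kap X0.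
  rewrite (eq_bigr (fun=> kap X0)); last by move=> O /andP[aO _]; exact: kapE.
  rewrite (eq_bigl (mem [set Om | adm Om && P Om])); last by move=> O; rewrite !inE.
  by rewrite sumr_const -[LHS]mulr_natl.
have sb : #|[set Om | adm Om && badS Om]|%:R * kap X0 <= bP pr bad.
  rewrite -e1; apply: le_trans (sumK badS bad hbad) _.
  by apply: bP_mono => // f /andP[].
apply: le_trans sb.
apply: (@le_trans _ _ (#|[set Om | adm Om && badS Om]|%:R / #|[set Om | adm Om]|%:R
    * (#|[set Om | adm Om]|%:R * kap X0))).
  rewrite ler_wpM2l ?divr_ge0 //; apply: le_trans sumT _.
  rewrite (eq_bigl (fun O => adm O && xpredT O)); last by move=> O; rewrite andbT.
  rewrite e1 (_ : [set Om | adm Om && xpredT Om] = [set Om | adm Om]) //.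
  by apply/setP => O; rewrite !inE andbT.
by rewrite mulrA mulfVK // pnatr_eq0 -lt0n.
Qed.

End Transfer.

(** * Probability that no band is oversubscribed *)

Section SmallProb.
Variables (R : realType) (S : finType) (N r : nat) (rlev : 'I_N -> 'I_r) (m : 'I_r -> nat).
Variable pr : S * 'I_N -> R.
Hypothesis pr_gt0 : forall t, 0 < pr t.
Hypothesis pr_le1 : forall t, pr t <= 1.
Hypothesis pr_half : forall j, \sum_(t | rlev t.2 == j) pr t <= (m j)%:R / 2.

Local Notation sp := {ffun S * 'I_N -> bool}.

Lemma bE_coord t : bE pr (fun f => (f t)%:R) = pr t.
Proof.
have -> : (fun f : sp => (f t)%:R) = (fun f => \prod_t' (if t' == t then (f t')%:R else 1 : R)).
  by apply/funext => f; rewrite (bigD1 t) //= eqxx big1 ?mulr1 // => t' /negPf ->.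
rewrite (bE_prod _ (fun t' (b : bool) => if t' == t then b%:R else 1 : R)).
rewrite (bigD1 t) //= eqxx big1 ?mulr1 ?mulr0 ?addr0 // => t' /negPf ->.
by rewrite !mulr1 addrC subrK.
Qed.

Lemma picked_le (f : sp) j : (#|picked rlev f j| <= \sum_(t | rlev t.2 == j) f t)%N.
Proof.
apply: (@leq_trans (\sum_(w in picked rlev f j) 1)); first by rewrite sum1_card.
have -> : (\sum_(t | rlev t.2 == j) f t = \sum_(w | rlev w == j) \sum_s f (s, w))%N.
  rewrite exchange_big /= pair_big_dep /=; apply: eq_big => -[s w] //=.
rewrite big_mkcond [leqRHS]big_mkcond; apply: leq_sum => w _; rewrite inE.
case: (rlev w == j) => //=; case: existsP => // -[s fs].
by rewrite (bigD1 s) //= fs.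
Qed.

(** Markov's inequality: the expected number of selections is at most [m j / 2], and failure needs
    at least [m j + 1]. *)
Lemma small_level_prob j : 2^-1 <= bP pr (fun f => #|picked rlev f j| <= m j)%N.
Proof.
have := bP_not pr (fun f => #|picked rlev f j| <= m j)%N.
suff : bP pr (fun f => ~~ (#|picked rlev f j| <= m j)%N) <= 2^-1 by lra.
have mj0 : 0 < (m j).+1%:R :> R by rewrite ltr0n.
rewrite -(ler_pM2l mj0) -bEZ.
apply: (@le_trans _ _ (bE pr (fun f => \sum_(t | rlev t.2 == j) (f t)%:R))).
  apply: bE_le => // f; rewrite -natr_sum; case: leqP => /= h; first by rewrite mulr0.
  by rewrite mulr1 ler_nat (leq_trans h) // picked_le.
rewrite bE_sum; under eq_bigr do rewrite bE_coord.
apply: le_trans (pr_half j) _; rewrite ler_wpM2r // ler_nat //.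
Qed.

Lemma picked_ext (f f' : sp) j : (forall t, rlev t.2 = j -> f t = f' t) ->
  picked rlev f j = picked rlev f' j.
Proof.
move=> h; apply/setP => w; rewrite !inE; case: eqP => //= wj.
by apply: eq_existsb => s; rewrite h.
Qed.

(** Bands depend on disjoint coordinates, so [bE_indep] multiplies the probabilities one band at a
    time. *)
Lemma small_prob : 2^-1 ^+ r <= bP pr (small rlev m).
Proof.
pose sm n (f : sp) := [forall j : 'I_r, (j < n)%N ==> (#|picked rlev f j| <= m j)%N].
suff h n : (n <= r)%N -> 2^-1 ^+ n <= bP pr (sm n).
  apply: le_trans (h r (leqnn r)) _; apply: bP_mono => // f /forallP fs.
  by apply/forallP => j; have := fs j; rewrite ltn_ord.
elim: n => [_|n IHn nr].
  rewrite expr0 -[leLHS](bE_const pr 1); apply: bE_le => // f.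
  by rewrite (_ : sm 0%N f = true) //; apply/forallP.
pose j : 'I_r := Ordinal nr.
have -> : bP pr (sm n.+1) = bE pr (fun f => (#|picked rlev f j| <= m j)%N%:R * (sm n f)%:R).
  apply: eq_bigr => f _; congr (_ * _); rewrite -natrM mulnb; congr (nat_of_bool _)%:R.
  apply/forallP/andP => [h|[h1 /forallP h2] i].
    split; first by have := h j; rewrite /= ltnSn.
    by apply/forallP => i; apply/implyP => ilt; have := h i; rewrite ltnS (ltnW ilt).
  apply/implyP; rewrite ltnS leq_eqVlt => /predU1P[e|ilt]; last by have := h2 i; rewrite ilt.
  by rewrite (_ : i = j) //; apply: val_inj.
rewrite (@bE_indep _ _ pr [set t | rlev t.2 == j]).
- rewrite exprS; apply: ler_pM; rewrite ?exprn_ge0 ?invr_ge0 //; first exact: small_level_prob.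
  by apply: IHn; exact: ltnW.
- move=> f f' ff'; rewrite (@picked_ext f f') // => t tj; apply: ff'; by rewrite inE tj.
- move=> f f' ff'; congr (nat_of_bool _)%:R; apply: eq_forallb => i.
  case: (ltnP i n) => //= ilt; rewrite (@picked_ext f f') // => t ti; apply: ff'.
  rewrite inE ti; apply/negP => /eqP e; move: ilt; by rewrite e /= ltnn.
Qed.

End SmallProb.

(** Comprehensions in [prob] and in the sparsity condition are classical sets; the arguments here
    use finite sets. *)
Lemma card_mkset (T : finType) (P : pred T) :
  #|[set x | P x]%classic| = #|[set x | P x]%SET|.
Proof. by apply: eq_card => x; apply/idP/idP; rewrite in_setE inE. Qed.

(** * Coefficients, measurements, the cone condition and best supports *)

Section Interface.
Variables (R : realType) (r : nat).
Local Notation N := (2 ^ r)%N.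
Local Notation Ph := (Phi R r).

Lemma norm2E p (v : 'cV[R[i]]_p) : norm2 v = l2 [set: 'I_p] (fun i => v i ord0).
Proof. by rewrite l2TE. Qed.

Lemma norm2D p (u v : 'cV[R[i]]_p) : norm2 (u + v) <= norm2 u + norm2 v.
Proof.
rewrite !norm2E; apply: le_trans (l2D _ _ _).
by rewrite (@eq_l2 _ _ _ _ (fun i => u i ord0 + v i ord0)) // => i _; rewrite mxE.
Qed.

Lemma norm2B p (u v : 'cV[R[i]]_p) : norm2 (u - v) = norm2 (v - u).
Proof. by rewrite !norm2E; apply: eq_l2 => i _; rewrite !mxE cmodB. Qed.

Lemma norm2_gram p (v : 'cV[R[i]]_p) : (norm2 v ^+ 2)%:C%C = (adjmx v *m v) ord0 ord0.
Proof.
rewrite norm2E l2_sqr sum_realC mxE; rewrite (eq_bigl xpredT); last by move=> i; rewrite inE.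
by apply: eq_bigr => i _; rewrite cmod_sqr mulrC /adjmx !mxE.
Qed.

Lemma norm2_iso p q (M : 'M[R[i]]_(q, p)) (v : 'cV[R[i]]_p) :
  adjmx M *m M = 1%:M -> norm2 (M *m v) = norm2 v.
Proof.
move=> hM; have : (norm2 (M *m v) ^+ 2)%:C%C = (norm2 v ^+ 2)%:C%C.
  by rewrite !norm2_gram adjmxM -mulmxA (mulmxA (adjmx M)) hM mul1mx.
move/complexI => e; apply/eqP; rewrite -(@eqrXn2 _ 2) ?e //; exact: sqrtr_ge0.
Qed.

Lemma adjmxK p q (M : 'M[R[i]]_(p, q)) : adjmx (adjmx M) = M.
Proof. by apply/matrixP => i j; rewrite /adjmx !mxE conjcK. Qed.

Lemma norm2_coef (v : 'cV[R[i]]_N) : norm2 (adjmx Ph *m v) = norm2 v.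
Proof. by apply: norm2_iso; rewrite adjmxK Phi_adj. Qed.

Lemma Uv_coef (v : 'cV[R[i]]_N) w :
  Uv (Umx R r) (fun i => (adjmx Ph *m v) i ord0) w = (Fmx R r *m v) w ord0.
Proof.
have -> : Fmx R r *m v = Umx R r *m (adjmx Ph *m v).
  by rewrite /Umx -mulmxA (mulmxA Ph) Phi_adj mul1mx.
by rewrite mxE.
Qed.

Lemma norm2_sample (p : nat) (Om : sample r) (v : 'cV[R[i]]_N) : #|Omega Om| = p ->
  norm2 (Amx R p Om *m v) = l2 (Omega Om) (fun w => (Fmx R r *m v) w ord0).
Proof.
move=> cO; have sz : size (enum (Omega Om)) = p by rewrite -cardE.
rewrite /norm2 /l2; congr Num.sqrt.
rewrite -[RHS]big_enum (big_nth (idx0 r)) sz big_mkord; apply: eq_bigr => i _.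
by congr (cmod _ ^+ 2); rewrite !mxE; apply: eq_bigr => t _; rewrite !mxE.
Qed.

(** On [D], [|c + h|] is at least [|c|] plus the real part of the conjugate sign times [h]; off [D]
    it is at least [|h| - |c|]. At a zero coefficient division by 0 gives sign 0, which is
    consistent. *)
Lemma cone (c h : 'I_N -> R[i]) (D : {set 'I_N}) (sgn : 'I_N -> R[i]) :
  (forall i, sgn i = if i \in D then c i / (cmod (c i))%:C%C else 0) ->
  \sum_i cmod (c i + h i) <= \sum_i cmod (c i) ->
  \sum_(i in ~: D) cmod (h i)
    <= 2 * (\sum_(i in ~: D) cmod (c i)) + cmod (\sum_i (sgn i)^*%C * h i).
Proof.
move=> sgnE; rewrite (bigID (mem D)) [X in _ <= X](bigID (mem D)) /=.
have cE (F : 'I_N -> R) : \sum_(i | i \notin D) F i = \sum_(i in ~: D) F i.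
  by apply: eq_bigl => i; rewrite inE.
rewrite !cE => hle.
have h1 : \sum_(i in ~: D) cmod (h i) - \sum_(i in ~: D) cmod (c i) <= \sum_(i in ~: D) cmod (c i + h i).
  rewrite -sumrB; apply: ler_sum => i _; rewrite lerBlDr.
  by have := cmodD (c i + h i) (- c i); rewrite cmodN addrAC subrr add0r.
have h2 : \sum_(i in D) cmod (c i) + complex.Re (\sum_i (sgn i)^*%C * h i) <= \sum_(i in D) cmod (c i + h i).
  have -> : \sum_i (sgn i)^*%C * h i = \sum_(i in D) (sgn i)^*%C * h i.
    rewrite [RHS]big_mkcond; apply: eq_bigr => i _; rewrite sgnE; case: ifP => // _.
    by rewrite conjc0 mul0r.
  rewrite complex_Re_sum -big_split /=; apply: ler_sum => i iD; rewrite sgnE iD.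
  case: (eqVneq (c i) 0) => [->|c0].
    by rewrite cmod0 mul0r conjc0 mul0r !add0r cmod_ge0.
  have n0 : cmod (c i) != 0 by rewrite cmod_eq0.
  set s := c i / _.
  have s1 : cmod s = 1 by rewrite /s cmodM cmodV cmodR ger0_norm ?cmod_ge0 // mulfV.
  have sc : s^*%C * c i = (cmod (c i))%:C%C.
    have n0' : (cmod (c i))%:C%C != 0 :> R[i] by rewrite (inj_eq (@complexI R) _ 0).
    apply: (mulIf n0'); rewrite realCM -expr2 cmod_sqr /s cconjM conjc_inv cconjR.
    by field.
  have -> : cmod (c i) + complex.Re (s^*%C * h i) = complex.Re (s^*%C * (c i + h i)).
    by rewrite mulrDr sc complex_ReD.
  apply: le_trans (ler_norm _) _; apply: le_trans (Re_le_cmod _) _.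
  by rewrite cmodM cmodJ s1 mul1r.
have h3 : - complex.Re (\sum_i (sgn i)^*%C * h i) <= cmod (\sum_i (sgn i)^*%C * h i).
  by apply: le_trans (Re_le_cmod _); rewrite -normrN ler_norm.
lra.
Qed.

Lemma sgn_le1 (c : 'I_N -> R[i]) i : cmod (c i / (cmod (c i))%:C%C) <= 1.
Proof.
rewrite cmodM cmodV cmodR ger0_norm ?cmod_ge0 //.
case: (eqVneq (cmod (c i)) 0) => [->|n0]; first by rewrite mul0r.
by rewrite mulfV.
Qed.

Definition sparse_supp (k : 'I_r -> nat) (D : {set 'I_N}) : bool :=
  [forall j : 'I_r, #|[set i in D | level i == j]| <= k j]%N.

(** A minimum over finitely many supports. The support of any competitor [z] in the infimum is
    admissible, and off it [c - z] equals [c]. *)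
Lemma best_support (k : 'I_r -> nat) (c : 'cV[R[i]]_N) :
  exists2 D, sparse_supp k D & \sum_(i in ~: D) cmod (c i ord0) <= sigma_kM k c.
Proof.
have s0 : sparse_supp k finset.set0.
  apply/forallP => j; rewrite (_ : [set i in _ | _] = finset.set0) ?cards0 //.
  by apply/setP => i; rewrite !inE.
pose T D := \sum_(i in ~: D) cmod (c i ord0).
case: (@arg_minP _ R _ finset.set0 (sparse_supp k) T s0) => D sD minD.
exists D => //; apply: lb_le_inf.
  exists (Defs.norm1 (c - 0)); exists 0 => //= j.
  rewrite (card_mkset (fun i => (level i == j) && ((0 : 'cV[R[i]]_N) i ord0 != 0))).
  by rewrite eq_card0 // => i; rewrite inE mxE eqxx andbF.
move=> _ [z /= zk <-]; pose Dz := [set i | z i ord0 != 0].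
apply: le_trans (minD Dz _) _.
  apply/forallP => j; apply: leq_trans (zk j).
  rewrite (card_mkset (fun i => (level i == j) && (z i ord0 != 0))); apply: subset_leq_card.
  by apply/fintype.subsetP => i; rewrite !inE andbC.
rewrite /T /Defs.norm1 big_mkcond; apply: ler_sum => i _; rewrite !inE negbK.
by case: eqP => [z0|_]; rewrite ?cmod_ge0 // !mxE z0 subr0.
Qed.

End Interface.

(** * Number of stages, sampling rates and numerical constants *)

Section SamplingRates.
Variables (R : realType) (r : nat) (eps : R) (k m : 'I_r -> nat).
Hypothesis r_gt0 : (0 < r)%N.
Hypothesis eps_gt0 : 0 < eps.
Hypothesis eps_le : eps <= expR (-1).
Hypothesis m_range : forall j : 'I_r, (1 <= m j)%N /\ (m j <= #|W r j|)%N.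
Local Notation N := (2 ^ r)%N.

Let kk := (\sum_(j < r) k j)%N.
Let a : R := ln eps^-1.
Let b : R := ln N%:R.

Definition levf (i : 'I_N) : 'I_r := Ordinal (level_lt r_gt0 i).
Definition rlf (w : 'I_N) : 'I_r := Ordinal (rl_lt r_gt0 w).

Lemma W_rlf (j : 'I_r) : W r j = [set w | rlf w == j].
Proof. by apply/setP => w; rewrite W_rl // inE -val_eqE. Qed.

Lemma card_W_gt0 (j : 'I_r) : (0 < #|W r j|)%N.
Proof. by have [h1 h2] := m_range j; exact: leq_trans h1 h2. Qed.

Lemma card_W_le (j : 'I_r) : (#|W r j|%:R : R) <= 2 * 2 ^+ j.
Proof.
rewrite -exprS -natrX ler_nat; apply: leq_trans (card_band R r_gt0 j).
by apply: subset_leq_card; apply/fintype.subsetP => w; rewrite W_rl // inE.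
Qed.

Lemma sum_card_W : (\sum_(j < r) #|W r j| = N)%N.
Proof.
rewrite -[RHS]card_ord -sum1_card (partition_big rlf predT) //=; apply: eq_bigr => j _.
by rewrite -sum1_card; apply: eq_bigl => w; rewrite W_rlf inE.
Qed.

Lemma ln2_ge : 1 / 2 <= ln 2 :> R.
Proof.
have : ln (1 + (- (1 / 2))) <= - (1 / 2) :> R by apply: le_ln1Dx; lra.
have -> : 1 + - (1 / 2) = 2^-1 :> R by lra.
by rewrite lnV ?posrE //; lra.
Qed.

Lemma b_ge : 1 / 2 <= b.
Proof.
apply: le_trans ln2_ge _; rewrite /b ler_ln ?posrE ?ltr0n ?expn_gt0 // ler_nat.
by rewrite -{1}(expn1 2) leq_exp2l.
Qed.

Lemma a_ge : 1 <= a.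
Proof. by rewrite /a lnV ?posrE // lerNr -[leRHS]expRK ler_ln ?posrE ?expR_gt0. Qed.

(** There are [stages.+1] stages: the logarithm lets the decay by 8 absorb [sqrt k], and the seven
    further stages leave the residual [2 ^ -18]. *)
Definition stages : nat := trunc_log 2 kk + 6.
(* The geometric part keeps 1 / pst s = O(2 ^ s), which the decay 8 ^- s of the
   iterates absorbs; the constant part keeps every stage above the Bernstein
   threshold at the cost of a single logarithm. *)
Definition pst (s : nat) : R := (2 ^+ (s + 2))^-1 + (2 * stages.+1%:R)^-1.

Lemma pst_ge1 s : (2 ^+ (s + 2))^-1 <= pst s.
Proof. by rewrite /pst lerDl invr_ge0 mulr_ge0. Qed.

Lemma pst_ge2 s : (2 * stages.+1%:R)^-1 <= pst s.
Proof. by rewrite /pst lerDr invr_ge0 exprn_ge0. Qed.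

Lemma pst_gt0 s : 0 < pst s.
Proof. by apply: lt_le_trans (pst_ge1 s); rewrite invr_gt0 exprn_gt0. Qed.

Lemma sum_pst : \sum_(s < stages.+1) pst s <= 1.
Proof.
rewrite big_split /= sumr_const card_ord.
have -> : (2 * stages.+1%:R)^-1 *+ stages.+1 = 1 / 2 :> R.
  by rewrite -mulr_natl; field; rewrite addrC natr1 pnatr_eq0.
have -> : \sum_(s < stages.+1) (2 ^+ (s + 2))^-1 = 1 / 4 * \sum_(s < stages.+1) (1 / 2) ^+ s :> R.
  rewrite mulr_sumr; apply: eq_bigr => s _; rewrite expr_div_n expr1n exprD invfM.
  by rewrite mulrC; congr (_ * _); rewrite ?mul1r // -natrX.
have : \sum_(s < stages.+1) (1 / 2 : R) ^+ s <= (1 - 1 / 2)^-1 by apply: geom_sum_le; lra.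
have -> : (1 - 1 / 2 : R)^-1 = 2 by field.
lra.
Qed.

Lemma pst_le1 (s : 'I_stages.+1) : pst s <= 1.
Proof.
apply: le_trans sum_pst; rewrite (bigD1 s) //= lerDl.
by apply: sumr_ge0 => i _; rewrite ltW // pst_gt0.
Qed.

(** The 2 in the denominator keeps the expected number of selections in band [j] at most [m j / 2],
    as Markov's inequality requires. *)
Definition prs (t : 'I_stages.+1 * 'I_N) : R :=
  pst t.1 * (m (rlf t.2))%:R / (2 * #|W r (rlf t.2)|%:R).

Lemma mj_gt0 j : 0 < (m j)%:R :> R.
Proof. by rewrite ltr0n; have [] := m_range j. Qed.

Lemma Wj_gt0 (j : 'I_r) : 0 < #|W r j|%:R :> R.
Proof. by rewrite ltr0n card_W_gt0. Qed.

Lemma prs_gt0 t : 0 < prs t.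
Proof. by rewrite divr_gt0 ?mulr_gt0 ?pst_gt0 ?mj_gt0 ?Wj_gt0. Qed.

Lemma prs_le1 t : prs t <= 1.
Proof.
rewrite ler_pdivrMr ?mulr_gt0 ?Wj_gt0 // mul1r.
have h1 := pst_le1 t.1; have h0 := ltW (pst_gt0 t.1).
have h2 : (m (rlf t.2))%:R <= #|W r (rlf t.2)|%:R :> R.
  by rewrite ler_nat; have [] := m_range (rlf t.2).
have := mj_gt0 (rlf t.2); nra.
Qed.

Lemma prsE s w : prs (s, w) = pst s * (m (rlf w))%:R / (2 * #|W r (rlf w)|%:R).
Proof. by []. Qed.

Lemma prs_lev s w w' : rlf w = rlf w' -> prs (s, w) = prs (s, w').
Proof. by move=> e; rewrite !prsE e. Qed.

Lemma prs_half (j : 'I_r) : \sum_(t | rlf t.2 == j) prs t <= (m j)%:R / 2.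
Proof.
have -> : \sum_(t | rlf t.2 == j) prs t = \sum_(s < stages.+1) \sum_(w | rlf w == j) prs (s, w).
  by rewrite pair_big_dep /=; apply: eq_big => -[s w].
have e (s : 'I_stages.+1) : \sum_(w | rlf w == j) prs (s, w) = pst s * ((m j)%:R / 2).
  rewrite (eq_bigr (fun=> pst s * (m j)%:R / (2 * #|W r j|%:R))); last by move=> w /eqP wj; rewrite prsE wj.
  rewrite (eq_bigl (mem (W r j))); last by move=> w; rewrite W_rlf !inE.
  rewrite sumr_const -[LHS]mulr_natl; field.
  by rewrite gt_eqF ?Wj_gt0.
under eq_bigr do rewrite e.
by rewrite -mulr_suml ler_piMl ?divr_ge0 // sum_pst.
Qed.

Variable E : R.
Hypothesis E_ge : forall j : 'I_r, #|W r j|%:R / (m j)%:R <= E.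

Lemma prs_E s w : (prs (s, w))^-1 <= 8 * 2 ^+ s * E.
Proof.
set j := rlf w.
have -> : (prs (s, w))^-1 = 2 * (#|W r j|%:R / (m j)%:R) * (pst s)^-1.
  rewrite prsE -/j; field.
  by rewrite !gt_eqF ?mj_gt0 ?Wj_gt0 ?pst_gt0.
have -> : 8 * 2 ^+ s * E = 2 * E * (4 * 2 ^+ s) by ring.
have p0 : 0 < 2 ^+ s :> R by rewrite exprn_gt0.
apply: ler_pM => //.
- by rewrite invr_ge0 ltW ?pst_gt0.
- by rewrite ler_wpM2l.
have e : 4 * 2 ^+ s = 2 ^+ (s + 2) :> R by rewrite exprD; ring.
rewrite e -[leRHS]invrK lef_pV2 ?posrE ?pst_gt0 ?invr_gt0 ?exprn_gt0 //.
exact: pst_ge1.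
Qed.

Lemma prs_m s w : (m (rlf w))%:R / prs (s, w) <= 16 * 2 ^+ s * 2 ^+ rlf w.
Proof.
set j := rlf w.
have -> : (m j)%:R / prs (s, w) = 2 * #|W r j|%:R * (pst s)^-1.
  rewrite prsE -/j; field.
  by rewrite !gt_eqF ?mj_gt0 ?Wj_gt0 ?pst_gt0.
have -> : 16 * 2 ^+ s * 2 ^+ j = 2 * (2 * 2 ^+ j) * (4 * 2 ^+ s) :> R by ring.
apply: ler_pM => //.
- by rewrite invr_ge0 ltW ?pst_gt0.
- by rewrite ler_wpM2l ?card_W_le.
have e : 4 * 2 ^+ s = 2 ^+ (s + 2) :> R by rewrite exprD; ring.
rewrite e -[leRHS]invrK lef_pV2 ?posrE ?pst_gt0 ?invr_gt0 ?exprn_gt0 //.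
exact: pst_ge1.
Qed.

Hypothesis kk_gt0 : (0 < kk)%N.
Hypothesis kk_eps : kk%:R * eps < 1.
Hypothesis m_large : forall j : 'I_r, 2 ^+ 43 * KK R k j * a * b <= (m j)%:R.

Lemma ab_ge : 1 / 2 <= a * b.
Proof. by rewrite -[leLHS]mul1r; apply: ler_pM; rewrite ?a_ge ?b_ge. Qed.

(** In each band [k j <= KK j <= m j], which is at most the size of the band. *)
Lemma kk_le : (kk <= N)%N.
Proof.
rewrite -sum_card_W; apply: leq_sum => j _; rewrite -(ler_nat R).
apply: le_trans (_ : (m j)%:R <= _); last by rewrite ler_nat; have [] := m_range j.
apply: le_trans (m_large j).
have K0 : (k j)%:R <= KK R k j.
  rewrite /KK (bigD1 j) //= dk_diag mul1r lerDl; apply: sumr_ge0 => l _.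
  by rewrite mulr_ge0 ?dk_ge0.
apply: le_trans K0 _; have Kp := KK_gt0 R kk_gt0 j.
have h : 1 <= 2 ^+ 43 * (a * b).
  have p43 : 2 <= 2 ^+ 43 :> R by rewrite -[leLHS]expr1 ler_weXn2l // ler1n.
  have := ab_ge; move: p43; move: (2 ^+ 43) (a * b) => p x; nra.
have -> : 2 ^+ 43 * KK R k j * a * b = KK R k j * (2 ^+ 43 * (a * b)) by ring.
by rewrite ler_peMr // ltW.
Qed.

Lemma ln_kk_b : ln kk%:R <= b.
Proof. by rewrite /b ler_ln ?posrE ?ltr0n ?expn_gt0 // ler_nat kk_le. Qed.

Lemma ln_kk_a : ln kk%:R <= a.
Proof.
rewrite /a ler_ln ?posrE ?ltr0n ?invr_gt0 //.
by rewrite -[leRHS]mul1r ler_pdivlMr // ltW.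
Qed.

Lemma stages_le : stages.+1%:R <= 7 + 2 * ln kk%:R :> R.
Proof.
rewrite /stages -addnS natrD addrC lerD2l.
have h : (2 ^+ trunc_log 2 kk : R) <= kk%:R by rewrite -natrX ler_nat trunc_logP.
have : ln (2 ^+ trunc_log 2 kk : R) <= ln kk%:R by rewrite ler_ln ?posrE ?exprn_gt0 ?ltr0n.
rewrite lnXn // -[ln 2 *+ _]mulr_natl.
have : (trunc_log 2 kk)%:R * (1 / 2) <= (trunc_log 2 kk)%:R * ln 2 :> R by rewrite ler_wpM2l // ln2_ge.
lra.
Qed.

(** [exp (- LamP)] is [eps / N ^ 16]; the power of [N] pays for the union bound and for the loss
    [2 ^ r]. *)
Definition LamP : R := a + 16 * b.

Lemma LamP_gt0 : 0 < LamP.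
Proof. have := a_ge; have := b_ge; rewrite /LamP; lra. Qed.

(** The number of stages is at most [16 * b] and at most [9 * a]; the first bound is used against
    [a], the second against [16 * b]. *)
Lemma stages_Lam : stages.+1%:R * LamP <= 160 * (a * b).
Proof.
have := stages_le; have := ln_kk_a; have := ln_kk_b; have := a_ge; have := b_ge.
have : 0 <= stages.+1%:R :> R by [].
rewrite /LamP; move: (stages.+1%:R) (ln kk%:R) a b => s v x y s0 y0 x0 vy vx sv.
have h1 : s <= 16 * y by lra.
have h2 : s <= 9 * x by lra.
have h3 : s * x <= 16 * y * x by apply: ler_wpM2r => //; lra.
have h4 : s * y <= 9 * x * y by apply: ler_wpM2r => //; lra.
lra.
Qed.

(** [Cth 64 256 th] is [2 ^ 23 * th + 2 ^ 17 * th ^ 2] and must not exceed [2 ^ -8]; here its main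
    term is [2 ^ -9]. *)
Definition thP : R := (2 ^+ 32)^-1.

Lemma thP_ge0 : 0 <= thP.
Proof. by rewrite /thP invr_ge0 exprn_ge0. Qed.

Lemma thP_mul : 2 ^+ 32 * thP = 1.
Proof. by rewrite /thP mulfV // expf_eq0 /= pnatr_eq0. Qed.

Lemma Cth_thP : Cth 64 256 thP <= 256^-1.
Proof.
have e1 := thP_mul.
have h : thP <= (2 ^+ 10)^-1.
  by rewrite /thP lef_pV2 ?posrE ?exprn_gt0 // ler_weXn2l // ler1n.
have e10 : (2 ^+ 10 : R) = 1024 by rewrite -natrX.
have e32 : (2 ^+ 32 : R) = 2 ^+ 10 * 2 ^+ 10 * 2 ^+ 10 * 4.
  by rewrite -!exprD [in LHS](_ : 32 = 10 + 10 + 10 + 2)%N // exprD -[2 ^+ 2]natrX.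
rewrite e32 !e10 in e1; rewrite e10 in h; have := thP_ge0; rewrite /Cth.
move: thP e1 h => t e1 h t0.
have h2 : t ^+ 2 <= t * 1024^-1 by rewrite expr2 ler_wpM2l.
lra.
Qed.

(** The constant part of the rate suffices: the claim reduces to
    [8 * stages.+1 * LamP <= 2 ^ 11 * a * b], and [8 * 160 <= 2 ^ 11]. *)
Lemma prs_large s w : LamP * KK R k (rlf w) <= thP * 2 ^+ rlf w * prs (s, w).
Proof.
set j := rlf w; have K0 := KK_gt0 R kk_gt0 j.
have W0 := Wj_gt0 j; have p0 : 0 < 2 ^+ j :> R by rewrite exprn_gt0.
have S0 : 0 < stages.+1%:R :> R by rewrite ltr0n.
have h1 : (2 * stages.+1%:R)^-1 * (m j)%:R / (2 * (2 * 2 ^+ j)) <= prs (s, w).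
  rewrite prsE -/j; apply: ler_pM.
  - by rewrite mulr_ge0 ?invr_ge0 ?mulr_ge0.
  - by rewrite invr_ge0 !mulr_ge0 // ltW.
  - by rewrite ler_wpM2r // pst_ge2.
  by rewrite lef_pV2 ?posrE ?mulr_gt0 // ler_wpM2l // card_W_le.
apply: (@le_trans _ _ (thP * 2 ^+ j * ((2 * stages.+1%:R)^-1 * (m j)%:R / (2 * (2 * 2 ^+ j))))); last first.
  by rewrite ler_wpM2l // mulr_ge0 ?thP_ge0 // ltW.
have -> : thP * 2 ^+ j * ((2 * stages.+1%:R)^-1 * (m j)%:R / (2 * (2 * 2 ^+ j)))
   = (thP * (m j)%:R) / (8 * stages.+1%:R).
  by field; rewrite (gt_eqF p0) /= addrC natr1 pnatr_eq0.
rewrite ler_pdivlMr ?mulr_gt0 //.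
apply: (@le_trans _ _ (thP * (2 ^+ 43 * KK R k j * a * b))); last first.
  by rewrite ler_wpM2l ?thP_ge0 ?m_large.
have -> : thP * (2 ^+ 43 * KK R k j * a * b) = KK R k j * (2 ^+ 11 * (a * b)).
  have -> : (2 ^+ 43 : R) = 2 ^+ 32 * 2 ^+ 11 by rewrite -exprD.
  transitivity ((2 ^+ 32 * thP) * (KK R k j * (2 ^+ 11 * (a * b)))); last by rewrite thP_mul mul1r.
  by rewrite [2 ^+ 32 * thP]mulrC -!mulrA; congr (_ * (_ * _)); ring.
have -> : LamP * KK R k j * (8 * stages.+1%:R) = KK R k j * (8 * (stages.+1%:R * LamP)) by ring.
rewrite ler_wpM2l ?(ltW K0) //.
have e11 : (2 ^+ 11 : R) = 2048 by rewrite -natrX.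
rewrite e11; have := stages_Lam; have := ab_ge; lra.
Qed.

Lemma stages_decay : Num.sqrt kk%:R / 8 ^+ stages.+1 <= (2 ^+ 18)^-1 :> R.
Proof.
have k0 : 1 <= kk%:R :> R by rewrite ler1n.
have s1 : Num.sqrt kk%:R <= kk%:R :> R.
  rewrite -[leRHS]ger0_norm ?ler0n // -sqrtr_sqr ler_wsqrtr // expr2 ler_peMr //.
rewrite ler_pdivrMr ?exprn_gt0 // ler_pdivlMl ?exprn_gt0 //.
rewrite /stages -addnS exprD.
have e : (8 ^+ 7 : R) = 2 ^+ 18 * 8.
  have e8 : (8 : R) = 2 ^+ 3 by rewrite -natrX.
  by rewrite e8 -exprM -exprD.
rewrite e mulrCA ler_wpM2l ?exprn_ge0 //; apply: le_trans s1 _.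
have h : (kk%:R : R) <= 2 ^+ (trunc_log 2 kk).+1 by rewrite -natrX ler_nat ltnW // trunc_log_ltn.
apply: le_trans h _; rewrite exprS mulrC; apply: ler_pM; rewrite ?exprn_ge0 //.
  by rewrite lerXn2r ?nnegrE // ler_nat.
by rewrite ler_nat.
Qed.

(** The leading [N] is the loss from [small_prob]. The polynomial is at most [1600 * N ^ 5], and
    [1600 <= 2 ^ 11 <= N ^ 11]. *)
Lemma union_bound : N%:R * (4 * (#|'I_N|.+1 ^ 2 * stages.+2 ^ 2)%:R * (4 * expR (- LamP))) <= eps.
Proof.
have eL : expR (- LamP) = eps / N%:R ^+ 16.
  rewrite /LamP opprD expRD /a lnV ?posrE // opprK lnK ?posrE //.
  by rewrite mulrC [16 * b]mulrC -mulNr -[X in expR (_ * X)]/(16%:R) expRM_natr expRN /b lnK ?posrE ?ltr0n ?expn_gt0 // exprVn mulrC.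
have N0 : 0 < N%:R :> R by rewrite ltr0n expn_gt0.
have N2 : (2 <= N)%N by rewrite -{1}(expn1 2) leq_exp2l.
have st : (stages.+2 <= 5 * N)%N.
  have h : (trunc_log 2 kk <= r)%N.
    rewrite -(leq_exp2l _ _ (isT : 1 < 2)%N); apply: leq_trans kk_le; exact: trunc_logP.
  have h2 : (r < N)%N by exact: ltn_expl.
  by rewrite /stages; lia.
have main : (N * (4 * (N.+1 ^ 2 * stages.+2 ^ 2) * 4) <= N ^ 16)%N.
  apply: (@leq_trans (N * (4 * ((2 * N) ^ 2 * (5 * N) ^ 2) * 4)%N)).
    apply: leq_mul => //; apply: leq_mul => //; apply: leq_mul => //.
    by apply: leq_mul; rewrite leq_exp2r //; lia.
  have -> : (N * (4 * ((2 * N) ^ 2 * (5 * N) ^ 2) * 4) = 1600 * N ^ 5)%N by rewrite !expnMn; lia.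
  rewrite (_ : 16 = 11 + 5)%N // [(N ^ (11 + 5))%N]expnD leq_mul2r; apply/orP; right.
  by apply: (@leq_trans (2 ^ 11)%N) => //; rewrite leq_exp2r.
rewrite card_ord eL.
have -> : N%:R * (4 * (N.+1 ^ 2 * stages.+2 ^ 2)%:R * (4 * (eps / N%:R ^+ 16)))
  = eps * ((N * (4 * (N.+1 ^ 2 * stages.+2 ^ 2) * 4))%:R / (N ^ 16)%:R) :> R.
  rewrite [(N ^ 16)%:R]natrX [(N * _)%:R]natrM [(4 * _ * 4)%:R]natrM [(4 * _)%:R]natrM.
  move: N0; move: (N%:R : R) (_ ^ 2 * _)%:R => n q n0; field; by rewrite gt_eqF.
rewrite ler_piMr ?(ltW eps_gt0) // ler_pdivrMr ?ltr0n ?expn_gt0 ?expn_gt0 //.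
by rewrite mul1r ler_nat.
Qed.

End SamplingRates.

(** * Consequences of minimality *)

Section Recover.
Variables (R : realType) (r : nat) (m : 'I_r -> nat).
Variables (x : 'cV[R[i]]_(2 ^ r)) (eta : R) (e : 'cV[R[i]]_(\sum_(j < r) m j)).
Hypothesis r_gt0 : (0 < r)%N.
Hypothesis e_le : norm2 e <= eta.
Local Notation N := (2 ^ r)%N.
Local Notation Ph := (Phi R r).

Definition coef (v : 'cV[R[i]]_N) (i : 'I_N) : R[i] := (adjmx Ph *m v) i ord0.

Lemma mem_Omega (Om : sample r) w : (w \in Omega Om) = [exists j, w \in Om j].
Proof.
apply/bigcupP/existsP => [[j _ wj]|[j wj]]; first by exists j.
by exists j.
Qed.

Lemma admissible_adm (Om : sample r) : admissible m Om = adm (rlf r_gt0) m Om.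
Proof. by apply: eq_forallb => j; rewrite (W_rlf r_gt0). Qed.

Lemma card_Omega (Om : sample r) : admissible m Om -> #|Omega Om| = (\sum_(j < r) m j)%N.
Proof.
rewrite admissible_adm => /forallP aO.
rewrite -sum1_card (partition_big (rlf r_gt0) predT) //=; apply: eq_bigr => j _.
have /andP[Oj /eqP <-] := aO j; rewrite -sum1_card; apply: eq_bigl => w.
rewrite mem_Omega; apply/andP/idP => [[/existsP[j' wj'] /eqP <-]|wj].
  have /andP[/fintype.subsetP/(_ w wj')] := aO j'; by rewrite inE => /eqP ->.
split; first by apply/existsP; exists j.
by have := fintype.subsetP Oj w wj; rewrite inE.
Qed.

Variables (Om : sample r) (xh : 'cV[R[i]]_N).
Hypothesis aOm : admissible m Om.
Let A := Amx R (\sum_(j < r) m j) Om.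
Hypothesis xh_min : is_minimizer A (A *m x + e) eta xh.

Lemma min_meas : l2 (Omega Om) (Uv (Umx R r) (coef (xh - x))) <= 2 * eta.
Proof.
have -> : l2 (Omega Om) (Uv (Umx R r) (coef (xh - x))) = norm2 (A *m (xh - x)).
  rewrite /A norm2_sample ?card_Omega //; apply: eq_l2 => w _.
  by rewrite -Uv_coef.
have -> : A *m (xh - x) = e - (A *m x + e - A *m xh).
  by rewrite mulmxBr; apply/matrixP => i j; rewrite !mxE; ring.
have [h1 _] := xh_min.
apply: le_trans (norm2D _ _) _; rewrite mulr_natl mulr2n; apply: lerD => //.
by rewrite -[norm2 (- _)]/(norm2 _) -sub0r norm2B subr0.
Qed.

Lemma min_l1 : \sum_i cmod (coef x i + coef (xh - x) i) <= \sum_i cmod (coef x i).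
Proof.
have [_ /(_ x)] := xh_min; rewrite addrC addKr => /(_ e_le) h.
apply: le_trans h; rewrite /Defs.norm1; apply: ler_sum => i _.
rewrite /coef mulmxBr; move: (adjmx Ph *m xh) (adjmx Ph *m x) => u v.
by have -> : v i ord0 + (u - v) i ord0 = u i ord0 by rewrite !mxE; ring.
Qed.

Lemma min_norm2 : norm2 (x - xh) = l2 [set: 'I_N] (coef (xh - x)).
Proof. by rewrite norm2B -norm2_coef norm2E. Qed.

Lemma eta_ge0 : 0 <= eta.
Proof. by apply: le_trans e_le; exact: sqrtr_ge0. Qed.

Lemma full_bound : Omega Om = [set: 'I_N] -> norm2 (x - xh) <= 2 * eta.
Proof.
move=> OT; rewrite min_norm2; have := min_meas; rewrite OT !l2TE.
by rewrite (parseval (@Umx_ortho R r)).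
Qed.

(** This serves the case [k = 0], in which the approximation error is the full l1 norm of the
    coefficients. *)
Lemma trivial_bound : norm2 (x - xh) <= 2 * \sum_i cmod (coef x i).
Proof.
rewrite min_norm2; apply: le_trans (l2_le_l1 _ _) _.
rewrite (eq_bigl xpredT); last by move=> i; rewrite inE.
apply: (@le_trans _ _ (\sum_i (cmod (coef x i + coef (xh - x) i) + cmod (coef x i)))).
  apply: ler_sum => i _.
  by have := cmodD (coef x i + coef (xh - x) i) (- coef x i); rewrite cmodN addrAC subrr add0r.
by rewrite big_split /= mulr_natl mulr2n lerD2r min_l1.
Qed.

End Recover.

Lemma decay_small (R : realType) (t : R) : t <= (2 ^+ 18)^-1 ->
  t <= 1 / 4 /\ t * Bst 64 <= 1 / 14.
Proof.
have c1 : (2 ^+ 18 : R)^-1 * 2 ^+ 18 = 1 by rewrite mulVf // expf_eq0 /= pnatr_eq0.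
have e18 : (2 ^+ 18 : R) = 2 ^+ 10 * 2 ^+ 8 by rewrite -exprD.
have e10 : (2 ^+ 10 : R) = 1024 by rewrite -natrX.
have e8 : (2 ^+ 8 : R) = 256 by rewrite -natrX.
move: c1; move: (_^-1) => c; rewrite e18 e10 e8 /Bst => c1 tc; split; lra.
Qed.

(** * Recovery with high probability under uniform sampling *)

Section Probability.
Variables (R : realType) (r : nat) (eps : R) (k m : 'I_r -> nat).
Variables (x : 'cV[R[i]]_(2 ^ r)) (eta : R) (e : 'cV[R[i]]_(\sum_(j < r) m j)).
Hypothesis r_gt0 : (0 < r)%N.
Hypothesis eps_gt0 : 0 < eps.
Hypothesis eps_le : eps <= expR (-1).
Hypothesis m_range : forall j : 'I_r, (1 <= m j)%N /\ (m j <= #|W r j|)%N.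
Hypothesis e_le : norm2 e <= eta.
Local Notation N := (2 ^ r)%N.
Let kk := (\sum_(j < r) k j)%N.

Lemma prob_ge0 (P : sample r -> Prop) : 0 <= prob R m P.
Proof. by rewrite /prob divr_ge0. Qed.

Lemma admissible_gt0 : (0 < #|[set Om | admissible m Om]%SET|)%N.
Proof.
have h (j : 'I_r) : exists C : {set 'I_N}, [/\ finset.set0 \subset C, C \subset W r j & #|C| = m j].
  apply: subset_between; rewrite ?finset.sub0set ?cards0 //.
  by have [] := m_range j.
have [C hC] := choice h; apply/card_gt0P; exists [ffun j : 'I_r => C j]; rewrite inE.
by apply/forallP => j; rewrite ffunE; have [_ -> ->] := hC j; rewrite eqxx.
Qed.

Lemma prob_compl (P : sample r -> Prop) :
  prob R m P = 1 - #|[set Om | admissible m Om && ~~ `[< P Om >]]%SET|%:R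
                   / #|[set Om | admissible m Om]%SET|%:R.
Proof.
rewrite /prob (card_mkset (fun Om => admissible m Om && `[< P Om >])).
rewrite (card_mkset (fun Om => admissible m Om)).
have T0 : #|[set Om | admissible m Om]%SET|%:R != 0 :> R.
  by rewrite pnatr_eq0 -lt0n admissible_gt0.
apply/eqP; rewrite eq_sym subr_eq -mulrDl -natrD eq_sym.
rewrite (_ : (_ + _)%N = #|[set Om | admissible m Om]%SET|) ?divff //.
rewrite -[RHS](cardsID [set Om | `[< P Om >]]%SET); congr (_ + _)%N; apply: eq_card => Om.
  by rewrite !inE.
by rewrite !inE andbC.
Qed.

Lemma prob_one (P : sample r -> Prop) : (forall Om, admissible m Om -> P Om) -> prob R m P = 1.
Proof.
move=> hP; rewrite prob_compl eq_card0 ?mul0r ?subr0 // => Om; rewrite inE.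
by apply/negP => /andP[/hP aO]; apply/negP/negPn/asboolP.
Qed.

Variable E : R.
Hypothesis E_ge : forall j : 'I_r, #|W r j|%:R / (m j)%:R <= E.
Hypothesis kk_gt0 : (0 < kk)%N.
Hypothesis m_large : forall j : 'I_r,
  2 ^+ 43 * KK R k j * ln eps^-1 * ln N%:R <= (m j)%:R.

Lemma prob_recovery (D : {set 'I_N}) (sg : R) : sparse_supp k D ->
  sg = \sum_(i in ~: D) cmod (coef x i) ->
  1 - kk%:R * eps <= prob R m (fun Om => forall xh,
    is_minimizer (Amx R (\sum_(j < r) m j) Om) (Amx R (\sum_(j < r) m j) Om *m x + e) eta xh ->
    norm2 (x - xh) <= 16389 * (3 * sg + 64 * (E * eta * Num.sqrt kk%:R))).
Proof.
move=> sD sgE; set P : sample r -> Prop := fun Om => _.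
(* In the first case the claimed probability is at most 0; in the second, [ln k <= ln (1/eps)]
   becomes available. *)
case: (leP 1 (kk%:R * eps)) => [k1|kk_eps].
  by apply: le_trans (prob_ge0 P); rewrite subr_le0.
pose pr := @prs R r k m r_gt0; pose Lam := LamP r eps; pose th : R := thP R.
pose sgn i := if i \in D then coef x i / (cmod (coef x i))%:C%C else 0.
pose U w b := Umx R r w b.
pose gd := good U (levf r_gt0) (rlf r_gt0) k D 64 pr th sgn.
have pr_gt0 t : 0 < pr t by exact: prs_gt0.
have pr_le1 t : pr t <= 1 by exact: prs_le1.
have U_coh w i : 2 ^+ rlf r_gt0 w * cmod (U w i) ^+ 2 <= 64 * dk R (rlf r_gt0 w) (levf r_gt0 i) ^+ 2.
  exact: (Umx_coh R r_gt0 w i).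
have U_op (j l : 'I_r) (q : 'I_N -> R[i]) : (forall i, levf r_gt0 i != l -> q i = 0) ->
    \sum_(w | rlf r_gt0 w == j) cmod (\sum_i U w i * q i) ^+ 2
     <= 256 * dk R j l ^+ 2 * \sum_i cmod (q i) ^+ 2.
  by move=> hq; apply: (@Umx_op R r r_gt0 j l q (ltn_ord j) (ltn_ord l)).
have D_sparse (l : 'I_r) : (#|[set i in D | levf r_gt0 i == l]| <= k l)%N by exact: (forallP sD l).
have one_256 : 1 <= 256 :> R by rewrite ler1n.
have gp := @good_prob R _ _ r U (levf r_gt0) (rlf r_gt0) k D 64 256 (ltr0n _ 64) one_256 U_coh kk_gt0
   (stages k) pr Lam th sgn pr_gt0 pr_le1 (LamP_gt0 r_gt0 eps_gt0 eps_le) (thP_ge0 R)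
   (prs_large r_gt0 eps_gt0 eps_le m_range kk_gt0 kk_eps m_large).
pose badS (Om : sample r) := ~~ `[< P Om >].
have tr : #|[set Om | adm (rlf r_gt0) m Om && badS Om]|%:R / #|[set Om | adm (rlf r_gt0) m Om]|%:R
     * bP pr (small (rlf r_gt0) m) <= bP pr (fun f => ~~ gd f).
  apply: transfer => //.
  - exact: prs_lev.
  - by move=> j; rewrite -W_rlf; have [] := m_range j.
  (* A good small selection forces recovery for every family that completes it, since the extra rows
     only add measurements. *)
  move=> f Om fs aOm cO; apply: contra => gf; apply/asboolP => xh xh_min.
  have aOm' : admissible m Om by rewrite (admissible_adm m r_gt0).
  have picked_Om s w : f (s, w) -> w \in Omega Om.
    move=> fsw; rewrite mem_Omega; apply/existsP; exists (rlf r_gt0 w).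
    apply: (fintype.subsetP (forallP cO (rlf r_gt0 w))); rewrite inE eqxx /=.
    by apply/existsP; exists s.
  have f_small (s : 'I_(stages k).+1) j : (#|[set w | (rlf r_gt0 w == j) && f (s, w)]| <= m j)%N.
    apply: leq_trans (forallP fs j); apply: subset_leq_card; apply/fintype.subsetP => w.
    by rewrite !inE => /andP[-> fsw] /=; apply/existsP; exists s.
  have E1 : 1 <= E.
    apply: le_trans (E_ge (Ordinal r_gt0)); rewrite ler_pdivlMr ?(mj_gt0 R m_range) // mul1r ler_nat.
    by have [] := m_range (Ordinal r_gt0).
  have sgn_s : supp D sgn by move=> i iD; rewrite /sgn (negPf iD).
  have sgn_1 i : cmod (sgn i) <= 1.
    by rewrite /sgn; case: ifP => _; [exact: sgn_le1 | rewrite cmod0].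
  have hcone : \sum_(i in ~: D) cmod (coef (xh - x) i)
      <= 2 * sg + cmod (\sum_i (sgn i)^*%C * coef (xh - x) i).
    by rewrite sgE; apply: cone (min_l1 e_le xh_min) => i.
  have dec := stages_decay R kk_gt0.
  have [dec1 dec2] := decay_small dec.
  rewrite min_norm2.
  have B0 : 1 + 2 * Bst 64 = 16389 :> R by rewrite /Bst; ring.
  rewrite -B0.
  apply: (@recovery R _ _ r U (levf r_gt0) (rlf r_gt0) k D 64 256 (ltr0n _ 64) one_256
    (@Umx_ortho R r) U_coh U_op D_sparse kk_gt0 (stages k) pr th f pr_gt0 (thP_ge0 R) (Cth_thP R)
    E eta m (Omega Om) (coef (xh - x)) sgn sg E1 (eta_ge0 e_le)) => //.
  - exact: prs_E.
  - exact: prs_m.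
  - exact: (min_meas r_gt0 e_le aOm' xh_min).
  - exact: (good_fwok_sgn gf).
  - by move=> i _; exact: (good_fwok_ev i gf).
  - by move=> i s _; exact: (good_heavy i s gf).
  - by move=> i s d _; exact: (good_bvd i gf).
have sp := small_prob pr_gt0 pr_le1 (prs_half R k r_gt0 m_range).
have ub := union_bound r_gt0 eps_gt0 eps_le m_range kk_gt0 kk_eps m_large.
rewrite prob_compl.
have eA : [set Om | admissible m Om]%SET = [set Om | adm (rlf r_gt0) m Om]%SET.
  by apply/setP => Om; rewrite !inE (admissible_adm m r_gt0).
have eB : [set Om | admissible m Om && ~~ `[< P Om >]]%SET = [set Om | adm (rlf r_gt0) m Om && badS Om]%SET.
  by apply/setP => Om; rewrite !inE (admissible_adm m r_gt0).
rewrite eA eB; move: tr; set q := _ / _ => tr.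
have q0 : 0 <= q by rewrite divr_ge0.
have N0 : 0 < N%:R :> R by rewrite ltr0n expn_gt0.
have h1 : q * 2^-1 ^+ r <= bP pr (fun f => ~~ gd f).
  by apply: le_trans tr; rewrite ler_wpM2l.
have h2 : q <= N%:R * bP pr (fun f => ~~ gd f).
  by move: h1; rewrite exprVn -natrX ler_pdivrMr // mulrC.
have h3 : q <= eps.
  by apply: le_trans h2 (le_trans _ ub); rewrite ler_wpM2l // ltW.
rewrite lerD2l lerN2; apply: le_trans h3 _.
by rewrite ler_peMl ?(ltW eps_gt0) // ler1n.
Qed.

End Probability.

(** * Assembly of the constants, with the cases [k = 0] and full sampling apart *)

Theorem theorem1 (R : realType) :
  exists C0 C : R, 0 < C0 /\ 0 < C /\
  forall (r : nat) (eps : R) (k m : 'I_r -> nat)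
         (x : 'cV[R[i]]_(2 ^ r)) (eta : R)
         (e : 'cV[R[i]]_(\sum_(j < r) m j)),
    (1 <= r)%N ->
    0 < eps -> eps <= expR (-1) ->
    (forall j : 'I_r, (1 <= m j)%N /\ (m j <= #|W r j|)%N) ->
    (forall j : 'I_r,
        C0 * ((k j)%:R
              + \sum_(l < r | l != j)
                  (Num.sqrt (2 ^+ (maxn j l - minn j l)))^-1 * (k l)%:R)
           * ln (eps^-1) * ln (2 ^ r)%:R
        <= (m j)%:R) ->
    norm2 e <= eta ->
    let kk : nat := (\sum_(j < r) k j)%N in
    let E : R := \big[Num.max/0]_(j < r) ((#|W r j|)%:R / (m j)%:R) in
    let D : R := 1 + Num.sqrt (log2 (6 / eps))
                     / log2 (4 * E * (2 ^ r)%:R * Num.sqrt kk%:R) in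
    let good (Om : sample r) : Prop :=
      let A := Amx R (\sum_(j < r) m j) Om in
      let y := A *m x + e in
      forall xh : 'cV[R[i]]_(2 ^ r), is_minimizer A y eta xh ->
        norm2 (x - xh)
          <= C * (eta * Num.sqrt D * (1 + E * Num.sqrt kk%:R)
                  + sigma_kM k (adjmx (Phi R r) *m x)) in
    prob R m good >= 1 - kk%:R * eps /\
    ((forall j : 'I_r, m j = #|W r j|) -> prob R m good = 1).
Proof.
(* The equation keeps [C] folded. The factor 64 covers both coefficients, 3 and 64, of the bound in
   [prob_recovery]. *)
have [C CE] : exists C : R, C = 16389 * 64 by exists (16389 * 64).
exists (2 ^+ 43), C; split; first by rewrite exprn_gt0.
split; first by rewrite CE; apply: mulr_gt0; rewrite ltr0n.
move=> r eps k m x eta e r_gt0 eps_gt0 eps_le m_range m_large e_le kk E D good.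
have eta0 : 0 <= eta := eta_ge0 e_le.
have E_ge (j : 'I_r) : #|W r j|%:R / (m j)%:R <= E.
  exact: (le_bigmax 0 (fun j : 'I_r => #|W r j|%:R / (m j)%:R : R) j).
have E1 : 1 <= E.
  apply: le_trans (E_ge (Ordinal r_gt0)); rewrite ler_pdivlMr ?(mj_gt0 R m_range) // mul1r ler_nat.
  by have [] := m_range (Ordinal r_gt0).
have E0 : 0 <= E by exact: le_trans ler01 E1.
have Ek0 : 0 <= E * Num.sqrt kk%:R by rewrite mulr_ge0 ?sqrtr_ge0.
have log2_ge0 (y : R) : 1 <= y -> 0 <= log2 y.
  by move=> y1; rewrite /log2 divr_ge0 // ln_ge0 // ler1n.
(* The error bound is established with 1 in place of [Num.sqrt D]. For [kk = 0] the conventions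
   [ln 0 = 0] and division by 0 give [D = 1]. *)
have D1 : 1 <= D.
  rewrite /D lerDl divr_ge0 ?sqrtr_ge0 //.
  case: (posnP kk) => [->|k0]; first by rewrite sqrtr0 mulr0 /log2 ln0 ?mul0r.
  apply: log2_ge0; rewrite -[leLHS]mulr1; apply: ler_pM => //.
    rewrite -[leLHS]mulr1; apply: ler_pM => //; last by rewrite ler1n expn_gt0.
    by rewrite -[leLHS]mulr1; apply: ler_pM => //; rewrite ler1n.
  by rewrite -[leLHS]sqrtr1 ler_wsqrtr // ler1n.
have sD1 : 1 <= Num.sqrt D by rewrite -[leLHS]sqrtr1 ler_wsqrtr.
have [S sS S_le] := best_support k (adjmx (Phi R r) *m x).
set sig := sigma_kM _ _ in S_le good *.
set sg := \sum_(i in ~: S) _ in S_le.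
have sg0 : 0 <= sg by apply: sumr_ge0 => i _; exact: cmod_ge0.
have noise : eta * (1 + E * Num.sqrt kk%:R) <= eta * Num.sqrt D * (1 + E * Num.sqrt kk%:R).
  by rewrite ler_wpM2r ?addr_ge0 // ler_peMr.
have eta_le : eta <= eta * (1 + E * Num.sqrt kk%:R) by rewrite ler_peMr // lerDl.
have enough (y : R) : y <= 16389 * (3 * sg + 64 * (eta * (1 + E * Num.sqrt kk%:R))) ->
    y <= C * (eta * Num.sqrt D * (1 + E * Num.sqrt kk%:R) + sig).
  by move=> hy; apply: le_trans hy _; rewrite CE; lra.
have mW (j : 'I_r) : (m j <= #|W r j|)%N by have [] := m_range j.
split; last first.
  (* An admissible family now consists of the whole bands, so [A] preserves norms and the error is
     at most [2 * eta]. *)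
  move=> m_full; apply: prob_one => // Om aO A y xh xh_min.
  apply: enough; apply: le_trans (full_bound r_gt0 e_le aO xh_min _) _; last by lra.
  apply/setP => w; rewrite mem_Omega inE; apply/existsP; exists (rlf r_gt0 w).
  have /andP[Oj /eqP cO] := forallP aO (rlf r_gt0 w).
  have -> : Om (rlf r_gt0 w) = W r (rlf r_gt0 w).
    by apply/eqP; rewrite eqEcard Oj cO m_full leqnn.
  by rewrite (W_rlf r_gt0) inE.
case: (posnP kk) => [k0|k_gt0].
  rewrite k0 mul0r subr0 prob_one // => Om aO A y xh xh_min.
  apply: enough; apply: le_trans (trivial_bound e_le xh_min) _.
  have -> : \sum_i cmod (coef x i) = sg.
    rewrite /sg; apply: eq_bigl => i; rewrite inE; apply/esym/negP => iS.
    have k0j : k (levf r_gt0 i) = 0%N.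
      by apply/eqP; rewrite -leqn0 -k0 /kk (bigD1 (levf r_gt0 i)) //= leq_addr.
    have := forallP sS (levf r_gt0 i); rewrite k0j leqn0 cards_eq0 => /eqP/setP/(_ i).
    by rewrite !inE iS eqxx.
  by lra.
have m_large' (j : 'I_r) : 2 ^+ 43 * KK R k j * ln eps^-1 * ln (2 ^ r)%:R <= (m j)%:R.
  have -> : KK R k j = (k j)%:R + \sum_(l < r | l != j) dk R j l * (k l)%:R.
    by rewrite /KK (bigD1 j) //= dk_diag mul1r.
  exact: m_large.
have main := @prob_recovery R r eps k m x eta e r_gt0 eps_gt0 eps_le m_range e_le E E_ge k_gt0 m_large' S sg sS (erefl _).
apply: le_trans main _.
rewrite !(prob_compl R m_range) lerD2l lerN2 ler_wpM2r // ler_nat.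
apply: subset_leq_card; apply/fintype.subsetP => Om; rewrite !inE => /andP[-> /=].
apply: contra => /asboolP hP; apply/asboolP => A y xh /hP h.
apply: enough; apply: le_trans h _.
have : E * eta * Num.sqrt kk%:R <= eta * (1 + E * Num.sqrt kk%:R).
  by rewrite [E * eta]mulrC -mulrA ler_wpM2l // lerDr.
by rewrite -/kk; lra.
Qed.
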